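(* (i) For $b\ge 3.062$, $$\min_{z\in\mathbb{H}}\big(\zeta(6,z)-b\zeta(3,z)\big)=\min_{z\in\overline{\mathcal{D}_{\mathcal{G}}}}\big(\zeta(6,z)-b\zeta(3,z)\big)=\min_{z\in\Gamma}\big(\zeta(6,z)-b\zeta(3,z)\big).$$ (ii) For $b\ge 3$, $$\min_{z\in\overline{\mathcal{D}_{\mathcal{G}}}\cap\{\Im z\ge1\}}\big(\zeta(6,z)-b\zeta(3,z)\big)=\min_{z\in\Gamma_a}\big(\zeta(6,z)-b\zeta(3,z)\big).$$
   Context: $\mathbb{H}=\{z=x+iy: y>0\}$. For $s>1$, $\zeta(s,z)=\sum_{(m,n)\in\mathbb{Z}^2\setminus\{0\}}\frac{(\Im z)^s}{|mz+n|^{2s}}$. $\mathcal{D}_{\mathcal{G}}=\{z\in\mathbb{H}: |z|>1,\ 0<\Re z<\frac12\}$. $\Gamma_a=\{z\in\mathbb{H}:\Re z=0,\ \Im z\ge1\}$, $\Gamma_b=\{z\in\mathbb{H}: |z|=1,\ \Im z\in[\frac{\sqrt3}{2},1]\}$, $\Gamma=\Gamma_a\cup\Gamma_b$. *)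

(* Defs.v *)
From Stdlib Require Import Reals.
From Coquelicot Require Import Coquelicot.
Open Scope R_scope.

(* A point z = x + i y of the upper half plane is represented by (x, y), y > 0. *)

(* Summand of the Epstein zeta function at (m,n) in Z^2 \ {0}:
   (Im z)^s / |m z + n|^(2s), with |m z + n|^2 = (m x + n)^2 + (m y)^2. *)
Definition zeta_term (s x y : R) (m n : Z) : R :=
  if (Z.eqb m 0 && Z.eqb n 0)%bool then 0
  else Rpower y s / Rpower ((IZR m * x + IZR n)^2 + (IZR m * y)^2) s.

Definition zeta_partial (s x y : R) (N : nat) : R :=
  sum_f_R0 (fun i =>
    sum_f_R0 (fun j =>
      zeta_term s x y (Z.of_nat i - Z.of_nat N)%Z (Z.of_nat j - Z.of_nat N)%Z)
      (2 * N)) (2 * N).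

(* zeta(s,z) = sum over Z^2\{0}; the terms are nonnegative, so this is the
   (monotone) limit of the square partial sums. *)
Definition zeta (s x y : R) : R := real (Lim_seq (zeta_partial s x y)).

Definition Eb (b x y : R) : R := zeta 6 x y - b * zeta 3 x y.

Definition upper_half (x y : R) : Prop := 0 < y.

(* closure of D_G = {|z| > 1, 0 < Re z < 1/2} (closure in H, equivalently in C) *)
Definition DG_closure (x y : R) : Prop :=
  0 < y /\ 1 <= x^2 + y^2 /\ 0 <= x /\ x <= 1/2.

Definition Gamma_a (x y : R) : Prop := x = 0 /\ 1 <= y.
Definition Gamma_b (x y : R) : Prop :=
  0 < y /\ x^2 + y^2 = 1 /\ sqrt 3 / 2 <= y /\ y <= 1.
Definition Gamma (x y : R) : Prop := Gamma_a x y \/ Gamma_b x y.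

Definition is_min_on (S : R -> R -> Prop) (f : R -> R -> R) (m : R) : Prop :=
  (exists x y, S x y /\ f x y = m) /\ (forall x y, S x y -> m <= f x y).

(* Main.v *)
Require Import Defs.
From Stdlib Require Import Reals Lra Lia Psatz ZArith Machin Factorial.
From Coquelicot Require Import Coquelicot.
Open Scope R_scope.

(** Fourier expansion in x. Summing |mz+n|^(-2s) over n for fixed m <> 0 gives, by Poisson summation,
    zeta(s,z) = A_s y^s + V_s y^(1-s) + sum over m,k >= 1 of W_s(m,k) cos(2 pi k m x), where for
    s = 3, 6 the coefficients W_s are elementary (Bessel functions of half-integer order). The case
    s = 1 of Poisson summation is the partial fraction expansion of sinh b / (cosh b - cos a), which
    follows from its triplication formula; higher s follow by applying -(1/y) d/dy termwise.

    Since |cos j t - cos j t'| <= j^2 |cos t - cos t'|, comparing z with z' at the same height reduces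
    to the modes (m,k) = (1,1), (1,2) plus an explicit error, hence to an inequality in y alone. It
    shows that zeta(6) - b zeta(3) increases with x on [0,1/2] for y >= 1, b >= 3, and to the right of
    the unit circle for 0.877 <= y <= 1, b >= 3.062. For b = 3.062 it is
    nearly an equality at exp(i pi/3), but in a box around that point the value exceeds the one at
    z = i by about 0.05, so direct estimates suffice there. *)

(** At b = 3.062 the horizontal comparison has almost no room left near exp(i pi/3), so it stops at
    height 0.877. The points of the fundamental domain below that height have x >= 0.48 and lie in
    the box, where the comparison is with the value at i instead.

    Only finite differences in x occur. Every mode contributes a multiple of cos t - cos t', which
    is divided out, so no series is differentiated in x. The remaining inequality in y is linear in
    b with a nonnegative left side, so it is checked only at b = 3 and b = 3.062, by rational bounds
    on finitely many intervals of 1/(2 pi y).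

    Triplication suits sums over Z better than duplication: a symmetric window of integers splits
    exactly into the residues -1, 0, 1 modulo 3, so the rescaled arguments stay near one period and
    meet a single pole.

    Attainment is a separate matter: the arc is compact, and on the imaginary axis y^6 beats y^3.
    Continuity is therefore needed only along these two curves. *)

(** * Symmetric sums over Z and series of nonnegative terms *)

Definition zsum (g : Z -> R) (N : nat) : R :=
  sum_f_R0 (fun j => g (Z.of_nat j - Z.of_nat N)%Z) (2 * N).

(** Pairing n with -n turns a sum over Z into a series over [nat], whose ordinary partial sums are
    the symmetric sums [zsum]. *)
Definition zfold (g : Z -> R) (j : nat) : R :=
  match j with
  | O => g 0%Z
  | S _ => g (Z.of_nat j) + g (- Z.of_nat j)%Z
  end.

Lemma zsum_zfold (g : Z -> R) (N : nat) : zsum g N = sum_f_R0 (zfold g) N.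
Proof.
  induction N as [|N IH].
  - reflexivity.
  - rewrite tech5, <- IH. unfold zsum.
    replace (2 * S N)%nat with (S (S (2 * N))) by lia.
    rewrite tech5.
    rewrite (decomp_sum _ (S (2 * N))) by lia.
    change (pred (S (2 * N))) with (2 * N)%nat. change (Z.of_nat 0) with 0%Z.
    rewrite (sum_eq (fun i => g (Z.of_nat (S i) - Z.of_nat (S N))%Z)
               (fun i => g (Z.of_nat i - Z.of_nat N)%Z)).
    + unfold zfold.
      replace (0 - Z.of_nat (S N))%Z with (- Z.of_nat (S N))%Z by lia.
      replace (Z.of_nat (S (S (2 * N))) - Z.of_nat (S N))%Z with (Z.of_nat (S N)) by lia.
      lra.
    + intros i _. f_equal. lia.
Qed.

Lemma zfold_ext (f g : Z -> R) (j : nat) : (forall n, f n = g n) -> zfold f j = zfold g j.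
Proof. intros H; destruct j; simpl; rewrite ?H; reflexivity. Qed.

Lemma zfold_nonneg (g : Z -> R) (j : nat) : (forall n, 0 <= g n) -> 0 <= zfold g j.
Proof.
  intros H; destruct j; unfold zfold; [apply H|].
  generalize (H (Z.of_nat (S j))), (H (- Z.of_nat (S j))%Z); lra.
Qed.

Lemma zfold_scal (c : R) (g : Z -> R) (j : nat) : zfold (fun n => c * g n) j = c * zfold g j.
Proof. destruct j; unfold zfold; ring. Qed.

Lemma zsum_ext (f g : Z -> R) (N : nat) : (forall n, f n = g n) -> zsum f N = zsum g N.
Proof. intros H; apply sum_eq; intros i _; apply H. Qed.

Lemma zsum_le (f g : Z -> R) (N : nat) : (forall n, f n <= g n) -> zsum f N <= zsum g N.
Proof. intros H; apply sum_Rle; intros i _; apply H. Qed.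

Lemma zsum_scal (c : R) (g : Z -> R) (N : nat) : zsum (fun n => c * g n) N = c * zsum g N.
Proof. unfold zsum. rewrite scal_sum. apply sum_eq; intros; ring. Qed.

Lemma zsum_plus (f g : Z -> R) (N : nat) :
  zsum (fun n => f n + g n) N = zsum f N + zsum g N.
Proof. unfold zsum. apply sum_plus. Qed.

Lemma zsum_S (g : Z -> R) (N : nat) :
  zsum g (S N) = zsum g N + (g (Z.of_nat (S N)) + g (- Z.of_nat (S N))%Z).
Proof. rewrite !zsum_zfold, tech5. reflexivity. Qed.

Lemma zsum_opp (g : Z -> R) (N : nat) : zsum (fun n => g (- n)%Z) N = zsum g N.
Proof.
  induction N as [|N IH]; [reflexivity|].
  rewrite !zsum_S, IH, Z.opp_involutive. lra.
Qed.

Lemma sum_f_R0_mono (a : nat -> R) (n m : nat) :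
  (forall i, 0 <= a i) -> (n <= m)%nat -> sum_f_R0 a n <= sum_f_R0 a m.
Proof.
  intros Ha H; induction H; [lra|]. rewrite tech5. generalize (Ha (S m)); lra.
Qed.

Lemma zsum_mono (g : Z -> R) (n m : nat) :
  (forall i, 0 <= g i) -> (n <= m)%nat -> zsum g n <= zsum g m.
Proof.
  intros Hg H. rewrite !zsum_zfold. apply sum_f_R0_mono; auto.
  intros; apply zfold_nonneg; auto.
Qed.

Lemma zsum_nonneg (g : Z -> R) (n : nat) : (forall i, 0 <= g i) -> 0 <= zsum g n.
Proof. intros; apply cond_pos_sum; auto. Qed.

Lemma is_series_lim_sum_f_R0 (a : nat -> R) (l : R) :
  is_series a l <-> is_lim_seq (sum_f_R0 a) l.
Proof.
  split; intros H.
  - apply is_lim_seq_ext with (sum_n a); [intros; apply sum_n_Reals|exact H].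
  - apply is_lim_seq_ext with (v := sum_n a) in H; [exact H|].
    intros; symmetry; apply sum_n_Reals.
Qed.

Lemma partial_le_series (a : nat -> R) (l : R) (n : nat) :
  (forall i, 0 <= a i) -> is_series a l -> sum_f_R0 a n <= l.
Proof.
  intros Ha H. apply is_series_lim_sum_f_R0 in H.
  apply (is_lim_seq_incr_compare _ _ H). intros k. rewrite tech5. generalize (Ha (S k)); lra.
Qed.

Lemma is_lim_seq_sum_f_R0 (u : nat -> nat -> R) (l : nat -> R) (M : nat) :
  (forall m, is_lim_seq (u m) (l m)) ->
  is_lim_seq (fun N => sum_f_R0 (fun m => u m N) M) (sum_f_R0 l M).
Proof.
  intros H; induction M as [|M IH]; simpl; [apply H|].
  apply is_lim_seq_plus'; auto.
Qed.

(* Fubini for nonnegative families, with squares as the exhausting sets. *)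
Lemma square_sums_converge (a : nat -> nat -> R) (r : nat -> R) (L : R) :
  (forall m n, 0 <= a m n) ->
  (forall m, is_series (a m) (r m)) -> is_series r L ->
  is_lim_seq (fun N => sum_f_R0 (fun m => sum_f_R0 (a m) N) N) L.
Proof.
  intros Ha Hr HL.
  assert (Hr0 : forall m, 0 <= r m).
  { intros m. apply Rle_trans with (sum_f_R0 (a m) 0); [apply Ha|].
    apply partial_le_series; auto. }
  assert (Hup : forall N, sum_f_R0 (fun m => sum_f_R0 (a m) N) N <= L).
  { intros N. apply Rle_trans with (sum_f_R0 r N).
    - apply sum_Rle; intros m _. apply partial_le_series; auto.
    - apply partial_le_series; auto. }
  apply is_lim_seq_spec. intros eps.
  assert (HL' := HL). apply is_series_lim_sum_f_R0 in HL'.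
  apply is_lim_seq_spec in HL'.
  destruct (HL' (pos_div_2 eps)) as [M HM].
  (* The first M rows carry L up to eps/2, and finitely many rows converge simultaneously. A square
     of side at least M contains the resulting rectangle. *)
  assert (H1 : is_lim_seq (fun N => sum_f_R0 (fun m => sum_f_R0 (a m) N) M) (sum_f_R0 r M)).
  { apply (is_lim_seq_sum_f_R0 (fun m N => sum_f_R0 (a m) N)).
    intros m. apply is_series_lim_sum_f_R0, Hr. }
  apply is_lim_seq_spec in H1.
  destruct (H1 (pos_div_2 eps)) as [N0 HN0].
  exists (max M N0). intros N HN.
  specialize (HN0 N ltac:(lia)). specialize (HM M ltac:(lia)).
  specialize (Hup N). simpl in HN0, HM.
  assert (H2 : sum_f_R0 (fun m => sum_f_R0 (a m) N) M <= sum_f_R0 (fun m => sum_f_R0 (a m) N) N).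
  { apply sum_f_R0_mono; [|lia]. intros; apply cond_pos_sum; auto. }
  apply Rabs_def2 in HN0. apply Rabs_def2 in HM. apply Rabs_def1; lra.
Qed.

Lemma zsum_square_converge (f : Z -> Z -> R) (r : Z -> R) (L : R) :
  (forall m n, 0 <= f m n) ->
  (forall m, is_series (zfold (f m)) (r m)) -> is_series (zfold r) L ->
  is_lim_seq (fun N => zsum (fun m => zsum (f m) N) N) L.
Proof.
  intros Hf Hr HL.
  apply is_lim_seq_ext with
    (fun N => sum_f_R0 (fun m => sum_f_R0 (fun n => zfold (fun m => zfold (f m) n) m) N) N).
  - intros N. rewrite zsum_zfold. apply sum_eq. intros m _. destruct m as [|m]; unfold zfold at 1 3.
    + rewrite zsum_zfold. apply sum_eq; reflexivity.
    + rewrite !zsum_zfold, <- sum_plus. apply sum_eq; reflexivity.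
  - apply square_sums_converge with (r := zfold r); auto.
    + intros m n. apply zfold_nonneg; intros; apply zfold_nonneg; auto.
    + intros [|m]; unfold zfold at 1 3.
      * apply Hr.
      * apply (is_series_plus (zfold (f (Z.of_nat (S m)))) (zfold (f (- Z.of_nat (S m))%Z))); apply Hr.
Qed.

Lemma is_series_Rmult_l (c : R) (a : nat -> R) (l : R) :
  is_series a l -> is_series (fun i => c * a i) (c * l).
Proof. exact (is_series_scal (V := R_NormedModule) c a l). Qed.

Lemma ex_series_Rmult_l (c : R) (a : nat -> R) :
  ex_series a -> ex_series (fun i => c * a i).
Proof. exact (ex_series_scal (V := R_NormedModule) c a). Qed.

Lemma ex_series_Rplus (a b : nat -> R) :
  ex_series a -> ex_series b -> ex_series (fun i => a i + b i).
Proof. exact (ex_series_plus (V := R_NormedModule) a b). Qed.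

Lemma ex_series_Rminus (a b : nat -> R) :
  ex_series a -> ex_series b -> ex_series (fun i => a i - b i).
Proof. exact (ex_series_minus (V := R_NormedModule) a b). Qed.

Lemma Series_nonneg (a : nat -> R) : (forall i, 0 <= a i) -> ex_series a -> 0 <= Series a.
Proof.
  intros Ha H. apply Rle_trans with (sum_f_R0 a 0); [apply Ha|].
  apply partial_le_series; [assumption|apply Series_correct; assumption].
Qed.

Lemma is_series_cons (a : nat -> R) (l : R) :
  is_series (fun k => a (S k)) l -> is_series a (a O + l).
Proof.
  intros H. apply is_series_decr_1.
  change (plus (a O + l) (opp (a O))) with (a O + l + - a O).
  replace (a O + l + - a O) with l by ring. exact H.
Qed.

(** * The Poisson kernel *)
Lemma nonneg_derivative_le (f f' : R -> R) (x : R) :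
  0 <= x -> (forall t, is_derive f t (f' t)) -> (forall t, 0 <= t -> 0 <= f' t) ->
  f 0 <= f x.
Proof.
  intros Hx Hd Hp.
  destruct (MVT_gen f 0 x f') as [c [Hc He]].
  - intros; apply Hd.
  - intros t _. apply derivable_continuous_pt. exists (f' t). apply is_derive_Reals, Hd.
  - rewrite Rmin_left, Rmax_right in Hc by lra.
    assert (0 <= f' c * (x - 0)) by (apply Rmult_le_pos; [apply Hp; lra|lra]). lra.
Qed.

Definition exp_neg_partial (n : nat) (x : R) : R :=
  sum_f_R0 (fun k => (- x) ^ k / INR (fact k)) n.

Lemma is_derive_exp_neg_partial (n : nat) (x : R) :
  is_derive (exp_neg_partial (S n)) x (- exp_neg_partial n x).
Proof.
  induction n as [|n IH].
  - unfold exp_neg_partial; simpl. auto_derive; [auto|field].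
  - apply is_derive_ext with
      (fun x => exp_neg_partial (S n) x + (- x) ^ (S (S n)) / INR (fact (S (S n)))).
    { intros t. unfold exp_neg_partial. rewrite (tech5 _ (S n)). reflexivity. }
    replace (- exp_neg_partial (S n) x) with
      (- exp_neg_partial n x + - ((- x) ^ (S n) / INR (fact (S n)))).
    2:{ unfold exp_neg_partial. rewrite tech5. ring. }
    apply (is_derive_plus (V := R_NormedModule)); [exact IH|].
    evar_last.
    { apply (is_derive_ext (fun x => / INR (fact (S (S n))) * (- x) ^ (S (S n)))).
      { intros t. unfold Rdiv. apply Rmult_comm. }
      apply is_derive_scal, is_derive_pow. auto_derive; [auto|reflexivity]. }
    change (pred (S (S n))) with (S n).
    rewrite (fact_simpl (S n)), mult_INR.
    assert (INR (fact (S n)) <> 0) by apply INR_fact_neq_0.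
    assert (INR (S (S n)) <> 0) by (apply not_0_INR; lia).
    field; auto.
Qed.

(** The remainders vanish at 0 and the derivative of each is minus the preceding one, so their signs
    alternate by integration. The rational bounds on exp(-t) used later come from orders 5 and 6. *)
Lemma exp_neg_alternating (n : nat) (x : R) :
  0 <= x -> 0 <= (- 1) ^ n * (exp_neg_partial n x - exp (- x)).
Proof.
  revert x; induction n as [|n IH]; intros x Hx.
  - unfold exp_neg_partial; simpl.
    assert (exp (- x) <= exp 0) by (destruct (Req_dec x 0) as [->|]; [rewrite Ropp_0; lra|left; apply exp_increasing; lra]). rewrite exp_0 in *. lra.
  - assert (H := nonneg_derivative_le
      (fun t => (-1) ^ (S n) * (exp_neg_partial (S n) t - exp (- t)))
      (fun t => (-1) ^ n * (exp_neg_partial n t - exp (- t))) x Hx).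
    simpl in H.
    replace (-1 * (-1) ^ n * (exp_neg_partial (S n) 0 - exp (- 0))) with 0 in H.
    { apply H; [|exact IH]. intros t.
      evar_last.
      - apply is_derive_scal, (is_derive_minus (V := R_NormedModule)).
        + apply is_derive_exp_neg_partial.
        + apply is_derive_comp; [apply is_derive_exp|auto_derive; [auto|reflexivity]].
      - unfold minus, plus, opp, scal; simpl. unfold mult; simpl. ring. }
    replace (exp_neg_partial (S n) 0) with 1; [rewrite Ropp_0, exp_0; ring|].
    unfold exp_neg_partial. rewrite decomp_sum by lia.
    rewrite (sum_eq _ (fun _ => 0)); [rewrite sum_cte; simpl; field|].
    intros i _. rewrite Ropp_0, pow_i by lia. unfold Rdiv; ring.
Qed.

Lemma exp_neg_lower (x : R) : 0 <= x -> 1 - x + x^2/2 - x^3/6 <= exp (- x).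
Proof. intros H. generalize (exp_neg_alternating 3 x H). unfold exp_neg_partial; simpl. lra. Qed.

Lemma exp_upper (u : R) : 0 <= u <= 1 -> exp u <= 1 + u + u^2/2 + u^3.
Proof.
  intros H. generalize (exp_neg_lower u (proj1 H)). intros H1.
  assert (H2 : exp (- u) * exp u = 1) by (rewrite <- exp_plus, Rplus_opp_l; apply exp_0).
  assert (H3 := exp_pos u).
  (* The lower bound for exp(-u) turns into an upper bound for exp(u) as soon as the product of the
     two polynomials is at least 1. *)
  assert (H4 : 1 <= (1 - u + u^2/2 - u^3/6) * (1 + u + u^2/2 + u^3)).
  { assert (0 <= u^3 * (5/6 - 11/12 * u + 5/12 * u^2 - u^3/6)).
    { apply Rmult_le_pos; [apply pow_le; lra|]. nra. }
    lra. }
  assert (H5 : 0 < 1 - u + u^2/2 - u^3/6) by nra.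
  nra.
Qed.

Lemma sinh_bounds (u : R) : 0 <= u <= 1 -> u <= sinh u <= u + u^3.
Proof.
  intros H. unfold sinh. generalize (exp_upper u H), (exp_neg_lower u (proj1 H)).
  intros H1 H2. split.
  - generalize (nonneg_derivative_le (fun t => exp t - exp (- t) - 2 * t)
      (fun t => exp t + exp (-t) - 2) u (proj1 H)). simpl. intros H3.
    assert (exp 0 - exp (- 0) - 2 * 0 <= exp u - exp (- u) - 2 * u).
    { apply H3.
      - intros t. auto_derive; [auto|ring].
      - intros t _. assert (exp t * exp (- t) = 1) by (rewrite <- exp_plus, Rplus_opp_r; apply exp_0).
        generalize (exp_pos t), (exp_pos (- t)). intros.
        apply Rnot_lt_le. intros C. assert (0 <= (exp t - exp (- t))^2) by apply pow2_ge_0. nra. }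
    rewrite Ropp_0 in H0. lra.
  - nra.
Qed.

Lemma cosh_double (u : R) : cosh (2 * u) = 1 + 2 * (sinh u)^2.
Proof.
  unfold cosh, sinh.
  replace (2 * u) with (u + u) by ring. replace (- (u + u)) with (- u + - u) by ring.
  rewrite !exp_plus.
  assert (exp u * exp (- u) = 1) by (rewrite <- exp_plus, Rplus_opp_r; apply exp_0).
  nra.
Qed.

Lemma cosh_bounds (b : R) : 0 <= b <= 1 -> 1 + b^2/2 <= cosh b <= 1 + b^2/2 + b^4.
Proof.
  intros H. set (u := b/2). replace b with (2 * u) by (unfold u; field).
  rewrite cosh_double.
  assert (Hu : 0 <= u <= 1/2) by (unfold u; lra).
  destruct (sinh_bounds u) as [H1 H2]; [lra|].
  assert (u^2 <= (sinh u)^2) by (apply pow_incr; split; lra).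
  assert ((sinh u)^2 <= (u + u^3)^2) by (apply pow_incr; split; lra).
  assert (H4 : 0 <= u^4) by (apply pow_le; lra).
  assert (u^6 <= u^4).
  { replace (u^6) with (u^4 * (u*u)) by ring.
    rewrite <- (Rmult_1_r (u^4)) at 2. apply Rmult_le_compat_l; nra. }
  replace ((u + u^3)^2) with (u^2 + 2 * u^4 + u^6) in * by ring.
  replace ((2 * u)^2) with (4 * u^2) by ring. replace ((2 * u)^4) with (16 * u^4) by ring.
  lra.
Qed.

Lemma sin_lower (u : R) : 0 <= u -> u - u^3/6 <= sin u.
Proof.
  intros Hu.
  assert (Hs : forall t, 0 <= t -> sin t <= t).
  { intros t Ht. generalize (nonneg_derivative_le (fun t => t - sin t) (fun t => 1 - cos t) t Ht).
    simpl. rewrite sin_0. intros H.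
    assert (0 - 0 <= t - sin t); [|lra]. apply H.
    - intros v; auto_derive; [auto|ring].
    - intros v _. generalize (COS_bound v); lra. }
  assert (Hc : forall t, 0 <= t -> 1 - t^2/2 <= cos t).
  { intros t Ht. generalize (nonneg_derivative_le (fun t => cos t - 1 + t^2/2) (fun t => t - sin t) t Ht).
    simpl. rewrite cos_0. intros H.
    assert (1 - 1 + 0 * (0 * 1) / 2 <= cos t - 1 + t * (t * 1)/2); [|lra]. apply H.
    - intros v; auto_derive; [auto|field].
    - intros v Hv. generalize (Hs v Hv); lra. }
  generalize (nonneg_derivative_le (fun t => sin t - t + t^3/6) (fun t => cos t - 1 + t^2/2) u Hu).
  simpl. rewrite sin_0. intros H.
  assert (0 - 0 + 0 * (0 * (0 * 1)) / 6 <= sin u - u + u * (u * (u * 1))/6); [|lra]. apply H.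
  - intros v; auto_derive; [auto|field].
  - intros v Hv. generalize (Hc v Hv); lra.
Qed.

(** The interval contains the rescaled arguments of the triadic sums, of modulus at most 16/5 + 1/2.
    The bound a^2/18 keeps the denominator of the kernel away from 0 on all of it; the other two are
    sharp at 0. *)
Lemma one_minus_cos_bounds (a : R) : -4 <= a <= 4 ->
  a^2/18 <= 1 - cos a /\ a^2/2 - a^4/24 <= 1 - cos a <= a^2/2.
Proof.
  intros Ha.
  assert (H : forall t, 0 <= t <= 4 ->
    t^2/18 <= 1 - cos t /\ t^2/2 - t^4/24 <= 1 - cos t <= t^2/2).
  { clear a Ha. intros a Ha.
    set (u := a/2). replace a with (2 * u) by (unfold u; field).
    assert (Hu : 0 <= u <= 2) by (unfold u; lra).
    rewrite cos_2a_sin.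
    assert (H1 := sin_lower u (proj1 Hu)).
    assert (H2 : sin u <= u).
    { destruct (Req_dec u 0) as [->|]; [rewrite sin_0; lra|].
      left; apply sin_lt_x; lra. }
    (* Equivalent to u^2 <= 4, which is the range of u; then 2 (u/3)^2 = a^2/18. *)
    assert (H3 : u / 3 <= u - u^3/6) by nra.
    assert (H4 : (u - u^3/6)^2 <= (sin u)^2) by (apply pow_incr; nra).
    assert (H5 : (u / 3)^2 <= (sin u)^2) by (apply pow_incr; nra).
    assert (H6 : (sin u)^2 <= u^2) by (apply pow_incr; nra).
    assert (0 <= u^6) by (apply pow_le; lra).
    nra. }
  destruct (Rle_dec 0 a); [apply H; lra|].
  rewrite <- cos_neg. replace (a^2) with ((-a)^2) by ring. replace (a^4) with ((-a)^4) by ring.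
  apply H; lra.
Qed.

(* The Poisson kernel (1-r^2)/(1-2r cos a+r^2) at r = exp(-b). *)
Definition poisson_kernel (a b : R) : R := sinh b / (cosh b - cos a).

Lemma cosh_gt_1 (b : R) : 0 < b -> 1 < cosh b.
Proof.
  intros H. replace b with (2 * (b / 2)) by field. rewrite cosh_double.
  assert (0 < sinh (b / 2)).
  { unfold sinh. assert (exp (- (b/2)) < exp (b/2)) by (apply exp_increasing; lra). lra. }
  nra.
Qed.

(** Both functions have the same leading behaviour at a = b = 0. With w = a^2 + b^2, the numerator
    of the difference is at most 3 b w^2 and its denominator at least w^2/18, which gives even 54 b.
    The factor b in the bound is what makes the summed error vanish under rescaling. *)
Lemma poisson_kernel_near_pole (a b : R) : -4 <= a <= 4 -> 0 < b <= 1 ->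
  Rabs (poisson_kernel a b - 2 * b / (a^2 + b^2)) <= 60 * b.
Proof.
  intros Ha Hb. destruct (one_minus_cos_bounds a Ha) as [H1 [H2 H3]].
  destruct (sinh_bounds b) as [S1 S2]; [lra|].
  destruct (cosh_bounds b) as [C1 C2]; [lra|].
  unfold poisson_kernel.
  assert (0 < b^2) by (apply pow_lt; lra).
  set (D := cosh b - cos a).
  assert (HD : (a^2 + b^2)/18 <= D) by (unfold D; lra).
  set (w := a^2 + b^2) in *.
  assert (Hw : 0 < w) by (unfold w; nra).
  replace (sinh b / D - 2 * b / w) with ((sinh b * w - 2 * b * D) / (D * w)) by (field; lra).
  unfold Rdiv. rewrite Rabs_mult, (Rabs_right (/ (D * w))).
  2:{ apply Rle_ge, Rlt_le, Rinv_0_lt_compat, Rmult_lt_0_compat; lra. }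
  apply Rmult_le_reg_r with (D * w); [apply Rmult_lt_0_compat; lra|].
  rewrite Rmult_assoc, Rinv_l by (apply Rgt_not_eq, Rmult_lt_0_compat; lra).
  rewrite Rmult_1_r.
  apply Rle_trans with (60 * b * (w / 18 * w)).
  2:{ repeat apply Rmult_le_compat_l; try lra. apply Rmult_le_compat_r; lra. }
  assert (Hb2 : b^2 <= w) by (unfold w; nra).
  assert (Ha2 : a^2 <= w) by (unfold w; nra).
  assert (Hww : b^2 * w <= w * w) by (apply Rmult_le_compat_r; lra).
  assert (Hb4 : b^4 <= w * w) by (replace (b^4) with (b^2*b^2) by ring; apply Rmult_le_compat; nra).
  assert (Ha4 : a^4 <= w * w) by (replace (a^4) with (a^2*a^2) by ring; apply Rmult_le_compat; nra).
  assert (E : sinh b * w - 2 * b * D =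
    (sinh b - b) * w - 2 * b * ((cosh b - 1 - b^2/2) - (a^2/2 - (1 - cos a)))).
  { unfold D, w. field. }
  rewrite E.
  assert (P1 : 0 <= (sinh b - b) * w <= b * (w * w)).
  { split; [apply Rmult_le_pos; lra|]. apply Rle_trans with (b^3 * w).
    - apply Rmult_le_compat_r; lra.
    - replace (b^3 * w) with (b * (b^2 * w)) by ring. apply Rmult_le_compat_l; lra. }
  assert (P2 : - (w*w) <= (cosh b - 1 - b^2/2) - (a^2/2 - (1 - cos a)) <= w * w) by lra.
  assert (P3 : - (b * (w*w)) <= b * ((cosh b - 1 - b^2/2) - (a^2/2 - (1 - cos a))) <= b * (w * w)).
  { split; [|apply Rmult_le_compat_l; lra].
    replace (- (b * (w * w))) with (b * - (w * w)) by ring. apply Rmult_le_compat_l; lra. }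
  apply Rabs_le. lra.
Qed.

(** Logarithmic derivative in u of cosh 3u - cos 3t = 4 (C - c)(C - c1)(C - c2), where C = cosh u
    and c, c1, c2 are the cosines of t and t -+ 2 pi/3, the roots of 4 X^3 - 3 X = cos 3t. [F] is
    this factorization; [G] is its derivative in C, up to the factor 4. *)
Lemma poisson_kernel_triple (a b : R) : 0 < b ->
  poisson_kernel a b =
  / 3 * (poisson_kernel ((a - 2 * PI) / 3) (b / 3) + poisson_kernel (a / 3) (b / 3)
       + poisson_kernel ((a + 2 * PI) / 3) (b / 3)).
Proof.
  intros Hb. unfold poisson_kernel.
  set (t := a / 3). set (u := b / 3).
  replace ((a - 2 * PI) / 3) with (t - 2 * (PI / 3)) by (unfold t; field).
  replace ((a + 2 * PI) / 3) with (t + 2 * (PI / 3)) by (unfold t; field).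
  replace a with (2 * t + t) by (unfold t; field).
  replace b with (u + u + u) by (unfold u; field).
  assert (Hu : 1 < cosh u) by (apply cosh_gt_1; unfold u; lra).
  assert (Hs : sinh (u + u + u) = sinh u * (4 * (cosh u)^2 - 1)).
  { unfold sinh, cosh. rewrite !Ropp_plus_distr, !exp_plus.
    assert (exp u * exp (- u) = 1) by (rewrite <- exp_plus, Rplus_opp_r; apply exp_0).
    set (p := exp u) in *. set (q := exp (- u)) in *.
    replace (p * p * p - q * q * q) with ((p - q) * (p * p + q * q + 1)) by (rewrite <- H; ring).
    replace (4 * ((p + q)/2)^2 - 1) with (p * p + q * q + 1) by (field_simplify; nra). field. }
  assert (Hc : cosh (u + u + u) = 4 * (cosh u)^3 - 3 * cosh u).
  { unfold sinh, cosh. rewrite !Ropp_plus_distr, !exp_plus.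
    assert (exp u * exp (- u) = 1) by (rewrite <- exp_plus, Rplus_opp_r; apply exp_0).
    set (p := exp u) in *. set (q := exp (- u)) in *.
    replace (4 * ((p + q) / 2) ^ 3 - 3 * ((p + q) / 2)) with
     ((p*p*p + q*q*q)/2 + 3/2 * (p + q) * (p * q - 1)) by field. rewrite H. field. }
  rewrite Hs, Hc.
  assert (Ht : cos (2 * t + t) = 4 * (cos t)^3 - 3 * cos t).
  { rewrite cos_plus, cos_2a, sin_2a. generalize (sin2_cos2 t). unfold Rsqr. intros H.
    replace (sin t * sin t) with (1 - cos t * cos t) by lra.
    replace (2 * sin t * cos t * sin t) with (2 * cos t * (sin t * sin t)) by ring.
    replace (sin t * sin t) with (1 - cos t * cos t) by lra. ring. }
  assert (B0 : -1 <= cos t <= 1) by apply COS_bound.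
  assert (B1 := COS_bound (t - 2 * (PI / 3))). assert (B2 := COS_bound (t + 2 * (PI / 3))).
  assert (B3 := COS_bound (2 * t + t)). rewrite Ht in *.
  assert (Hpi3 : cos (2 * (PI / 3)) = - / 2 /\ sin (2 * (PI / 3)) = sqrt 3 / 2).
  { split; [rewrite cos_2PI3; lra|rewrite sin_2PI3; lra]. }
  destruct Hpi3 as [E1 E2].
  rewrite cos_minus, cos_plus, E1, E2 in *.
  assert (Hss : (sin t)^2 = 1 - (cos t)^2).
  { generalize (sin2_cos2 t). unfold Rsqr. intros; lra. }
  assert (H3 : (sqrt 3)^2 = 3) by (apply pow2_sqrt; lra).
  set (C := cosh u) in *. set (c := cos t) in *. set (s := sin t) in *. set (q := sqrt 3) in *.
  set (c1 := c * - / 2 + s * (q / 2)) in *. set (c2 := c * - / 2 - s * (q / 2)) in *.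
  assert (Q : s ^2 * q^2 = 3 * (1 - c^2)) by (rewrite Hss, H3; ring).
  assert (F : 4 * C ^ 3 - 3 * C - (4 * c ^ 3 - 3 * c) = 4 * (C - c) * (C - c1) * (C - c2)).
  { replace (4 * (C - c) * (C - c1) * (C - c2)) with
      ((C - c) * (4 * (C + c/2)^2 - (s^2 * q^2))) by (unfold c1, c2; field).
    rewrite Q. field. }
  rewrite F.
  assert (G : (C - c) * (C - c1) + (C - c) * (C - c2) + (C - c1) * (C - c2) = 3 * C^2 - 3/4).
  { replace ((C - c) * (C - c1) + (C - c) * (C - c2) + (C - c1) * (C - c2)) with
     (3 * C^2 - 3/4 * c^2 - (s^2 * q^2)/4) by (unfold c1, c2; field). rewrite Q; field. }
  replace (4 * C^2 - 1) with (4/3 * (3 * C^2 - 3/4)) by field. rewrite <- G.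
  clearbody c1 c2. field. repeat split; lra.
Qed.

Lemma zsum_triple (g : Z -> R) (N : nat) :
  zsum g (3 * N + 1) = zsum (fun i => g (3 * i - 1)%Z + g (3 * i)%Z + g (3 * i + 1)%Z) N.
Proof.
  induction N as [|N IH].
  - unfold zsum; simpl. ring.
  - replace (3 * S N + 1)%nat with (S (S (S (3 * N + 1)))) by lia.
    rewrite !zsum_S, IH.
    replace (Z.of_nat (S (3 * N + 1)))%Z with (3 * Z.of_nat (S N) - 1)%Z by lia.
    replace (Z.of_nat (S (S (3 * N + 1))))%Z with (3 * Z.of_nat (S N))%Z by lia.
    replace (Z.of_nat (S (S (S (3 * N + 1)))))%Z with (3 * Z.of_nat (S N) + 1)%Z by lia.
    replace (3 * - Z.of_nat (S N) - 1)%Z with (- (3 * Z.of_nat (S N) + 1))%Z by lia.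
    replace (3 * - Z.of_nat (S N))%Z with (- (3 * Z.of_nat (S N)))%Z by lia.
    replace (- (3 * Z.of_nat (S N)) + 1)%Z with (- (3 * Z.of_nat (S N) - 1))%Z by lia.
    ring.
Qed.

Lemma zsum_dist_le (f g : Z -> R) (C : R) (N : nat) :
  (forall j, (Z.abs j <= Z.of_nat N)%Z -> Rabs (f j - g j) <= C) ->
  Rabs (zsum f N - zsum g N) <= (2 * INR N + 1) * C.
Proof.
  intros H. unfold zsum. rewrite <- minus_sum.
  eapply Rle_trans; [apply Rsum_abs|].
  replace ((2 * INR N + 1) * C) with (sum_f_R0 (fun _ => C) (2 * N)).
  - apply sum_Rle. intros j Hj. apply H. lia.
  - rewrite sum_cte, S_INR, mult_INR. simpl. ring.
Qed.

Fixpoint triadic (k : nat) : nat :=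
  match k with O => 0 | S k => 3 * triadic k + 1 end.

Lemma triadic_pow (k : nat) : 2 * INR (triadic k) + 1 = 3 ^ k.
Proof.
  induction k as [|k IH]; [simpl; ring|].
  change (triadic (S k)) with (3 * triadic k + 1)%nat.
  rewrite plus_INR, mult_INR, <- tech_pow_Rmult, <- IH. simpl. ring.
Qed.

Lemma poisson_kernel_triadic (k : nat) (a b : R) : 0 < b ->
  poisson_kernel a b =
  / 3 ^ k * zsum (fun j => poisson_kernel ((a + 2 * PI * IZR j) / 3 ^ k) (b / 3 ^ k)) (triadic k).
Proof.
  revert a b; induction k as [|k IH]; intros a b Hb.
  - simpl. unfold zsum; simpl. rewrite Rinv_1, Rmult_1_l. f_equal; field.
  - assert (H3 : 3 ^ k <> 0) by (apply pow_nonzero; lra).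
    rewrite poisson_kernel_triple by assumption.
    rewrite (IH ((a - 2 * PI) / 3)), (IH (a / 3)), (IH ((a + 2 * PI) / 3)) by lra.
    change (triadic (S k)) with (3 * triadic k + 1)%nat.
    rewrite zsum_triple, !zsum_plus.
    rewrite <- tech_pow_Rmult, Rinv_mult, Rmult_assoc, <- !Rmult_plus_distr_l.
    do 2 f_equal; f_equal; [f_equal|]; apply zsum_ext; intros j; f_equal;
      rewrite ?plus_IZR, ?minus_IZR, ?mult_IZR; field; assumption.
Qed.

Lemma is_lim_seq_inv_pow3 (C : R) : is_lim_seq (fun k => C / 3 ^ k) 0.
Proof.
  replace (Finite 0) with (Rbar_mult C 0) by (simpl; f_equal; ring).
  apply (is_lim_seq_scal_l (fun k => / 3 ^ k)).
  apply is_lim_seq_ext with (fun k => (/ 3) ^ k); [intros; apply pow_inv|].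
  apply is_lim_seq_geom. rewrite Rabs_right; lra.
Qed.

Lemma is_lim_seq_abs_le (u v : nat -> R) (l : R) (k0 : nat) :
  (forall k, (k0 <= k)%nat -> Rabs (u k - l) <= v k) -> is_lim_seq v 0 -> is_lim_seq u l.
Proof.
  intros H Hv. apply is_lim_seq_spec. intros eps.
  apply is_lim_seq_spec in Hv. destruct (Hv eps) as [N HN].
  exists (max N k0). intros n Hn.
  eapply Rle_lt_trans; [apply H; lia|].
  specialize (HN n ltac:(lia)). rewrite Rminus_0_r in HN.
  apply Rabs_def2 in HN. lra.
Qed.

(** The scale 3^k cancels in the Lorentzian that replaces the kernel. Each of the 3^k terms is off
    by at most 60 b/9^k, hence the whole sum by at most 60 b/3^k. *)
Lemma lorentz_triadic_limit (a b : R) : 0 < b ->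
  is_lim_seq (fun k => zsum (fun j => 2 * b / ((a + 2 * PI * IZR j)^2 + b^2)) (triadic k))
    (poisson_kernel a b).
Proof.
  intros Hb.
  (* From here on b/3^k <= 1, and the arguments are at most PI + 1/2 < 4 in modulus, as
     [poisson_kernel_near_pole] requires. *)
  assert (Hlarge : exists k0, forall k, (k0 <= k)%nat -> Rabs a + b < / 2 * 3 ^ k).
  { assert (H := is_lim_seq_inv_pow3 (Rabs a + b)).
    apply is_lim_seq_spec in H. destruct (H (mkposreal (/ 2) ltac:(lra))) as [k0 Hk0].
    exists k0. intros k Hk. specialize (Hk0 k Hk). simpl in Hk0.
    rewrite Rminus_0_r in Hk0. apply Rabs_def2 in Hk0.
    assert (H3 : 0 < 3 ^ k) by (apply pow_lt; lra).
    apply (Rmult_lt_reg_r (/ 3 ^ k)); [apply Rinv_0_lt_compat; lra|].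
    rewrite Rmult_assoc, Rinv_r by lra. unfold Rdiv in Hk0. lra. }
  destruct Hlarge as [k0 Hk0].
  apply is_lim_seq_abs_le with (v := fun k => 60 * b / 3 ^ k) (k0 := k0);
    [|apply is_lim_seq_inv_pow3].
  intros k Hk. specialize (Hk0 k Hk).
  rewrite (poisson_kernel_triadic k a b Hb), Rabs_minus_sym.
  assert (H3 : 0 < 3 ^ k) by (apply pow_lt; lra).
  assert (Hi : 0 < / 3 ^ k) by (apply Rinv_0_lt_compat; lra).
  rewrite <- zsum_scal.
  eapply Rle_trans.
  - apply zsum_dist_le with (C := / 3 ^ k * (60 * (b / 3 ^ k))).
    intros j Hj.
    replace (2 * b / ((a + 2 * PI * IZR j) ^ 2 + b ^ 2)) with
      (/ 3 ^ k * (2 * (b / 3 ^ k) / (((a + 2 * PI * IZR j) / 3 ^ k) ^ 2 + (b / 3 ^ k)^2))).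
    2:{ assert (0 < b^2) by (apply pow_lt; lra).
        field. split; [|lra].
        generalize (pow2_ge_0 (a + 2 * PI * IZR j)); simpl; lra. }
    rewrite <- Rmult_minus_distr_l, Rabs_mult, (Rabs_right (/ 3 ^ k)) by lra.
    apply Rmult_le_compat_l; [lra|].
    apply poisson_kernel_near_pole.
    + assert (Hj' : Rabs (IZR j) <= INR (triadic k)).
      { rewrite <- abs_IZR, INR_IZR_INZ. apply IZR_le; assumption. }
      assert (Ht := triadic_pow k).
      assert (Hpi : 0 < PI <= 16/5).
      { split; [apply PI_RGT_0|]. assert (HP := proj2 (PI_ineq 9)).
        unfold tg_alt, PI_tg in HP. simpl in HP. lra. }
      apply Rabs_le_between in Hj'.
      assert (Ha : - Rabs a <= a <= Rabs a) by (apply Rabs_le_between; lra).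
      assert (- (PI * 3 ^ k) <= 2 * PI * IZR j <= PI * 3 ^ k) by nra.
      assert (PI * 3 ^ k <= 16/5 * 3 ^ k) by (apply Rmult_le_compat_r; lra).
      split; apply (Rmult_le_reg_r (3 ^ k)); try assumption;
        unfold Rdiv; rewrite ?Rmult_assoc, ?Rinv_l by lra; lra.
    + split; [apply Rdiv_lt_0_compat; lra|].
      apply (Rmult_le_reg_r (3 ^ k)); [assumption|].
      unfold Rdiv; rewrite Rmult_assoc, Rinv_l by lra. generalize (Rabs_pos a); lra.
  - rewrite triadic_pow. right. field. lra.
Qed.

(** Lets convergence along the triadic windows suffice, since the Lorentzian terms are positive. *)
Lemma increasing_subseq_lim (u : nat -> R) (phi : nat -> nat) (l : R) :
  (forall n m, (n <= m)%nat -> u n <= u m) -> (forall k, (k <= phi k)%nat) ->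
  is_lim_seq (fun k => u (phi k)) l -> is_lim_seq u l.
Proof.
  intros Hu Hphi H.
  assert (Hle : forall n, u n <= l).
  { intros n. apply (is_lim_seq_le_loc (fun _ => u n) (fun k => u (phi k)) (u n) l).
    - exists n. intros k Hk. apply Hu. specialize (Hphi k). lia.
    - apply is_lim_seq_const.
    - exact H. }
  apply is_lim_seq_spec. intros eps. apply is_lim_seq_spec in H.
  destruct (H eps) as [N HN]. exists (phi N). intros n Hn.
  specialize (HN N (le_n N)). apply Rabs_def2 in HN.
  assert (H1 := Hu _ _ Hn). assert (H2 := Hle n). apply Rabs_def1; lra.
Qed.

Lemma triadic_ge (k : nat) : (k <= triadic k)%nat.
Proof. induction k; simpl; lia. Qed.

Lemma lorentz_series (x y : R) : 0 < y ->
  is_series (zfold (fun j => / ((x + IZR j)^2 + y^2)))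
    (PI / y * poisson_kernel (2 * PI * x) (2 * PI * y)).
Proof.
  intros Hy. assert (Hpi := PI_RGT_0).
  apply is_series_lim_sum_f_R0.
  apply is_lim_seq_ext with (zsum (fun j => / ((x + IZR j)^2 + y^2))); [apply zsum_zfold|].
  assert (Hq : forall j, 0 < (x + IZR j)^2 + y^2).
  { intros j. assert (0 < y^2) by (apply pow_lt; lra). generalize (pow2_ge_0 (x + IZR j)); lra. }
  apply increasing_subseq_lim with triadic.
  - intros n m Hnm. apply zsum_mono; [|assumption].
    intros j. apply Rlt_le, Rinv_0_lt_compat, Hq.
  - apply triadic_ge.
  - apply is_lim_seq_ext with
      (fun k => PI / y * zsum (fun j => 2 * (2 * PI * y) /
         ((2 * PI * x + 2 * PI * IZR j)^2 + (2 * PI * y)^2)) (triadic k)).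
    + intros k. rewrite <- zsum_scal. apply zsum_ext. intros j.
      assert (Hj := Hq j).
      replace ((2 * PI * x + 2 * PI * IZR j)^2 + (2 * PI * y)^2) with
        (4 * PI^2 * ((x + IZR j)^2 + y^2)) by ring.
      field. repeat split; lra.
    + apply (is_lim_seq_scal_l _ (PI / y) (poisson_kernel (2 * PI * x) (2 * PI * y))).
      apply lorentz_triadic_limit. nra.
Qed.

(** With r = exp(-b), multiplication by 1 - 2 r cos a + r^2 telescopes the partial sums, because
    cos((k+1)a) + cos((k-1)a) = 2 cos a cos(ka). What is left over 1 - r^2 is at most 4 r^K. *)
Lemma poisson_kernel_fourier (a b : R) : 0 < b ->
  is_series (fun k => match k with O => 1 | S _ => 2 * exp (- (INR k * b)) * cos (INR k * a) end)
    (poisson_kernel a b).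
Proof.
  intros Hb. apply is_series_lim_sum_f_R0.
  set (r := exp (- b)).
  assert (Hr : 0 < r < 1).
  { split; [apply exp_pos|]. unfold r. rewrite <- exp_0. apply exp_increasing; lra. }
  assert (He : forall k, exp (- (INR k * b)) = r ^ k).
  { induction k as [|k IH]; [simpl; rewrite Rmult_0_l, Ropp_0; apply exp_0|].
    rewrite <- tech_pow_Rmult, <- IH. unfold r. rewrite <- exp_plus, S_INR. f_equal; ring. }
  assert (Hc : -1 <= cos a <= 1) by apply COS_bound.
  assert (HD : 0 < 1 - 2 * r * cos a + r^2).
  { assert (0 < (1 - r)^2) by (apply pow_lt; lra). nra. }
  assert (Hp : poisson_kernel a b = (1 - r^2) / (1 - 2 * r * cos a + r^2)).
  { unfold poisson_kernel, sinh, cosh. fold r.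
    assert (E : exp b = / r) by (unfold r; rewrite exp_Ropp, Rinv_inv; reflexivity).
    rewrite E. field. repeat split; try lra;
    intros Z; apply Rlt_not_eq in HD; apply HD; nra. }
  rewrite Hp.
  set (S0 := fun K => sum_f_R0 (fun k => match k with O => 1 | S _ => 2 * exp (- (INR k * b)) * cos (INR k * a) end) K).
  assert (HS : forall K, (1 - 2 * r * cos a + r^2) * S0 K =
    1 - r^2 - 2 * r ^ (S K) * cos (INR (S K) * a) + 2 * r ^ (S (S K)) * cos (INR K * a)).
  { induction K as [|K IH].
    - unfold S0; simpl. rewrite Rmult_1_l, Rmult_0_l, cos_0. ring.
    - unfold S0 in *. rewrite tech5, Rmult_plus_distr_l, IH, He.
      rewrite (S_INR (S K)).
      replace (INR K * a) with (INR (S K) * a - a) by (rewrite S_INR; ring).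
      replace ((INR (S K) + 1) * a) with (INR (S K) * a + a) by ring.
      rewrite cos_plus, cos_minus. rewrite <- !tech_pow_Rmult. ring. }
  apply is_lim_seq_abs_le with (k0 := O)
    (v := fun K => 4 / (1 - 2 * r * cos a + r^2) * r ^ K).
  - intros K _. change (sum_f_R0 _ K) with (S0 K).
    replace (S0 K - (1 - r^2) / (1 - 2 * r * cos a + r^2)) with
     (((1 - 2 * r * cos a + r^2) * S0 K - (1 - r^2)) / (1 - 2 * r * cos a + r^2)) by (field; lra).
    rewrite (HS K). unfold Rdiv. rewrite Rabs_mult, (Rabs_right (/ _)).
    2:{ apply Rle_ge, Rlt_le, Rinv_0_lt_compat; lra. }
    replace (4 * / (1 - 2 * r * cos a + r ^ 2) * r ^ K) with
      (4 * r ^ K * / (1 - 2 * r * cos a + r ^ 2)) by ring.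
    apply Rmult_le_compat_r; [apply Rlt_le, Rinv_0_lt_compat; lra|].
    assert (HK : 0 < r ^ K) by (apply pow_lt; lra).
    assert (B1 := COS_bound (INR (S K) * a)). assert (B2 := COS_bound (INR K * a)).
    set (p := cos (INR (S K) * a)) in *. set (q := cos (INR K * a)) in *.
    match goal with |- Rabs ?z <= _ =>
      replace z with (r ^ K * (2 * (r * (r * q - p)))) by (simpl; ring) end.
    rewrite Rabs_mult, Rabs_right, Rmult_comm by lra.
    apply Rmult_le_compat_r; [lra|]. apply Rabs_le.
    assert (-2 <= r * q - p <= 2) by nra. nra.
  - replace (Finite 0) with (Rbar_mult (4 / (1 - 2 * r * cos a + r ^ 2)) 0)
      by (simpl; f_equal; ring).
    apply (is_lim_seq_scal_l (fun K => r ^ K)). apply is_lim_seq_geom. rewrite Rabs_right; lra.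
Qed.

(** * Termwise differentiation and Bessel functions of half-integer order *)
(** [a i n] is the n-th iterate of -(1/y) d/dy on [a i 0]. Nonnegativity at all orders is complete
    monotonicity in y^2: every member decreases in y, and this is why summability is required at
    order 0 only. *)
Definition radial_family (a : nat -> nat -> R -> R) : Prop :=
  (forall i n y, 0 < y -> 0 <= a i n y) /\
  (forall i n y, 0 < y -> is_derive (a i n) y (- y * a i (S n) y)) /\
  (forall y, 0 < y -> ex_series (fun i => a i O y)).

Lemma ex_series_le_nonneg (a b : nat -> R) :
  (forall i, 0 <= a i <= b i) -> ex_series b -> ex_series a.
Proof.
  intros H Hb. apply (ex_series_le a b); [|exact Hb].
  intros i. change (Rabs (a i) <= b i). rewrite Rabs_right; [apply H|apply Rle_ge, H].
Qed.

Lemma ex_series_weighted (e a : nat -> R) :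
  (forall i, Rabs (e i) <= 1) -> (forall i, 0 <= a i) -> ex_series a ->
  ex_series (fun i => e i * a i).
Proof.
  intros He Ha H. apply (ex_series_le (fun i => e i * a i) a); [|exact H].
  intros i. change (Rabs (e i * a i) <= a i). rewrite Rabs_mult, (Rabs_right (a i)) by (apply Rle_ge, Ha).
  specialize (He i). specialize (Ha i). nra.
Qed.

Lemma Series_weighted_abs_le (e a b : nat -> R) :
  (forall i, Rabs (e i) <= 1) -> (forall i, Rabs (a i) <= b i) -> ex_series b ->
  Rabs (Series (fun i => e i * a i)) <= Series b.
Proof.
  intros He Ha Hb.
  assert (H : forall i, 0 <= Rabs (e i * a i) <= b i).
  { intros i. split; [apply Rabs_pos|]. rewrite Rabs_mult.
    specialize (He i). specialize (Ha i). generalize (Rabs_pos (e i)), (Rabs_pos (a i)). nra. }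
  eapply Rle_trans.
  - apply Series_Rabs. apply ex_series_le_nonneg with b; assumption.
  - apply Series_le; assumption.
Qed.

Section Family.
Variable a : nat -> nat -> R -> R.
Hypothesis Ha : radial_family a.

Lemma family_mvt (i n : nat) (s t : R) : 0 < s -> 0 < t ->
  exists c, Rmin s t <= c <= Rmax s t /\ a i n t - a i n s = - c * a i (S n) c * (t - s).
Proof.
  destruct Ha as [H0 [H1 H2]]. intros Hs Ht.
  destruct (MVT_gen (a i n) s t (fun c => - c * a i (S n) c)) as [c Hc].
  - intros c Hc. apply H1. apply Rlt_trans with (Rmin s t); [apply Rmin_glb_lt|]; lra.
  - intros c Hc. apply derivable_continuous_pt. exists (- c * a i (S n) c).
    apply is_derive_Reals, H1. apply Rlt_le_trans with (Rmin s t); [apply Rmin_glb_lt|]; lra.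
  - exists c; exact Hc.
Qed.

Lemma family_decr (i n : nat) (s t : R) : 0 < s <= t -> a i n t <= a i n s.
Proof.
  intros H. destruct (family_mvt i n s t) as [c [Hc E]]; try lra.
  rewrite Rmin_left, Rmax_right in Hc by lra.
  destruct Ha as [H0 _]. assert (0 <= a i (S n) c) by (apply H0; lra).
  assert (0 <= c * a i (S n) c * (t - s)) by (repeat apply Rmult_le_pos; lra). lra.
Qed.

(** The drop of [a i n] over [y/2, y] is at least (y/2)^2 times the next order at y. Summability
    thus passes from order n at y/2 to order n + 1 at y. *)
Lemma family_next_le (i n : nat) (y : R) : 0 < y -> a i (S n) y <= 4 / y^2 * a i n (y / 2).
Proof.
  intros H. destruct (family_mvt i n (y/2) y) as [c [Hc E]]; try lra.
  rewrite Rmin_left, Rmax_right in Hc by lra.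
  destruct Ha as [H0 _]. assert (0 <= a i n y) by (apply H0; lra).
  assert (G1 : 0 <= a i (S n) y) by (apply H0; lra).
  assert (G2 : a i (S n) y <= a i (S n) c) by (apply family_decr; lra).
  assert (y / 2 * a i (S n) y <= c * a i (S n) c) by (apply Rmult_le_compat; lra).
  assert (0 < y^2) by (apply pow_lt; lra).
  apply (Rmult_le_reg_l (y^2/4)); [lra|].
  replace (y ^ 2 / 4 * (4 / y ^ 2 * a i n (y / 2))) with (a i n (y/2)) by (field; lra).
  replace (y ^ 2 / 4 * a i (S n) y) with (y / 2 * a i (S n) y * (y / 2)) by field.
  nra.
Qed.

Lemma family_ex_series (n : nat) (y : R) : 0 < y -> ex_series (fun i => a i n y).
Proof.
  revert y; induction n as [|n IH]; intros y Hy.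
  - apply Ha; assumption.
  - apply ex_series_le_nonneg with (fun i => 4 / y^2 * a i n (y / 2)).
    + intros i; split; [apply Ha; assumption|apply family_next_le; assumption].
    + apply (ex_series_Rmult_l (4 / y^2)), IH; lra.
Qed.

(** All intermediate points lie in (y/2, 2y), and by monotonicity the members are largest at y/2.
    The bound is h^2 times a summable quantity independent of h, which permits differentiation under
    the sum. *)
Lemma family_quadratic_remainder (i n : nat) (y h : R) : 0 < y -> Rabs h < y / 2 ->
  Rabs (a i n (y + h) - a i n y + h * (y * a i (S n) y)) <=
  h^2 * (a i (S n) (y / 2) + 4 * y^2 * a i (S (S n)) (y / 2)).
Proof.
  intros Hy Hh. apply Rabs_def2 in Hh.
  destruct (family_mvt i n y (y + h)) as [c [Hc E]]; try lra.
  rewrite E. replace (y + h - y) with h by ring.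
  destruct Ha as [H0 [H1 _]].
  assert (Hc' : y / 2 < c < 2 * y).
  { split.
    - apply Rlt_le_trans with (Rmin y (y + h)); [apply Rmin_glb_lt|]; lra.
    - apply Rle_lt_trans with (Rmax y (y + h)); [|apply Rmax_lub_lt]; lra. }
  assert (Hch : Rabs (c - y) <= Rabs h).
  { revert Hc. unfold Rmin, Rmax, Rabs. repeat destruct Rle_dec; repeat destruct Rcase_abs; lra. }
  destruct (MVT_gen (fun s => s * a i (S n) s) y c
     (fun s => a i (S n) s - s^2 * a i (S (S n)) s)) as [d [Hd Ed]].
  - intros s Hs. assert (0 < s).
    { apply Rlt_trans with (Rmin y c); [apply Rmin_glb_lt|]; lra. }
    evar_last.
    + apply (is_derive_mult (fun s : R => s) (a i (S n))); [apply is_derive_id|apply H1; assumption|].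
      intros; apply Rmult_comm.
    + unfold plus, mult, one; simpl. ring.
  - intros s Hs. assert (0 < s).
    { apply Rlt_le_trans with (Rmin y c); [apply Rmin_glb_lt|]; lra. }
    apply continuity_pt_mult; [apply derivable_continuous_pt, derivable_pt_id|].
    apply derivable_continuous_pt. exists (- s * a i (S (S n)) s).
    apply is_derive_Reals, H1; assumption.
  - assert (Hd' : y / 2 < d < 2 * y).
    { split.
      - apply Rlt_le_trans with (Rmin y c); [apply Rmin_glb_lt|]; lra.
      - apply Rle_lt_trans with (Rmax y c); [|apply Rmax_lub_lt]; lra. }
    replace (- c * a i (S n) c * h + h * (y * a i (S n) y)) with
      (- (h * (c * a i (S n) c - y * a i (S n) y))) by ring.
    rewrite Ed, Rabs_Ropp, !Rabs_mult.
    assert (P1 : 0 <= a i (S n) d) by (apply H0; lra).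
    assert (P2 : 0 <= a i (S (S n)) d) by (apply H0; lra).
    assert (P3 : a i (S n) d <= a i (S n) (y/2)) by (apply family_decr; lra).
    assert (P4 : a i (S (S n)) d <= a i (S (S n)) (y/2)) by (apply family_decr; lra).
    set (M := a i (S n) (y / 2) + 4 * y ^ 2 * a i (S (S n)) (y / 2)).
    assert (P5 : 0 <= d^2 <= 4 * y^2) by nra.
    assert (P6 : d^2 * a i (S (S n)) d <= 4 * y^2 * a i (S (S n)) (y/2))
      by (apply Rmult_le_compat; lra).
    assert (P7 : 0 <= d^2 * a i (S (S n)) d) by (apply Rmult_le_pos; lra).
    assert (P8 : Rabs (a i (S n) d - d ^ 2 * a i (S (S n)) d) <= M).
    { apply Rabs_le. unfold M. lra. }
    rewrite <- (pow2_abs h).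
    replace (Rabs h ^ 2 * M) with (Rabs h * (M * Rabs h)) by ring.
    apply Rmult_le_compat_l; [apply Rabs_pos|].
    apply Rmult_le_compat; auto using Rabs_pos.
Qed.

Lemma family_series_derive (e : nat -> R) (n : nat) (y : R) :
  (forall i, Rabs (e i) <= 1) -> 0 < y ->
  is_derive (fun y => Series (fun i => e i * a i n y)) y
    (- y * Series (fun i => e i * a i (S n) y)).
Proof.
  intros He Hy.
  assert (H0 := proj1 Ha).
  assert (EX : forall m s, 0 < s -> ex_series (fun i => e i * a i m s)).
  { intros m s Hs. apply ex_series_weighted; auto. apply family_ex_series; assumption. }
  set (M := fun i => a i (S n) (y / 2) + 4 * y^2 * a i (S (S n)) (y / 2)).
  assert (HM : ex_series M).
  { apply (ex_series_Rplus (fun i => a i (S n) (y/2))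
       (fun i => 4 * y^2 * a i (S (S n)) (y / 2))).
    - apply family_ex_series; lra.
    - apply (ex_series_Rmult_l (4 * y^2)), family_ex_series; lra. }
  assert (HM0 : 0 <= Series M).
  { apply Series_nonneg; [|exact HM]. intros i. unfold M.
    assert (0 <= a i (S n) (y/2)) by (apply H0; lra).
    assert (0 <= a i (S (S n)) (y/2)) by (apply H0; lra).
    assert (0 <= y^2) by apply pow2_ge_0. nra. }
  apply is_derive_Reals. intros eps Heps.
  assert (Hd : 0 < Rmin (y/2) (eps / (Series M + 1))).
  { apply Rmin_glb_lt; [lra|apply Rdiv_lt_0_compat; lra]. }
  exists (mkposreal _ Hd). intros h Hh Hlt. simpl in Hlt.
  assert (Hh1 : Rabs h < y / 2) by (eapply Rlt_le_trans; [exact Hlt|apply Rmin_l]).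
  assert (Hh2 : Rabs h < eps / (Series M + 1)) by (eapply Rlt_le_trans; [exact Hlt|apply Rmin_r]).
  assert (Hyh : 0 < y + h) by (apply Rabs_def2 in Hh1; lra).
  assert (E : Series (fun i => e i * a i n (y + h)) - Series (fun i => e i * a i n y)
     + h * (y * Series (fun i => e i * a i (S n) y)) =
     Series (fun i => e i * (a i n (y + h) - a i n y + h * (y * a i (S n) y)))).
  { rewrite <- Series_minus by auto. rewrite <- !Series_scal_l.
    rewrite <- Series_plus.
    - apply Series_ext; intros i; ring.
    - apply (ex_series_Rminus (fun i => e i * a i n (y + h)) (fun i => e i * a i n y)); auto.
    - apply (ex_series_Rmult_l h), (ex_series_Rmult_l y); auto. }
  assert (B : Rabs (Series (fun i => e i * (a i n (y + h) - a i n y + h * (y * a i (S n) y))))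
     <= Series (fun i => h^2 * M i)).
  { apply Series_weighted_abs_le; auto.
    - intros i. apply family_quadratic_remainder; assumption.
    - apply (ex_series_Rmult_l (h^2)); assumption. }
  rewrite <- E, Series_scal_l in B.
  match goal with |- Rabs ?z < eps => replace z with
    ((Series (fun i => e i * a i n (y + h)) - Series (fun i => e i * a i n y)
     + h * (y * Series (fun i => e i * a i (S n) y))) / h) by (field; assumption) end.
  unfold Rdiv. rewrite Rabs_mult, Rabs_inv.
  assert (Hp : 0 < Rabs h) by (apply Rabs_pos_lt; assumption).
  apply (Rmult_lt_reg_r (Rabs h)); [assumption|].
  rewrite Rmult_assoc, Rinv_l, Rmult_1_r by lra.
  eapply Rle_lt_trans; [exact B|]. rewrite <- (pow2_abs h).
  replace (Rabs h ^ 2 * Series M) with (Rabs h * Series M * Rabs h) by ring.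
  apply Rmult_lt_compat_r; [assumption|].
  apply (Rmult_lt_compat_r (Series M + 1)) in Hh2; [|lra].
  unfold Rdiv in Hh2. rewrite Rmult_assoc, Rinv_l in Hh2 by lra. lra.
Qed.

End Family.

(* Termwise application of [- (1/y) d/dy] propagates an identity of order 0 to all orders. *)
Lemma family_identity_all_orders (a b : nat -> nat -> R -> R) (e f : nat -> R) :
  radial_family a -> radial_family b ->
  (forall i, Rabs (e i) <= 1) -> (forall i, Rabs (f i) <= 1) ->
  (forall y, 0 < y -> Series (fun i => e i * a i O y) = Series (fun i => f i * b i O y)) ->
  forall n y, 0 < y -> Series (fun i => e i * a i n y) = Series (fun i => f i * b i n y).
Proof.
  intros Ha Hb He Hf H0 n. induction n as [|n IH]; intros y Hy; [auto|].
  assert (D1 := family_series_derive a Ha e n y He Hy).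
  assert (D2 := family_series_derive b Hb f n y Hf Hy).
  apply (is_derive_ext_loc _ (fun y => Series (fun i => f i * b i n y))) in D1.
  - apply is_derive_unique in D1. apply is_derive_unique in D2.
    apply (Rmult_eq_reg_l (- y)); [|lra]. rewrite <- D1, <- D2. reflexivity.
  - exists (mkposreal y Hy). intros z Hz. apply IH.
    change (Rabs (z - y) < y) in Hz. apply Rabs_def2 in Hz. lra.
Qed.

(* [sqrt (2/PI) * t^(-n-1/2) * K_(n+1/2)(t)]: three-term recurrence of the modified
   Bessel functions of half-integer order. *)
Fixpoint bessel_half (n : nat) (t : R) : R :=
  match n with
  | O => exp (- t) / t
  | S m =>
    match m with
    | O => exp (- t) * (/ t^2 + / t^3)
    | S k => ((2 * INR k + 3) * bessel_half m t + bessel_half k t) / t^2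
    end
  end.

Lemma bessel_half_SS (n : nat) (t : R) :
  bessel_half (S (S n)) t = ((2 * INR n + 3) * bessel_half (S n) t + bessel_half n t) / t^2.
Proof. reflexivity. Qed.

Lemma nat_ind2 (P : nat -> Prop) :
  P O -> P 1%nat -> (forall n, P n -> P (S n) -> P (S (S n))) -> forall n, P n.
Proof.
  intros H0 H1 H n. assert (P n /\ P (S n)) as [? _]; [|assumption].
  induction n as [|n [IH1 IH2]]; auto.
Qed.

Lemma bessel_half_pos (n : nat) (t : R) : 0 < t -> 0 < bessel_half n t.
Proof.
  intros Ht. assert (He := exp_pos (- t)).
  assert (0 < t^2) by (apply pow_lt; lra). assert (0 < t^3) by (apply pow_lt; lra).
  induction n as [| |n IH1 IH2] using nat_ind2.
  - apply Rdiv_lt_0_compat; assumption.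
  - apply Rmult_lt_0_compat; [assumption|].
    apply Rplus_lt_0_compat; apply Rinv_0_lt_compat; assumption.
  - rewrite bessel_half_SS. apply Rdiv_lt_0_compat; [|assumption].
    generalize (pos_INR n). nra.
Qed.

(** The classical relation -(1/t) d/dt (t^(-nu) K_nu) = t^(-nu-1) K_(nu+1) for nu = n + 1/2. The
    induction takes two steps because the recurrence involves two previous orders. *)
Lemma bessel_half_derive (n : nat) (t : R) : 0 < t ->
  is_derive (bessel_half n) t (- t * bessel_half (S n) t).
Proof.
  intros Ht. induction n as [| |n IH1 IH2] using nat_ind2.
  - unfold bessel_half. auto_derive; [lra|]. field. lra.
  - unfold bessel_half. auto_derive.
    { assert (t * t <> 0) by nra. repeat split; rewrite ?Rmult_1_r;
        repeat apply Rmult_integral_contrapositive_currified; lra. }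
    simpl. field. lra.
  - apply is_derive_ext with
      (fun t => ((2 * INR n + 3) * bessel_half (S n) t + bessel_half n t) * / t^2);
      [reflexivity|].
    evar_last.
    + apply (is_derive_mult (fun t => (2 * INR n + 3) * bessel_half (S n) t + bessel_half n t)
        (fun t => / t^2)).
      * apply (is_derive_plus (fun t => (2 * INR n + 3) * bessel_half (S n) t)); [|exact IH1].
        apply is_derive_scal, IH2.
      * auto_derive; [|reflexivity]. nra.
      * intros; apply Rmult_comm.
    + rewrite (bessel_half_SS (S n)), (bessel_half_SS n), S_INR.
      set (u1 := bessel_half (S n) t). set (u0 := bessel_half n t).
      unfold plus, mult; simpl Hierarchy.plus; simpl Hierarchy.mult. simpl. field. lra.
Qed.

(** * The lattice sum and its Fourier modes as radial families *)

Definition shifted_square (x : R) (j : Z) (y : R) : R := (x + IZR j)^2 + y^2.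

Lemma shifted_square_pos (x : R) (j : Z) (y : R) : 0 < y -> 0 < shifted_square x j y.
Proof.
  intros Hy. unfold shifted_square.
  assert (0 < y^2) by (apply pow_lt; lra). generalize (pow2_ge_0 (x + IZR j)); lra.
Qed.

(** The factor 2^n n! is what n applications of -(1/y) d/dy to 1/((x+j)^2 + y^2) produce. *)
Definition lattice_family (x : R) (i n : nat) (y : R) : R :=
  zfold (fun j => 2 ^ n * INR (fact n) / shifted_square x j y ^ S n) i.

Lemma lattice_term_derive (x : R) (j : Z) (n : nat) (y : R) : 0 < y ->
  is_derive (fun y => 2 ^ n * INR (fact n) / shifted_square x j y ^ S n) y
    (- y * (2 ^ S n * INR (fact (S n)) / shifted_square x j y ^ S (S n))).
Proof.
  intros Hy. assert (Hq := shifted_square_pos x j y Hy).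
  evar_last.
  - apply is_derive_scal.
    apply is_derive_inv; [apply is_derive_pow|apply pow_nonzero; lra].
    unfold shifted_square. auto_derive; [auto|reflexivity].
  - change (pred (S n)) with n. fold (shifted_square x j y).
    rewrite fact_simpl, mult_INR.
    assert (shifted_square x j y ^ n <> 0) by (apply pow_nonzero; lra).
    simpl pow. field. repeat split; first [assumption | lra].
Qed.

Lemma lattice_family_radial (x : R) : radial_family (lattice_family x).
Proof.
  split; [|split].
  - intros i n y Hy. apply zfold_nonneg. intros j. apply Rlt_le.
    assert (Hq := shifted_square_pos x j y Hy).
    apply Rdiv_lt_0_compat; [apply Rmult_lt_0_compat|]; try (apply pow_lt; lra).
    apply INR_fact_lt_0.
  - intros [|i] n y Hy; unfold lattice_family, zfold.
    + apply lattice_term_derive; assumption.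
    + rewrite Rmult_plus_distr_l.
      apply (is_derive_plus (V := R_NormedModule)); apply lattice_term_derive; assumption.
  - intros y Hy. eexists. apply (is_series_ext (zfold (fun j => / ((x + IZR j)^2 + y^2)))).
    + intros i. apply zfold_ext. intros j. unfold shifted_square. simpl. rewrite !Rmult_1_r.
      unfold Rdiv. ring.
    + apply lorentz_series; assumption.
Qed.

(** Coefficient of frequency 0: the iterates of -(1/y) d/dy on PI/y. *)
Fixpoint central_mode (n : nat) (y : R) : R :=
  match n with O => PI / y | S m => (2 * INR m + 1) * central_mode m y / y^2 end.

Lemma central_mode_closed (n : nat) : exists c, 0 < c /\
  forall y, 0 < y -> central_mode n y = c / y ^ (2 * n + 1).
Proof.
  induction n as [|n [c [Hc IH]]].
  - exists PI. split; [apply PI_RGT_0|]. intros; simpl. field. lra.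
  - exists ((2 * INR n + 1) * c). split; [generalize (pos_INR n); nra|].
    intros y Hy. simpl central_mode. rewrite IH by assumption.
    replace (2 * S n + 1)%nat with (S (S (2 * n + 1))) by lia.
    rewrite <- !tech_pow_Rmult.
    assert (y ^ (2 * n + 1) <> 0) by (apply pow_nonzero; lra). field. repeat split; first [assumption | lra].
Qed.

Lemma central_mode_derive (n : nat) (y : R) : 0 < y ->
  is_derive (central_mode n) y (- y * central_mode (S n) y).
Proof.
  intros Hy. induction n as [|n IH].
  - simpl. auto_derive; [lra|]. field. lra.
  - apply is_derive_ext with (fun y => (2 * INR n + 1) * (central_mode n y * / y^2)).
    { intros t; simpl. unfold Rdiv. ring. }
    evar_last.
    + apply is_derive_scal, (is_derive_mult (central_mode n) (fun y => / y^2)).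
      * exact IH.
      * auto_derive; [|reflexivity]. nra.
      * intros; apply Rmult_comm.
    + assert (E : forall m, central_mode (S m) y = (2 * INR m + 1) * central_mode m y / y^2)
        by reflexivity.
      rewrite (E (S n)), !(E n), S_INR. set (c := central_mode n y).
      unfold plus, mult; simpl. field. lra.
Qed.

(** For i >= 1 the frequencies i and -i are merged. With w = 2 PI i, order 0 is 2 PI exp(-w y)/y,
    and each application of -(1/y) d/dy to a function of w y gives a factor w^2. *)
Definition fourier_family (i n : nat) (y : R) : R :=
  match i with
  | O => central_mode n y
  | S _ => 2 * PI * (2 * PI * INR i) ^ (2 * n + 1) * bessel_half n (2 * PI * INR i * y)
  end.

Definition fourier_weight (x : R) (i : nat) : R := cos (INR i * (2 * PI * x)).

Lemma fourier_weight_abs (x : R) (i : nat) : Rabs (fourier_weight x i) <= 1.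
Proof. apply Rabs_le, COS_bound. Qed.

Lemma fourier_family_0 (i : nat) (y : R) : 0 < y ->
  fourier_family i 0 y =
  PI / y * match i with O => 1 | S _ => 2 * exp (- (INR i * (2 * PI * y))) end.
Proof.
  intros Hy. assert (Hpi := PI_RGT_0).
  destruct i as [|i]; unfold fourier_family, central_mode, bessel_half; [ring|].
  assert (0 < INR (S i)) by (apply lt_0_INR; lia).
  replace (2 * PI * INR (S i) * y) with (INR (S i) * (2 * PI * y)) by ring.
  change (2 * 0 + 1)%nat with 1%nat. rewrite pow_1. field. repeat split; lra.
Qed.

Lemma fourier_family_nonneg (i n : nat) (y : R) : 0 < y -> 0 <= fourier_family i n y.
Proof.
  intros Hy. assert (Hpi := PI_RGT_0). destruct i as [|i]; unfold fourier_family.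
  - destruct (central_mode_closed n) as [c [Hc E]]. rewrite E by assumption.
    apply Rlt_le, Rdiv_lt_0_compat; [assumption|apply pow_lt; assumption].
  - assert (0 < INR (S i)) by (apply lt_0_INR; lia).
    assert (0 < 2 * PI * INR (S i)) by (apply Rmult_lt_0_compat; lra).
    apply Rlt_le, Rmult_lt_0_compat; [apply Rmult_lt_0_compat; [lra|apply pow_lt; assumption]|].
    apply bessel_half_pos, Rmult_lt_0_compat; assumption.
Qed.

Lemma ex_series_exp_neg (b : R) : 0 < b -> ex_series (fun k => exp (- (INR k * b))).
Proof.
  intros Hb. apply (ex_series_ext (fun k => exp (- b) ^ k)).
  - intros k. induction k as [|k IH].
    + simpl. rewrite Rmult_0_l, Ropp_0, exp_0. reflexivity.
    + rewrite <- tech_pow_Rmult, IH, <- exp_plus, S_INR. f_equal; ring.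
  - apply ex_series_geom. rewrite Rabs_right by (apply Rle_ge, Rlt_le, exp_pos).
    rewrite <- exp_0. apply exp_increasing; lra.
Qed.

Lemma fourier_family_radial : radial_family fourier_family.
Proof.
  assert (Hpi := PI_RGT_0).
  split; [|split].
  - intros; apply fourier_family_nonneg; assumption.
  - intros [|i] n y Hy; unfold fourier_family.
    + apply central_mode_derive; assumption.
    + assert (0 < INR (S i)) by (apply lt_0_INR; lia).
      set (w := 2 * PI * INR (S i)). assert (Hw : 0 < w) by (unfold w; nra).
      evar_last.
      * apply is_derive_scal. apply (is_derive_comp (bessel_half n) (fun y => w * y)).
        -- apply bessel_half_derive. nra.
        -- auto_derive; [auto|reflexivity].
      * replace (2 * S n + 1)%nat with (S (S (2 * n + 1))) by lia.
        unfold scal; simpl; unfold mult; simpl. ring.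
  - intros y Hy. apply (ex_series_le_nonneg _ (fun i => PI / y * (2 * exp (- (INR i * (2 * PI * y)))))).
    + intros i. split; [apply fourier_family_nonneg; assumption|].
      rewrite fourier_family_0 by assumption.
      apply Rmult_le_compat_l; [apply Rlt_le, Rdiv_lt_0_compat; lra|].
      destruct i; [simpl INR; rewrite Rmult_0_l, Ropp_0, exp_0|]; lra.
    + apply (ex_series_Rmult_l (PI / y)), (ex_series_Rmult_l 2), ex_series_exp_neg. nra.
Qed.

(** At order 0 both sides equal PI/y times the Poisson kernel, once by the partial fractions and
    once by the cosine series. The weights, 1 and the cosines, do not depend on y, so the identity
    propagates to all orders. *)
Lemma lattice_fourier_series (x : R) (n : nat) (y : R) : 0 < y ->
  is_series (fun i => lattice_family x i n y)
    (Series (fun i => fourier_weight x i * fourier_family i n y)).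
Proof.
  intros Hy.
  rewrite <- (family_identity_all_orders (lattice_family x) fourier_family (fun _ => 1)
    (fourier_weight x)); auto using lattice_family_radial, fourier_family_radial, fourier_weight_abs.
  - rewrite (Series_ext (fun i => 1 * lattice_family x i n y) (fun i => lattice_family x i n y))
      by (intros; ring).
    apply Series_correct, family_ex_series; auto using lattice_family_radial.
  - intros; rewrite Rabs_R1; lra.
  - clear y Hy. intros y Hy.
    transitivity (PI / y * poisson_kernel (2 * PI * x) (2 * PI * y)).
    + apply is_series_unique.
      apply (is_series_ext (zfold (fun j => / ((x + IZR j)^2 + y^2)))).
      * intros i. rewrite Rmult_1_l. apply zfold_ext. intros j. unfold shifted_square. simpl.
        rewrite !Rmult_1_r. unfold Rdiv. ring.
      * apply lorentz_series; assumption.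
    + symmetry. apply is_series_unique.
      apply (is_series_ext (fun k => PI / y * match k with O => 1
         | S _ => 2 * exp (- (INR k * (2 * PI * y))) * cos (INR k * (2 * PI * x)) end)).
      * intros i. rewrite fourier_family_0 by assumption. unfold fourier_weight.
        match goal with |- ?a = ?b => change (@eq R a b) end.
        destruct i; [simpl INR; rewrite Rmult_0_l, cos_0|]; ring.
      * apply (is_series_Rmult_l (PI / y)). apply poisson_kernel_fourier.
        generalize PI_RGT_0; nra.
Qed.

(** * Double series of Fourier modes *)
Lemma ex_series_abs_le (a b : nat -> R) :
  (forall i, Rabs (a i) <= b i) -> ex_series b -> ex_series a.
Proof. intros H Hb. apply (ex_series_le (V := R_CompleteNormedModule) a b); assumption. Qed.

Lemma Series_abs_le (a b : nat -> R) :
  (forall i, Rabs (a i) <= b i) -> ex_series b -> Rabs (Series a) <= Series b.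
Proof.
  intros H Hb. eapply Rle_trans; [apply Series_Rabs|apply Series_le; [|assumption]].
  - apply ex_series_le_nonneg with b; [|assumption]. intros; split; [apply Rabs_pos|apply H].
  - intros; split; [apply Rabs_pos|apply H].
Qed.

Lemma geometric_dominated (a : nat -> R) (B q : R) :
  0 <= q < 1 -> (forall i, Rabs (a i) <= B * q ^ i) ->
  ex_series a /\ Rabs (Series a) <= B / (1 - q).
Proof.
  intros Hq H. assert (Hq' : Rabs q < 1) by (rewrite Rabs_right; lra).
  assert (Hg : is_series (fun i => B * q ^ i) (B / (1 - q))).
  { apply is_series_Rmult_l, is_series_geom; assumption. }
  assert (Hg' : ex_series (fun i => B * q ^ i)) by (eexists; exact Hg).
  split; [apply ex_series_abs_le with (1 := H); assumption|].
  rewrite <- (is_series_unique _ _ Hg). apply Series_abs_le; assumption.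
Qed.

(** Indices are shifted by one: the isolated terms are the modes (m,k) = (1,1) and (1,2). The rest
    of row m = 1 and all later rows get separate geometric majorants, since their leading powers of
    exp(-t) differ. *)
Lemma double_series_two_terms (f : nat -> nat -> R) (B1 q1 B2 q2 q3 : R) :
  0 <= q1 < 1 -> 0 <= q2 < 1 -> 0 <= q3 < 1 ->
  (forall j, Rabs (f O (S (S j))) <= B1 * q1 ^ j) ->
  (forall i j, Rabs (f (S i) j) <= B2 * q2 ^ i * q3 ^ j) ->
  (forall i, ex_series (f i)) /\ ex_series (fun i => Series (f i)) /\
  Rabs (Series (fun i => Series (f i)) - (f O O + f O 1%nat)) <=
    B1 / (1 - q1) + B2 / (1 - q3) / (1 - q2).
Proof.
  intros H1 H2 H3 Hf0 Hf.
  destruct (geometric_dominated (fun j => f O (S (S j))) B1 q1 H1 Hf0) as [E0 L0].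
  assert (Hr : forall i, ex_series (f (S i)) /\ Rabs (Series (f (S i))) <= B2 / (1 - q3) * q2 ^ i).
  { intros i. destruct (geometric_dominated (f (S i)) (B2 * q2 ^ i) q3 H3 (Hf i)) as [E L].
    split; [assumption|]. replace (B2 / (1 - q3) * q2 ^ i) with (B2 * q2 ^ i / (1 - q3))
      by (field; lra). assumption. }
  destruct (geometric_dominated (fun i => Series (f (S i))) (B2 / (1 - q3)) q2 H2
    (fun i => proj2 (Hr i))) as [E1 L1].
  assert (E00 : ex_series (f O)).
  { apply ex_series_incr_1, ex_series_incr_1. exact E0. }
  assert (ES : ex_series (fun i => Series (f i))) by (apply ex_series_incr_1; exact E1).
  split; [intros [|i]; [assumption|apply Hr]|]. split; [assumption|].
  rewrite Series_incr_1 by assumption.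
  rewrite (Series_incr_1 (f O)) by assumption.
  rewrite (Series_incr_1 (fun k => f O (S k))) by (apply (ex_series_incr_1 (f O)); assumption).
  match goal with |- Rabs ?z <= _ =>
    replace z with (Series (fun j => f O (S (S j))) + Series (fun i => Series (f (S i)))) by ring end.
  eapply Rle_trans; [apply Rabs_triang|]. lra.
Qed.

(** Used with a = s - 1, d = s, t = 2 PI y, and [Q] the polynomial in 1/t that accompanies exp(-t)
    in K_(s-1/2)(t). *)
Definition mode (a d : nat) (Q : R -> R) (t : R) (m k : nat) : R :=
  INR k ^ a / INR m ^ d * exp (- (INR k * INR m * t)) * Q (INR k * INR m * t).

Lemma exp_neg_INR_mult (n : nat) (t : R) : exp (- (INR n * t)) = exp (- t) ^ n.
Proof.
  induction n as [|n IH]; [simpl; rewrite Rmult_0_l, Ropp_0; apply exp_0|].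
  rewrite <- tech_pow_Rmult, <- IH, <- exp_plus, S_INR. f_equal; ring.
Qed.

Lemma pow_decr_exponent (r : R) (n m : nat) : 0 <= r <= 1 -> (n <= m)%nat -> r ^ m <= r ^ n.
Proof.
  intros Hr H. induction H; [lra|]. rewrite <- tech_pow_Rmult.
  assert (0 <= r ^ m) by (apply pow_le; lra). nra.
Qed.

Lemma INR_le_pow2 (j : nat) : INR (S j) <= 2 ^ j.
Proof.
  induction j as [|j IH]; [simpl; lra|]. rewrite S_INR, <- tech_pow_Rmult.
  assert (1 <= 2 ^ j) by (apply pow_R1_Rle; lra). lra.
Qed.

Lemma INR_le_pow_4_3 (j : nat) : INR (S (S (S j))) <= 3 * (4/3) ^ j.
Proof.
  induction j as [|j IH]; [simpl; lra|]. rewrite S_INR, <- tech_pow_Rmult.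
  assert (1 <= (4/3) ^ j) by (apply pow_R1_Rle; lra). lra.
Qed.

(* First summand: row m = 1, k >= 3, using k <= 3 (4/3)^(k-3) and (4/3)^7 < 8. Second summand: rows
   m >= 2, using k <= 2^(k-1) and 2^7 exp(-t) <= 1. *)
Definition tail_bound (a d : nat) (Q : R -> R) (t : R) : R :=
  3 ^ (a + 2) * Q (3 * t) * exp (- t) ^ 3 / (1 - 8 * exp (- t)) +
  Q (2 * t) / 2 ^ (d - 2) * exp (- t) ^ 2 / (1 - exp (- t)) / (1 - exp (- t)).

Definition mode_sum (a d : nat) (Q : R -> R) (t : R) (c : nat -> nat -> R) : R :=
  Series (fun i => Series (fun j => mode a d Q t (S i) (S j) * c (S i) (S j))).

(** The coefficients [c] serve two purposes: the cosines themselves, with D = 1, and differences of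
    cosines at two abscissas, with D = |cos t - cos t'|. The weight (km)^2 is forced by the second
    use. *)
Lemma mode_sum_two_terms (a d : nat) (Q : R -> R) (t : R) (c : nat -> nat -> R) (D : R) :
  (a <= 5)%nat -> (2 <= d)%nat ->
  (forall s, 0 < s -> 0 <= Q s) -> (forall s s', 0 < s <= s' -> Q s' <= Q s) ->
  0 < t -> exp (- t) <= / 128 ->
  (forall m k, (0 < m)%nat -> (0 < k)%nat -> Rabs (c m k) <= D * (INR k * INR m) ^ 2) ->
  (forall i, ex_series (fun j => mode a d Q t (S i) (S j) * c (S i) (S j))) /\
  ex_series (fun i => Series (fun j => mode a d Q t (S i) (S j) * c (S i) (S j))) /\
  Rabs (mode_sum a d Q t c -
     (mode a d Q t 1 1 * c 1%nat 1%nat + mode a d Q t 1 2 * c 1%nat 2%nat))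
   <= D * tail_bound a d Q t.
Proof.
  intros Ha Hd HQ0 HQ Ht Hr Hc.
  set (r := exp (- t)) in *. assert (Hr0 : 0 < r) by apply exp_pos.
  assert (HD : 0 <= D).
  { specialize (Hc 1%nat 1%nat ltac:(lia) ltac:(lia)). simpl in Hc.
    generalize (Rabs_pos (c 1%nat 1%nat)). lra. }
  (* The weight (km)^2 raises the exponent of k to a + 2 <= 7 and lowers that of m to d - 2. *)
  assert (Hmode : forall m k, (0 < m)%nat -> (0 < k)%nat ->
     Rabs (mode a d Q t m k * c m k) <=
     D * (INR k ^ (a + 2) / INR m ^ (d - 2) * r ^ (k * m) * Q (INR k * INR m * t))).
  { intros m k Hm Hk.
    assert (0 < INR m) by (apply lt_0_INR; lia). assert (0 < INR k) by (apply lt_0_INR; lia).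
    assert (0 < INR k * INR m * t) by (repeat apply Rmult_lt_0_compat; lra).
    assert (Hpos : 0 <= mode a d Q t m k).
    { unfold mode. repeat apply Rmult_le_pos; try (apply Rlt_le, exp_pos); auto.
      - apply pow_le; lra.
      - apply Rlt_le, Rinv_0_lt_compat, pow_lt; assumption. }
    rewrite Rabs_mult, (Rabs_right (mode _ _ _ _ _ _)) by lra.
    apply Rle_trans with (mode a d Q t m k * (D * (INR k * INR m) ^ 2)).
    - apply Rmult_le_compat_l; auto.
    - right. unfold mode. rewrite <- mult_INR, exp_neg_INR_mult. fold r.
      replace d with (d - 2 + 2)%nat at 1 by lia. rewrite !pow_add, mult_INR.
      assert (INR m ^ (d - 2) <> 0) by (apply pow_nonzero; lra).
      field. split; [assumption|lra]. }
  destruct (double_series_two_terms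
    (fun i j => mode a d Q t (S i) (S j) * c (S i) (S j))
    (D * (3 ^ (a + 2) * Q (3 * t) * r ^ 3)) (8 * r)
    (D * (Q (2 * t) / 2 ^ (d - 2) * r ^ 2)) r r) as [E1 [E2 L]]; try lra.
  - intros j. eapply Rle_trans; [apply Hmode; lia|].
    unfold Rdiv. rewrite !Rmult_assoc. apply Rmult_le_compat_l; [assumption|].
    change (INR 1) with 1. rewrite pow1, Rinv_1, !Rmult_1_l, Nat.mul_1_r.
    replace (S (S (S j))) with (3 + j)%nat at 2 by lia. rewrite (pow_add r 3 j), (Rpow_mult_distr 8 r j).
    assert (Hk : 3 <= INR (S (S (S j)))) by (rewrite !S_INR; generalize (pos_INR j); lra).
    assert (Q1 : Q (INR (S (S (S j))) * t) <= Q (3 * t)) by (apply HQ; nra).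
    assert (Q2 : 0 <= Q (INR (S (S (S j))) * t)) by (apply HQ0; nra).
    assert (P1 : INR (S (S (S j))) ^ (a + 2) <= 3 ^ (a + 2) * 8 ^ j).
    { apply Rle_trans with ((3 * (4/3) ^ j) ^ (a + 2)).
      - apply pow_incr. split; [lra|apply INR_le_pow_4_3].
      - rewrite Rpow_mult_distr. apply Rmult_le_compat_l; [apply pow_le; lra|].
        rewrite <- pow_mult, Nat.mul_comm, pow_mult. apply pow_incr.
        split; [apply pow_le; lra|].
        apply Rle_trans with ((4/3) ^ 7); [apply Rle_pow; [lra|lia]|lra]. }
    assert (0 <= INR (S (S (S j))) ^ (a + 2)) by (apply pow_le; lra).
    assert (0 <= r ^ 3 * r ^ j) by (apply Rmult_le_pos; apply pow_le; lra).
    replace (3 ^ (a + 2) * (Q (3 * t) * (r ^ 3 * (8 ^ j * r ^ j)))) with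
      ((3 ^ (a + 2) * 8 ^ j) * ((r ^ 3 * r ^ j) * Q (3 * t))) by ring.
    apply Rmult_le_compat; try assumption.
    + apply Rmult_le_pos; assumption.
    + apply Rmult_le_compat_l; assumption.
  - intros i j. eapply Rle_trans; [apply Hmode; lia|].
    unfold Rdiv. rewrite !Rmult_assoc. apply Rmult_le_compat_l; [assumption|].
    assert (Hm : 2 <= INR (S (S i))) by (rewrite !S_INR; generalize (pos_INR i); lra).
    assert (Hk : 1 <= INR (S j)) by (rewrite !S_INR; generalize (pos_INR j); lra).
    assert (Hkm : 2 <= INR (S j) * INR (S (S i))) by nra.
    assert (Q1 : Q (INR (S j) * INR (S (S i)) * t) <= Q (2 * t)) by (apply HQ; nra).
    assert (Q2 : 0 <= Q (INR (S j) * INR (S (S i)) * t)) by (apply HQ0; nra).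
    assert (M0 : 0 < 2 ^ (d - 2)) by (apply pow_lt; lra).
    assert (M1 : / INR (S (S i)) ^ (d - 2) <= / 2 ^ (d - 2)).
    { apply Rinv_le_contravar; [assumption|]. apply pow_incr; lra. }
    assert (M2 : 0 < / INR (S (S i)) ^ (d - 2)) by (apply Rinv_0_lt_compat, pow_lt; lra).
    (* The exponent (j+1)(i+2) is at least 2 + i + 2j. One of the two factors r^j absorbs the growth
       128^j of k^7. *)
    assert (P1 : INR (S j) ^ (a + 2) * r ^ (S j * S (S i)) <= r ^ 2 * (r ^ i * r ^ j)).
    { apply Rle_trans with (128 ^ j * (r ^ 2 * r ^ i * (r ^ 2) ^ j)).
      - apply Rmult_le_compat; [apply pow_le; lra|apply pow_le; lra| |].
        + apply Rle_trans with ((2 ^ j) ^ (a + 2)).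
          * apply pow_incr. split; [lra|apply INR_le_pow2].
          * rewrite <- pow_mult, Nat.mul_comm, pow_mult. apply pow_incr.
            split; [apply pow_le; lra|].
            apply Rle_trans with (2 ^ 7); [apply Rle_pow; [lra|lia]|lra].
        + rewrite <- pow_mult, <- !pow_add. apply pow_decr_exponent; [lra|nia].
      - replace (128 ^ j * (r ^ 2 * r ^ i * (r ^ 2) ^ j)) with
          (r ^ 2 * (r ^ i * (128 ^ j * (r ^ 2) ^ j))) by ring.
        apply Rmult_le_compat_l; [apply pow_le; lra|].
        apply Rmult_le_compat_l; [apply pow_le; lra|].
        rewrite <- Rpow_mult_distr. apply pow_incr. nra. }
    assert (0 <= INR (S j) ^ (a + 2) * r ^ (S j * S (S i))).
    { apply Rmult_le_pos; apply pow_le; lra. }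
    replace (INR (S j) ^ (a + 2) *
      (/ INR (S (S i)) ^ (d - 2) * (r ^ (S j * S (S i)) * Q (INR (S j) * (INR (S (S i)) * t)))))
     with ((INR (S j) ^ (a + 2) * r ^ (S j * S (S i))) *
       (/ INR (S (S i)) ^ (d - 2) * Q (INR (S j) * INR (S (S i)) * t)))
      by (rewrite <- (Rmult_assoc (INR (S j)) (INR (S (S i))) t); ring).
    replace (Q (2 * t) * (/ 2 ^ (d - 2) * (r ^ 2 * (r ^ i * r ^ j)))) with
      ((r ^ 2 * (r ^ i * r ^ j)) * (/ 2 ^ (d - 2) * Q (2 * t))) by ring.
    apply Rmult_le_compat; try assumption.
    + apply Rmult_le_pos; [lra|assumption].
    + apply Rmult_le_compat; lra.
  - split; [exact E1|]. split; [exact E2|].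
    unfold tail_bound. fold r.
    replace (D * (3 ^ (a + 2) * Q (3 * t) * r ^ 3 / (1 - 8 * r) +
       Q (2 * t) / 2 ^ (d - 2) * r ^ 2 / (1 - r) / (1 - r))) with
      (D * (3 ^ (a + 2) * Q (3 * t) * r ^ 3) / (1 - 8 * r) +
       D * (Q (2 * t) / 2 ^ (d - 2) * r ^ 2) / (1 - r) / (1 - r)).
    + exact L.
    + assert (2 ^ (d - 2) <> 0) by (apply pow_nonzero; lra). field. repeat split; lra.
Qed.

(** * Values of the Riemann zeta function at integers *)

Lemma inverse_power_tail (p N K : nat) : (2 <= p)%nat -> (1 <= N)%nat ->
  sum_f_R0 (fun k => / INR (S (N + k)) ^ p) K <= / INR N ^ (p - 1).
Proof.
  intros Hp HN. assert (HN' : 0 < INR N) by (apply lt_0_INR; lia).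
  assert (E : / INR N ^ (p - 1) = / INR N ^ (p - 2) * / INR N).
  { replace (p - 1)%nat with (S (p - 2)) by lia. rewrite <- tech_pow_Rmult, Rinv_mult. ring. }
  assert (Hc : 0 < / INR N ^ (p - 2)) by (apply Rinv_0_lt_compat, pow_lt; assumption).
  (* All but two of the p factors are bounded by 1/N; the remaining two give a telescoping
     difference. *)
  assert (G : forall k, / INR (S (N + k)) ^ p <= / INR N ^ (p - 2) * (/ INR (N + k) - / INR (S (N + k)))).
  { intros k. assert (0 < INR (N + k)) by (apply lt_0_INR; lia).
    assert (INR N <= INR (N + k)) by (apply le_INR; lia).
    rewrite (S_INR (N + k)). set (z := INR (N + k)) in *.
    replace (/ z - / (z + 1)) with (/ (z * (z + 1))) by (field; lra).
    replace p with (p - 2 + 2)%nat at 1 by lia.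
    rewrite pow_add, Rinv_mult.
    apply Rmult_le_compat.
    - apply Rlt_le, Rinv_0_lt_compat, pow_lt; lra.
    - apply Rlt_le, Rinv_0_lt_compat, pow_lt; lra.
    - apply Rinv_le_contravar; [apply pow_lt; assumption|]. apply pow_incr; lra.
    - apply Rinv_le_contravar; [nra|]. nra. }
  apply Rle_trans with (/ INR N ^ (p - 2) * (/ INR N - / INR (S (N + K)))).
  - induction K as [|K IH].
    + simpl sum_f_R0. eapply Rle_trans; [apply G|]. rewrite Nat.add_0_r. lra.
    + rewrite tech5. eapply Rle_trans; [apply Rplus_le_compat; [exact IH|apply G]|].
      replace (N + S K)%nat with (S (N + K)) by lia. lra.
  - rewrite E. apply Rmult_le_compat_l; [lra|].
    assert (0 < / INR (S (N + K))) by (apply Rinv_0_lt_compat, lt_0_INR; lia). lra.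
Qed.

Definition zeta_nat (p : nat) : R := Series (fun k => / INR (S k) ^ p).

Lemma zeta_nat_term_pos (p k : nat) : 0 < / INR (S k) ^ p.
Proof. apply Rinv_0_lt_compat, pow_lt, lt_0_INR; lia. Qed.

Lemma zeta_nat_partial_le (p N K : nat) : (2 <= p)%nat ->
  sum_f_R0 (fun k => / INR (S k) ^ p) K <=
  sum_f_R0 (fun k => / INR (S k) ^ p) N + / INR (S N) ^ (p - 1).
Proof.
  intros Hp.
  assert (0 < / INR (S N) ^ (p - 1)) by apply zeta_nat_term_pos.
  destruct (le_lt_dec K N) as [H1|H1].
  - assert (sum_f_R0 (fun k => / INR (S k) ^ p) K <= sum_f_R0 (fun k => / INR (S k) ^ p) N); [|lra].
    apply sum_f_R0_mono; [|assumption]. intros; apply Rlt_le, zeta_nat_term_pos.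
  - rewrite (tech2 _ N K H1). apply Rplus_le_compat_l.
    apply (inverse_power_tail p (S N) (K - S N)); lia.
Qed.

Lemma ex_series_zeta_nat (p : nat) : (2 <= p)%nat -> ex_series (fun k => / INR (S k) ^ p).
Proof.
  intros Hp.
  destruct (ex_finite_lim_seq_incr (sum_f_R0 (fun k => / INR (S k) ^ p))
     (sum_f_R0 (fun k => / INR (S k) ^ p) 0 + / INR 1 ^ (p - 1))) as [l Hl].
  - intros n. rewrite tech5. generalize (zeta_nat_term_pos p (S n)). lra.
  - intros n. apply zeta_nat_partial_le; assumption.
  - exists l. apply is_series_lim_sum_f_R0. exact Hl.
Qed.

Lemma zeta_nat_bounds (p N : nat) : (2 <= p)%nat ->
  sum_f_R0 (fun k => / INR (S k) ^ p) N <= zeta_nat p <=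
  sum_f_R0 (fun k => / INR (S k) ^ p) N + / INR (S N) ^ (p - 1).
Proof.
  intros Hp. assert (H := Series_correct _ (ex_series_zeta_nat p Hp)). split.
  - apply partial_le_series; [|exact H]. intros; apply Rlt_le, zeta_nat_term_pos.
  - apply is_series_lim_sum_f_R0 in H.
    apply (is_lim_seq_le _ (fun _ => sum_f_R0 (fun k => / INR (S k) ^ p) N + / INR (S N) ^ (p - 1)) _
      (Finite _)) with (2 := H) (3 := is_lim_seq_const _).
    intros n. apply zeta_nat_partial_le; assumption.
Qed.

(** * Fourier expansion of the Epstein zeta function *)
Definition epstein_form (x y : R) (m n : Z) : R := (IZR m * x + IZR n)^2 + (IZR m * y)^2.

Lemma epstein_form_pos (x y : R) (m n : Z) : 0 < y ->
  (Z.eqb m 0 && Z.eqb n 0)%bool = false -> 0 < epstein_form x y m n.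
Proof.
  intros Hy H. unfold epstein_form.
  destruct (Z.eq_dec m 0) as [->|Hm].
  - simpl in H. apply Z.eqb_neq in H.
    assert (IZR n <> 0) by (apply not_0_IZR; assumption).
    rewrite !Rmult_0_l, Rplus_0_l.
    assert (0 < IZR n ^ 2) by (apply pow2_gt_0; assumption). lra.
  - assert (IZR m <> 0) by (apply not_0_IZR; assumption).
    assert (0 < (IZR m * y)^2) by (apply pow2_gt_0, Rmult_integral_contrapositive_currified; lra).
    generalize (pow2_ge_0 (IZR m * x + IZR n)). lra.
Qed.

Lemma zeta_term_pow (p : nat) (x y : R) (m n : Z) : 0 < y ->
  zeta_term (INR p) x y m n =
  if (Z.eqb m 0 && Z.eqb n 0)%bool then 0 else y ^ p / epstein_form x y m n ^ p.
Proof.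
  intros Hy. unfold zeta_term. fold (epstein_form x y m n).
  destruct (Z.eqb m 0 && Z.eqb n 0)%bool eqn:E; [reflexivity|].
  rewrite !Rpower_pow; [reflexivity|apply epstein_form_pos; assumption|assumption].
Qed.

Lemma zeta_term_nonneg (s x y : R) (m n : Z) : 0 <= zeta_term s x y m n.
Proof.
  unfold zeta_term. destruct (_ && _)%bool; [lra|].
  apply Rlt_le, Rdiv_lt_0_compat; apply exp_pos.
Qed.

Lemma zeta_term_opp (s x y : R) (m n : Z) : zeta_term s x y (- m) (- n) = zeta_term s x y m n.
Proof.
  unfold zeta_term. rewrite !opp_IZR.
  replace (Z.eqb (- m) 0) with (Z.eqb m 0) by (destruct (Z.eqb_spec m 0), (Z.eqb_spec (- m) 0); lia).
  replace (Z.eqb (- n) 0) with (Z.eqb n 0) by (destruct (Z.eqb_spec n 0), (Z.eqb_spec (- n) 0); lia).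
  replace ((- IZR m * x + - IZR n) ^ 2 + (- IZR m * y) ^ 2) with
    ((IZR m * x + IZR n) ^ 2 + (IZR m * y) ^ 2) by ring. reflexivity.
Qed.

Lemma zfold_opp (g : Z -> R) (j : nat) : zfold (fun n => g (- n)%Z) j = zfold g j.
Proof. destruct j; unfold zfold; [reflexivity|]. rewrite Z.opp_involutive. ring. Qed.

Lemma zeta_row_0 (p : nat) (x y : R) : (2 <= p)%nat -> 0 < y ->
  is_series (zfold (zeta_term (INR p) x y 0)) (2 * zeta_nat (2 * p) * y ^ p).
Proof.
  intros Hp Hy.
  replace (2 * zeta_nat (2 * p) * y ^ p) with
    (zfold (zeta_term (INR p) x y 0) 0 + 2 * y ^ p * zeta_nat (2 * p)).
  2:{ unfold zfold, zeta_term; simpl. ring. }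
  apply is_series_cons.
  apply (is_series_ext (fun k => 2 * y ^ p * / INR (S k) ^ (2 * p))).
  - intros k. unfold zfold. rewrite !zeta_term_pow by assumption.
    replace (Z.eqb (Z.of_nat (S k)) 0) with false by (symmetry; apply Z.eqb_neq; lia).
    replace (Z.eqb (- Z.of_nat (S k)) 0) with false by (symmetry; apply Z.eqb_neq; lia).
    simpl andb. unfold epstein_form. rewrite opp_IZR, <- INR_IZR_INZ, !pow_mult.
    replace ((0 * x + INR (S k)) ^ 2 + (0 * y) ^ 2) with (INR (S k) ^ 2) by ring.
    replace ((0 * x + - INR (S k)) ^ 2 + (0 * y) ^ 2) with (INR (S k) ^ 2) by ring.
    unfold Rdiv. rewrite <- Rmult_plus_distr_l.
    match goal with |- ?a = ?b => change (@eq R a b) end. ring.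
  - apply is_series_Rmult_l. apply Series_correct, ex_series_zeta_nat. lia.
Qed.

(** Here s = n + 1. Row m is the one-dimensional lattice sum at (m x, m y), and the prefactor
    removes the 2^n n! of [lattice_family]. *)
Definition zeta_row (n : nat) (x y : R) (m : nat) : R :=
  y ^ S n / (2 ^ n * INR (fact n)) *
  Series (fun i => fourier_weight (INR m * x) i * fourier_family i n (INR m * y)).

Lemma zeta_row_pos (n : nat) (x y : R) (m : nat) : (0 < m)%nat -> 0 < y ->
  is_series (zfold (zeta_term (INR (S n)) x y (Z.of_nat m))) (zeta_row n x y m).
Proof.
  intros Hm Hy. assert (0 < INR m) by (apply lt_0_INR; lia).
  unfold zeta_row.
  apply (is_series_ext (fun i => y ^ S n / (2 ^ n * INR (fact n)) *
     lattice_family (INR m * x) i n (INR m * y))).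
  - intros i. unfold lattice_family. rewrite <- zfold_scal. apply zfold_ext.
    intros j. rewrite zeta_term_pow by assumption.
    replace (Z.eqb (Z.of_nat m) 0) with false by (symmetry; apply Z.eqb_neq; lia).
    simpl andb. unfold epstein_form, shifted_square. rewrite <- INR_IZR_INZ.
    fold (shifted_square (INR m * x) j (INR m * y)).
    assert (0 < shifted_square (INR m * x) j (INR m * y)).
    { apply shifted_square_pos. nra. }
    assert (INR (fact n) <> 0) by apply INR_fact_neq_0.
    assert (2 ^ n <> 0) by (apply pow_nonzero; lra).
    assert (shifted_square (INR m * x) j (INR m * y) ^ S n <> 0) by (apply pow_nonzero; lra).
    match goal with |- ?a = ?b => change (@eq R a b) end.
    field. auto.
  - apply is_series_Rmult_l, lattice_fourier_series. nra.
Qed.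

Lemma zeta_row_neg (n : nat) (x y : R) (m : nat) : (0 < m)%nat -> 0 < y ->
  is_series (zfold (zeta_term (INR (S n)) x y (- Z.of_nat m))) (zeta_row n x y m).
Proof.
  intros Hm Hy.
  apply (is_series_ext (zfold (zeta_term (INR (S n)) x y (Z.of_nat m)))).
  - intros j. rewrite <- zfold_opp. apply zfold_ext. intros k.
    rewrite <- zeta_term_opp. f_equal. lia.
  - apply zeta_row_pos; assumption.
Qed.

Lemma zeta_partial_limit (n : nat) (x y : R) : (1 <= n)%nat -> 0 < y ->
  ex_series (fun i => zeta_row n x y (S i)) ->
  is_lim_seq (zeta_partial (INR (S n)) x y)
    (2 * zeta_nat (2 * S n) * y ^ S n + 2 * Series (fun i => zeta_row n x y (S i))).
Proof.
  intros Hn Hy Hex.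
  set (R0 := fun m : Z => match m with Z0 => 2 * zeta_nat (2 * S n) * y ^ S n
     | _ => zeta_row n x y (Z.abs_nat m) end).
  apply (zsum_square_converge (zeta_term (INR (S n)) x y) R0).
  - intros; apply zeta_term_nonneg.
  - intros m. destruct m as [|m|m]; unfold R0.
    + apply zeta_row_0; [lia|assumption].
    + replace (Z.pos m) with (Z.of_nat (Z.abs_nat (Z.pos m))) at 1 by lia.
      apply zeta_row_pos; [lia|assumption].
    + replace (Z.neg m) with (- Z.of_nat (Z.abs_nat (Z.neg m)))%Z at 1 by lia.
      apply zeta_row_neg; [lia|assumption].
  - apply (is_series_cons (zfold R0)).
    apply (is_series_ext (fun i => 2 * zeta_row n x y (S i))).
    + intros i. unfold zfold, R0.
      change (Z.of_nat (S i)) with (Z.pos (Pos.of_succ_nat i)).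
      simpl Z.opp. simpl Z.abs_nat. rewrite SuccNat2Pos.id_succ.
      match goal with |- ?a = ?b => change (@eq R a b) end. ring.
    + apply is_series_Rmult_l, Series_correct, Hex.
Qed.

(** Stated through the two coefficient identities so that s = 3 and s = 6 share one proof. The zero
    frequencies of the rows decay like m^(-2n-1) and sum to V zeta(2n+1). *)
Lemma zeta_mode_expansion (n : nat) (a d : nat) (Q : R -> R) (A V x y : R) :
  (1 <= n)%nat -> (a <= 5)%nat -> (2 <= d)%nat ->
  (forall s, 0 < s -> 0 <= Q s) -> (forall s s', 0 < s <= s' -> Q s' <= Q s) ->
  0 < y -> exp (- (2 * PI * y)) <= / 128 ->
  (forall m k, (0 < m)%nat -> (0 < k)%nat ->
     2 * y ^ S n / (2 ^ n * INR (fact n)) * fourier_family k n (INR m * y) =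
     A * mode a d Q (2 * PI * y) m k) ->
  (forall m, (0 < m)%nat ->
     2 * y ^ S n / (2 ^ n * INR (fact n)) * central_mode n (INR m * y) =
     V * / INR m ^ (2 * n + 1)) ->
  is_lim_seq (zeta_partial (INR (S n)) x y)
    (2 * zeta_nat (2 * S n) * y ^ S n + V * zeta_nat (2 * n + 1) +
     A * mode_sum a d Q (2 * PI * y) (fun m k => cos (INR k * INR m * (2 * PI * x)))).
Proof.
  intros Hn Ha Hd HQ0 HQ Hy Hr Hmode Hc. assert (Hpi := PI_RGT_0).
  destruct (mode_sum_two_terms a d Q (2 * PI * y) (fun m k => cos (INR k * INR m * (2 * PI * x))) 1)
    as [E1 [E2 _]]; try assumption.
  { nra. }
  { intros m k Hm Hk.
    assert (1 <= INR m) by (apply (le_INR 1); lia). assert (1 <= INR k) by (apply (le_INR 1); lia).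
    apply Rle_trans with 1; [apply Rabs_le, COS_bound|].
    assert (1 <= INR k * INR m) by nra. nra. }
  assert (Hrow : forall i, 2 * zeta_row n x y (S i) =
    V * / INR (S i) ^ (2 * n + 1) +
    A * Series (fun j => mode a d Q (2 * PI * y) (S i) (S j) *
        cos (INR (S j) * INR (S i) * (2 * PI * x)))).
  { intros i. unfold zeta_row.
    assert (Hm : 0 < INR (S i)) by (apply lt_0_INR; lia).
    (* Splits off frequency 0 of the row, which feeds the V term. *)
    rewrite Series_incr_1.
    2:{ apply ex_series_weighted; auto using fourier_weight_abs.
        - intros; apply fourier_family_nonneg; nra.
        - apply family_ex_series; [apply fourier_family_radial|nra]. }
    rewrite <- Series_scal_l, <- Hc by lia.
    replace (fourier_weight (INR (S i) * x) 0) with 1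
      by (unfold fourier_weight; simpl (INR 0); rewrite Rmult_0_l, cos_0; reflexivity).
    set (K := y ^ S n / (2 ^ n * INR (fact n))).
    replace (2 * y ^ S n / (2 ^ n * INR (fact n))) with (2 * K) by (unfold K, Rdiv; ring).
    rewrite <- Rmult_assoc, Rmult_plus_distr_l, Rmult_1_l. f_equal.
    rewrite <- Series_scal_l. apply Series_ext. intros j.
    rewrite <- (Rmult_assoc A), <- Hmode by lia. unfold K, fourier_weight.
    replace (INR (S j) * (2 * PI * (INR (S i) * x))) with
      (INR (S j) * INR (S i) * (2 * PI * x)) by ring.
    unfold Rdiv. ring. }
  assert (Hz := ex_series_zeta_nat (2 * n + 1) ltac:(lia)).
  assert (X1 : ex_series (fun i => V * / INR (S i) ^ (2 * n + 1))) by (apply ex_series_Rmult_l; exact Hz).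
  assert (X2 : ex_series (fun i => A * Series (fun j => mode a d Q (2 * PI * y) (S i) (S j) *
        cos (INR (S j) * INR (S i) * (2 * PI * x))))) by (apply ex_series_Rmult_l; exact E2).
  assert (Hex : ex_series (fun i => 2 * zeta_row n x y (S i))).
  { apply (ex_series_ext (fun i => V * / INR (S i) ^ (2 * n + 1) +
      A * Series (fun j => mode a d Q (2 * PI * y) (S i) (S j) *
        cos (INR (S j) * INR (S i) * (2 * PI * x))))).
    - intros i; symmetry; apply Hrow.
    - apply ex_series_Rplus; assumption. }
  assert (Hex' : ex_series (fun i => zeta_row n x y (S i))).
  { apply (ex_series_ext (fun i => / 2 * (2 * zeta_row n x y (S i)))).
    - intros i. match goal with |- ?a = ?b => change (@eq R a b) end. field.
    - apply ex_series_Rmult_l; assumption. }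
  assert (L := zeta_partial_limit n x y Hn Hy Hex').
  replace (2 * zeta_nat (2 * S n) * y ^ S n + V * zeta_nat (2 * n + 1) +
     A * mode_sum a d Q (2 * PI * y) (fun m k => cos (INR k * INR m * (2 * PI * x)))) with
   (2 * zeta_nat (2 * S n) * y ^ S n + 2 * Series (fun i => zeta_row n x y (S i))); [exact L|].
  rewrite Rplus_assoc. f_equal. unfold zeta_nat, mode_sum.
  rewrite <- !Series_scal_l, <- Series_plus by assumption.
  apply Series_ext. exact Hrow.
Qed.

(** [p2] and [p5] are the Bessel polynomials of degree 2 and 5. *)
Definition p2 (v : R) : R := 1 + v * (3 + 3 * v).
Definition p5 (v : R) : R := 1 + v * (15 + v * (105 + v * (420 + v * (945 + 945 * v)))).

Lemma p2_mono (v w : R) : 0 <= v <= w -> 1 <= p2 v <= p2 w.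
Proof.
  intros H. unfold p2. assert (0 <= v^2) by (apply pow_le; lra).
  assert (v^2 <= w^2) by (apply pow_incr; lra). lra.
Qed.

Lemma p5_mono (v w : R) : 0 <= v <= w -> 1 <= p5 v <= p5 w.
Proof.
  intros H. unfold p5.
  assert (0 <= v^2 <= w^2) by (split; [apply pow_le|apply pow_incr]; lra).
  assert (0 <= v^3 <= w^3) by (split; [apply pow_le|apply pow_incr]; lra).
  assert (0 <= v^4 <= w^4) by (split; [apply pow_le|apply pow_incr]; lra).
  assert (0 <= v^5 <= w^5) by (split; [apply pow_le|apply pow_incr]; lra). lra.
Qed.

(* [exp(-t) Q2(t)] and [exp(-t) Q5(t)] are [sqrt(2t/PI)] times [K_(5/2)(t)] and [K_(11/2)(t)]. *)
Definition Q2 (t : R) : R := p2 (/ t).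
Definition Q5 (t : R) : R := p5 (/ t).

Lemma Q2_nonneg (s : R) : 0 < s -> 0 <= Q2 s.
Proof.
  intros H. assert (0 < / s) by (apply Rinv_0_lt_compat; assumption).
  unfold Q2. generalize (p2_mono (/ s) (/ s)); lra.
Qed.

Lemma Q5_nonneg (s : R) : 0 < s -> 0 <= Q5 s.
Proof.
  intros H. assert (0 < / s) by (apply Rinv_0_lt_compat; assumption).
  unfold Q5. generalize (p5_mono (/ s) (/ s)); lra.
Qed.

Lemma Q2_decr (s s' : R) : 0 < s <= s' -> Q2 s' <= Q2 s.
Proof.
  intros H. apply p2_mono. split; [apply Rlt_le, Rinv_0_lt_compat; lra|].
  apply Rinv_le_contravar; lra.
Qed.

Lemma Q5_decr (s s' : R) : 0 < s <= s' -> Q5 s' <= Q5 s.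
Proof.
  intros H. apply p5_mono. split; [apply Rlt_le, Rinv_0_lt_compat; lra|].
  apply Rinv_le_contravar; lra.
Qed.

Lemma bessel_half_2 (t : R) : 0 < t -> bessel_half 2 t = exp (- t) * Q2 t / t ^ 3.
Proof. intros H. unfold bessel_half, Q2, p2. simpl INR. field. lra. Qed.

Lemma bessel_half_5 (t : R) : 0 < t -> bessel_half 5 t = exp (- t) * Q5 t / t ^ 6.
Proof. intros H. unfold bessel_half, Q5, p5. simpl INR. field. lra. Qed.

Definition phase (x : R) (m k : nat) : R := cos (INR k * INR m * (2 * PI * x)).

Lemma zeta3_expansion (x y : R) : 0 < y -> exp (- (2 * PI * y)) <= / 128 ->
  is_lim_seq (zeta_partial 3 x y)
    (2 * zeta_nat 6 * y ^ 3 + 3 * PI / 4 / y ^ 2 * zeta_nat 5 +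
     2 * PI ^ 3 * mode_sum 2 3 Q2 (2 * PI * y) (phase x)).
Proof.
  intros Hy Hr. assert (Hpi := PI_RGT_0).
  replace 3 with (INR 3) at 1 by (simpl; lra).
  apply (zeta_mode_expansion 2 2 3 Q2 (2 * PI^3) (3 * PI / 4 / y ^ 2) x y);
    auto using Q2_nonneg, Q2_decr.
  - intros m k Hm Hk.
    assert (0 < INR m) by (apply lt_0_INR; lia). assert (0 < INR k) by (apply lt_0_INR; lia).
    destruct k as [|k]; [lia|]. unfold fourier_family, mode.
    set (kk := INR (S k)) in *.
    replace (2 * PI * kk * (INR m * y)) with (kk * INR m * (2 * PI * y)) by ring.
    assert (0 < 2 * PI * y) by (apply Rmult_lt_0_compat; lra).
    rewrite bessel_half_2 by (apply Rmult_lt_0_compat; [apply Rmult_lt_0_compat|]; assumption).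
    change (2 * 2 + 1)%nat with 5%nat. change (INR (fact 2)) with 2.
    replace (kk * INR m * (2 * PI * y)) with (2 * PI * kk * INR m * y) by ring.
    field. repeat split; lra.
  - intros m Hm. assert (0 < INR m) by (apply lt_0_INR; lia).
    simpl fact. simpl INR at 1. unfold central_mode. simpl (INR 0). simpl (INR 1).
    simpl (2 * 2 + 1)%nat. field. split; lra.
Qed.

Lemma zeta6_expansion (x y : R) : 0 < y -> exp (- (2 * PI * y)) <= / 128 ->
  is_lim_seq (zeta_partial 6 x y)
    (2 * zeta_nat 12 * y ^ 6 + 63 * PI / 128 / y ^ 5 * zeta_nat 11 +
     PI ^ 6 / 30 * mode_sum 5 6 Q5 (2 * PI * y) (phase x)).
Proof.
  intros Hy Hr. assert (Hpi := PI_RGT_0).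
  replace 6 with (INR 6) at 1 by (simpl; lra).
  apply (zeta_mode_expansion 5 5 6 Q5 (PI^6 / 30) (63 * PI / 128 / y ^ 5) x y);
    auto using Q5_nonneg, Q5_decr; try lia.
  - intros m k Hm Hk.
    assert (0 < INR m) by (apply lt_0_INR; lia). assert (0 < INR k) by (apply lt_0_INR; lia).
    destruct k as [|k]; [lia|]. unfold fourier_family, mode.
    set (kk := INR (S k)) in *.
    replace (2 * PI * kk * (INR m * y)) with (kk * INR m * (2 * PI * y)) by ring.
    assert (0 < 2 * PI * y) by (apply Rmult_lt_0_compat; lra).
    rewrite bessel_half_5 by (apply Rmult_lt_0_compat; [apply Rmult_lt_0_compat|]; assumption).
    change (2 * 5 + 1)%nat with 11%nat.
    replace (INR (fact 5)) with 120 by (rewrite INR_IZR_INZ; reflexivity).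
    replace (kk * INR m * (2 * PI * y)) with (2 * PI * kk * INR m * y) by ring.
    field. repeat split; lra.
  - intros m Hm. assert (0 < INR m) by (apply lt_0_INR; lia).
    replace (INR (fact 5)) with 120 by (rewrite INR_IZR_INZ; reflexivity). unfold central_mode. simpl (INR 0). simpl (INR 1).
    replace (INR 2) with 2 by (simpl; lra). replace (INR 3) with 3 by (simpl; lra).
    replace (INR 4) with 4 by (simpl; lra).
    simpl (2 * 5 + 1)%nat. field. split; lra.
Qed.

(** * The one-variable inequality *)
Lemma PI_approx : 3.141592 < PI < 3.141594.
Proof.
  assert (H := PI_2_3_7_ineq 3).
  unfold tg_alt, PI_2_3_7_tg, Ratan_seq in H. cbn [sum_f_R0 Nat.mul Nat.add] in H.
  rewrite !INR_IZR_INZ in H. cbn [Z.of_nat Pos.of_succ_nat Pos.succ Nat.mul Nat.add] in H. lra.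
Qed.

Lemma exp_neg_partial_5 (x : R) :
  exp_neg_partial 5 x = 1 - x + x^2/2 - x^3/6 + x^4/24 - x^5/120.
Proof.
  unfold exp_neg_partial. cbn [sum_f_R0].
  change (INR (fact 0)) with 1. change (INR (fact 1)) with 1. change (INR (fact 2)) with 2.
  replace (INR (fact 3)) with 6 by (rewrite INR_IZR_INZ; reflexivity).
  replace (INR (fact 4)) with 24 by (rewrite INR_IZR_INZ; reflexivity).
  replace (INR (fact 5)) with 120 by (rewrite INR_IZR_INZ; reflexivity).
  field.
Qed.

Lemma exp_neg_partial_6 (x : R) :
  exp_neg_partial 6 x = 1 - x + x^2/2 - x^3/6 + x^4/24 - x^5/120 + x^6/720.
Proof.
  unfold exp_neg_partial. rewrite tech5. fold (exp_neg_partial 5 x).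
  rewrite exp_neg_partial_5.
  replace (INR (fact 6)) with 720 by (rewrite INR_IZR_INZ; reflexivity).
  field.
Qed.

Lemma exp_neg_antitone (s t : R) : s <= t -> exp (- t) <= exp (- s).
Proof.
  intros H. destruct (Req_dec s t) as [->|]; [lra|]. apply Rlt_le, exp_increasing; lra.
Qed.

(* [exp(-16x)] by four squarings, rounding in between keeps the rational numbers small. *)
Lemma exp_neg_upper16 (x a1 a2 a3 a4 a5 t : R) : 0 <= x -> 16 * x <= t ->
  1 - x * (1 - x / 2 * (1 - x / 3 * (1 - x / 4 * (1 - x / 5 * (1 - x / 6))))) <= a1 ->
  a1 * a1 <= a2 -> a2 * a2 <= a3 -> a3 * a3 <= a4 -> a4 * a4 <= a5 -> exp (- t) <= a5.
Proof.
  intros Hx Ht H1 H2 H3 H4 H5.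
  assert (Hsq : forall u a b, exp (- u) <= a -> a * a <= b -> exp (- (u + u)) <= b).
  { intros u a b Ha Hb. rewrite Ropp_plus_distr, exp_plus. apply Rle_trans with (2 := Hb).
    apply Rmult_le_compat; try assumption; apply Rlt_le, exp_pos. }
  assert (E1 : exp (- x) <= a1).
  { apply Rle_trans with (2 := H1). generalize (exp_neg_alternating 6 x Hx).
    rewrite exp_neg_partial_6. lra. }
  assert (E5 := Hsq _ _ _ (Hsq _ _ _ (Hsq _ _ _ (Hsq _ _ _ E1 H2) H3) H4) H5).
  apply Rle_trans with (2 := E5). apply exp_neg_antitone. lra.
Qed.

Lemma exp_neg_lower16 (x a1 a2 a3 a4 a5 t : R) : 0 <= x -> t <= 16 * x ->
  0 <= a1 -> 0 <= a2 -> 0 <= a3 -> 0 <= a4 ->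
  a1 <= 1 - x * (1 - x / 2 * (1 - x / 3 * (1 - x / 4 * (1 - x / 5)))) ->
  a2 <= a1 * a1 -> a3 <= a2 * a2 -> a4 <= a3 * a3 -> a5 <= a4 * a4 -> a5 <= exp (- t).
Proof.
  intros Hx Ht P1 P2 P3 P4 H1 H2 H3 H4 H5.
  assert (Hsq : forall u a b, 0 <= a -> a <= exp (- u) -> b <= a * a -> b <= exp (- (u + u))).
  { intros u a b Pa Ha Hb. rewrite Ropp_plus_distr, exp_plus. apply Rle_trans with (1 := Hb).
    apply Rmult_le_compat; assumption. }
  assert (E1 : a1 <= exp (- x)).
  { apply Rle_trans with (1 := H1). generalize (exp_neg_alternating 5 x Hx).
    rewrite exp_neg_partial_5. lra. }
  assert (E5 := Hsq _ _ _ P4 (Hsq _ _ _ P3 (Hsq _ _ _ P2 (Hsq _ _ _ P1 E1 H2) H3) H4) H5).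
  apply Rle_trans with (1 := E5). apply exp_neg_antitone. lra.
Qed.


(* [tail_bound] divided by [exp(-t)], as a function of [r = exp(-t)] and [v = 1/t]. *)
Definition err6 (r v : R) : R :=
  2187 * p5 (v/3) * r^2 / (1 - 8 * r) + p5 (v/2) / 16 * r / (1 - r) / (1 - r).
Definition err3 (r v : R) : R :=
  81 * p2 (v/3) * r^2 / (1 - 8 * r) + p2 (v/2) / 2 * r / (1 - r) / (1 - r).

Lemma err_mono_aux (c d A A' B B' r r' : R) : 0 <= c -> 0 <= d -> 0 <= A <= A' -> 0 <= B <= B' ->
  0 <= r <= r' -> r' <= / 128 ->
  0 <= c * A * r^2 / (1 - 8 * r) + B / d * r / (1 - r) / (1 - r) <=
  c * A' * r'^2 / (1 - 8 * r') + B' / d * r' / (1 - r') / (1 - r').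
Proof.
  intros Hc Hd HA HB Hr Hr'.
  assert (I1 : 0 < / (1 - 8 * r) <= / (1 - 8 * r')).
  { split; [apply Rinv_0_lt_compat; lra|apply Rinv_le_contravar; lra]. }
  assert (I2 : 0 < / (1 - r) <= / (1 - r')).
  { split; [apply Rinv_0_lt_compat; lra|apply Rinv_le_contravar; lra]. }
  assert (I3 : 0 <= r^2 <= r'^2) by (split; [apply pow_le|apply pow_incr]; lra).
  assert (I4 : 0 <= / d).
  { destruct Hd as [Hd|<-]; [apply Rlt_le, Rinv_0_lt_compat; assumption|rewrite Rinv_0; lra]. }
  unfold Rdiv.
  assert (T1 : 0 <= c * A * r^2 * / (1 - 8 * r)) by (repeat apply Rmult_le_pos; lra).
  assert (T2 : 0 <= B * / d * r * / (1 - r) * / (1 - r)) by (repeat apply Rmult_le_pos; lra).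
  assert (T3 : c * A * r^2 * / (1 - 8 * r) <= c * A' * r'^2 * / (1 - 8 * r')).
  { repeat apply Rmult_le_compat; try lra; repeat apply Rmult_le_pos; lra. }
  assert (T4 : B * / d * r * / (1 - r) * / (1 - r) <= B' * / d * r' * / (1 - r') * / (1 - r')).
  { repeat apply Rmult_le_compat; try lra; repeat apply Rmult_le_pos; lra. }
  lra.
Qed.

Lemma err6_mono (r r' v v' : R) : 0 <= v <= v' -> 0 <= r <= r' -> r' <= / 128 ->
  0 <= err6 r v <= err6 r' v'.
Proof.
  intros Hv Hr Hr'. apply err_mono_aux; try lra.
  - generalize (p5_mono (v/3) (v'/3) ltac:(lra)); lra.
  - generalize (p5_mono (v/2) (v'/2) ltac:(lra)); lra.
Qed.

Lemma err3_mono (r r' v v' : R) : 0 <= v <= v' -> 0 <= r <= r' -> r' <= / 128 ->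
  0 <= err3 r v <= err3 r' v'.
Proof.
  intros Hv Hr Hr'. apply err_mono_aux; try lra.
  - generalize (p2_mono (v/3) (v'/3) ltac:(lra)); lra.
  - generalize (p2_mono (v/2) (v'/2) ltac:(lra)); lra.
Qed.

(** Contribution of mode (1,1) to b zeta(3) - zeta(6), whereas [second_gap] is that of mode (1,2)
    with the opposite sign. The inequality to prove reads: k times the error of zeta(6), plus b
    times that of zeta(3), plus q r [second_gap], is at most [main_gap]. *)
Definition main_gap (b k v : R) : R := b * p2 v - k * p5 v.
Definition second_gap (b k v : R) : R := 32 * k * p5 (v/2) - 4 * b * p2 (v/2).

(** Concavity in v >= 0 reduces an interval to its endpoints: the quadratic coefficient 3b - 105k
    and all higher ones are negative. [E1] is the interpolation formula; the divided difference of
    v^n at three points is the complete homogeneous polynomial of degree n - 2, whence [h2] and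
    [h3]. *)
Lemma main_gap_concave (b k va vb v E : R) :
  0 <= va <= v -> v <= vb -> b <= 4 -> / 2 <= k ->
  E <= main_gap b k va -> E <= main_gap b k vb -> E <= main_gap b k v.
Proof.
  intros Hva Hvb Hb Hk Ha Hb'.
  destruct (Req_dec va vb) as [->|Hne]; [replace v with vb by lra; assumption|].
  set (h3 := va^3 + v^3 + vb^3 + va^2*v + va^2*vb + v^2*va + v^2*vb + vb^2*va + vb^2*v + va*v*vb).
  set (h2 := va^2 + v^2 + vb^2 + va*v + va*vb + v*vb).
  assert (E1 : (vb - va) * main_gap b k v =
    (vb - v) * main_gap b k va + (v - va) * main_gap b k vb +
    (v - va) * (vb - v) * (vb - va) *
      (k * (105 + 420 * (va + v + vb) + 945 * h2 + 945 * h3) - 3 * b)).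
  { unfold main_gap, p2, p5, h2, h3. ring. }
  assert (0 <= h2) by (unfold h2; nra).
  assert (0 <= h3).
  { unfold h3. assert (0 <= v) by lra. assert (0 <= vb) by lra. assert (0 <= va) by lra.
    repeat first [assumption | apply Rplus_le_le_0_compat | apply pow_le | apply Rmult_le_pos]. }
  assert (0 <= k * (105 + 420 * (va + v + vb) + 945 * h2 + 945 * h3) - 3 * b) by nra.
  assert (0 <= (v - va) * (vb - v) * (vb - va) *
      (k * (105 + 420 * (va + v + vb) + 945 * h2 + 945 * h3) - 3 * b)).
  { repeat apply Rmult_le_pos; lra. }
  apply (Rmult_le_reg_l (vb - va)); [lra|]. rewrite E1. nra.
Qed.

Lemma second_gap_mono (b k v w : R) : 0 <= b -> 4 * b <= 32 * k -> 0 <= v <= w ->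
  0 <= second_gap b k v <= second_gap b k w.
Proof.
  intros Hb Hk Hv. unfold second_gap, p2, p5.
  set (x := v/2). set (y := w/2). assert (Hx : 0 <= x <= y) by (unfold x, y; lra).
  assert (G2 : 0 <= x^2 <= y^2) by (split; [apply pow_le|apply pow_incr]; lra).
  assert (G3 : 0 <= x^3 <= y^3) by (split; [apply pow_le|apply pow_incr]; lra).
  assert (G4 : 0 <= x^4 <= y^4) by (split; [apply pow_le|apply pow_incr]; lra).
  assert (G5 : 0 <= x^5 <= y^5) by (split; [apply pow_le|apply pow_incr]; lra).
  assert (E : forall z, 32 * k * (1 + z * (15 + z * (105 + z * (420 + z * (945 + 945 * z))))) -
     4 * b * (1 + z * (3 + 3 * z)) = (32 * k - 4 * b) * (1 + 3 * z + 3 * z^2) +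
     32 * k * (12 * z + 102 * z ^ 2 + 420 * z ^ 3 + 945 * z ^ 4 + 945 * z ^ 5)) by (intros; ring).
  rewrite !E. split.
  - apply Rplus_le_le_0_compat; apply Rmult_le_pos; lra.
  - apply Rplus_le_compat; apply Rmult_le_compat_l; lra.
Qed.

(** Slightly above PI^3/60 = 0.51677..., the ratio of the mode coefficients PI^6/30 of zeta(6) and 2
    PI^3 of zeta(3). *)
Definition kappa_max : R := 51678 / 100000.

(* With [v = 1/t], [r = exp(-t)], [t = 2 PI y], [k = PI^3/60] and [q = 2 (c + c')]: the difference of
   zeta(6) between two points at height y with cos(2 PI x) equal to c and c' is at most b times that
   of zeta(3). Both differences have been divided by [2 PI^3 r (c - c')]. *)
Definition dominated (b k v r q : R) : Prop :=
  k * (p5 v + 32 * q * r * p5 (v/2) + err6 r v) <= b * (p2 v + 4 * q * r * p2 (v/2) - err3 r v).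

Lemma dominated_of_bounds (b k va vb v rh r q S e6 e3 M : R) :
  0 <= va <= v -> v <= vb -> 0 <= r <= rh -> rh <= / 128 -> 0 <= b <= 4 -> -4 <= q ->
  0 <= k <= kappa_max ->
  q * r * second_gap b kappa_max v <= S -> err6 rh vb <= e6 -> err3 rh vb <= e3 ->
  M <= main_gap b kappa_max va -> M <= main_gap b kappa_max vb ->
  kappa_max * e6 + b * e3 + S <= M ->
  dominated b k v r q.
Proof.
  intros Hva Hvb Hr Hrh Hb Hq Hk HS He6 He3 Ha Hb' HM.
  assert (Hm := main_gap_concave b kappa_max va vb v _ Hva Hvb (proj2 Hb)
    ltac:(unfold kappa_max; lra) Ha Hb').
  assert (H6 := err6_mono r rh v vb ltac:(lra) Hr Hrh).
  assert (H3 := err3_mono r rh v vb ltac:(lra) Hr Hrh).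
  assert (Hk6 : kappa_max * err6 r v <= kappa_max * e6)
    by (apply Rmult_le_compat_l; unfold kappa_max; lra).
  assert (Hk3 : b * err3 r v <= b * e3) by (apply Rmult_le_compat_l; lra).
  unfold dominated.
  apply Rle_trans with (kappa_max * (p5 v + 32 * q * r * p5 (v / 2) + err6 r v)).
  (* Replacing k by [kappa_max] is conservative only if the bracket is nonnegative: 32 q r >= -128 r
     >= -1, and [p5 (v/2)] is at most [p5 v]. *)
  - apply Rmult_le_compat_r; [|lra].
    assert (P1 := p5_mono (v/2) v ltac:(lra)).
    assert (0 <= (q + 4) * (r * p5 (v/2))) by (repeat apply Rmult_le_pos; lra).
    assert (r * p5 (v/2) <= / 128 * p5 v) by (apply Rmult_le_compat; lra). lra.
  - unfold main_gap, second_gap in *. lra.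
Qed.

(** For a nonnegative bound on q the second mode works against the inequality, so r and [second_gap]
    are taken at their largest. *)
Lemma dominated_pos_piece (b k va vb v rh r qh q e6 e3 B M : R) :
  0 <= va <= v -> v <= vb -> 0 <= r <= rh -> rh <= / 128 -> 0 <= b <= 4 -> -4 <= q <= qh ->
  0 <= k <= kappa_max -> 0 <= qh ->
  err6 rh vb <= e6 -> err3 rh vb <= e3 -> second_gap b kappa_max vb <= B ->
  M <= main_gap b kappa_max va -> M <= main_gap b kappa_max vb ->
  kappa_max * e6 + b * e3 + qh * rh * B <= M ->
  dominated b k v r q.
Proof.
  intros Hva Hvb Hr Hrh Hb Hq Hk Hqh He6 He3 HB.
  apply dominated_of_bounds with (rh := rh); try assumption; try lra.
  assert (G := second_gap_mono b kappa_max v vb ltac:(lra) ltac:(unfold kappa_max; lra) ltac:(lra)).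
  apply Rle_trans with (qh * r * second_gap b kappa_max v).
  - apply Rmult_le_compat_r; [lra|]. apply Rmult_le_compat_r; lra.
  - apply Rmult_le_compat; try lra; [apply Rmult_le_pos; lra|].
    apply Rmult_le_compat_l; lra.
Qed.

(** For a nonpositive bound on q the second mode helps, so lower bounds for r and [second_gap] are
    needed as well. *)
Lemma dominated_neg_piece (b k va vb v rl rh r qh q e6 e3 B M : R) :
  0 <= va <= v -> v <= vb -> 0 <= rl <= r -> r <= rh -> rh <= / 128 -> 0 <= b <= 4 ->
  -4 <= q <= qh -> 0 <= k <= kappa_max -> qh <= 0 ->
  err6 rh vb <= e6 -> err3 rh vb <= e3 -> 0 <= B <= second_gap b kappa_max va ->
  M <= main_gap b kappa_max va -> M <= main_gap b kappa_max vb ->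
  kappa_max * e6 + b * e3 + qh * rl * B <= M ->
  dominated b k v r q.
Proof.
  intros Hva Hvb Hrl Hr Hrh Hb Hq Hk Hqh He6 He3 HB.
  apply dominated_of_bounds with (rh := rh); try assumption; try lra.
  assert (G := second_gap_mono b kappa_max va v ltac:(lra) ltac:(unfold kappa_max; lra) ltac:(lra)).
  apply Rle_trans with (qh * r * second_gap b kappa_max v).
  - apply Rmult_le_compat_r; [lra|]. apply Rmult_le_compat_r; lra.
  - assert (K : rl * B <= r * second_gap b kappa_max v) by (apply Rmult_le_compat; lra).
    rewrite !Rmult_assoc. apply Rmult_le_compat_neg_l; assumption.
Qed.

(** The left side is nonnegative and free of b; hence the factor of b on the right is nonnegative
    too, and increasing b only helps. *)
Lemma dominated_larger_b (b b' k v r q : R) :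
  b <= b' -> 0 < b -> 0 <= k -> 0 <= v -> 0 <= r <= / 128 -> -4 <= q ->
  dominated b k v r q -> dominated b' k v r q.
Proof.
  unfold dominated. intros Hb Hb0 Hk Hv Hr Hq H.
  assert (0 <= p5 v + 32 * q * r * p5 (v / 2) + err6 r v).
  { assert (P1 := p5_mono (v/2) v ltac:(lra)).
    assert (H6 := err6_mono r r v v ltac:(lra) ltac:(lra) ltac:(lra)).
    assert (0 <= (q + 4) * (r * p5 (v/2))) by (repeat apply Rmult_le_pos; lra).
    assert (r * p5 (v/2) <= / 128 * p5 v) by (apply Rmult_le_compat; lra). lra. }
  set (X := p5 v + 32 * q * r * p5 (v / 2) + err6 r v) in *.
  set (Y := p2 v + 4 * q * r * p2 (v / 2) - err3 r v) in *.
  assert (0 <= k * X) by (apply Rmult_le_pos; assumption).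
  assert (0 <= Y) by (apply Rnot_lt_le; intros C; nra).
  apply Rle_trans with (1 := H). apply Rmult_le_compat_r; assumption.
Qed.

Lemma kappa_bounds : 0 <= PI^3 / 60 <= kappa_max.
Proof.
  assert (H := PI_approx). unfold kappa_max.
  assert (PI^3 <= 3.141594^3) by (apply pow_incr; lra).
  assert (0 <= PI^3) by (apply pow_le; lra). lra.
Qed.

Lemma exp_neg_2PI_upper (t : R) : 6.28318 <= t -> exp (- t) <= 0.0018675.
Proof.
  intros Ht.
  apply (exp_neg_upper16 0.392698 0.675233 0.45593961 0.20788093 0.043214482); lra.
Qed.

Lemma dominated_upper (t q : R) : 2 * PI <= t -> -4 <= q <= 4 ->
  dominated 3 (PI^3/60) (/ t) (exp (- t)) q.
Proof.
  intros Ht Hq. assert (Hpi := PI_approx).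
  assert (Hv : 0 < / t <= / 6.28318).
  { split; [apply Rinv_0_lt_compat; lra|apply Rinv_le_contravar; lra]. }
  (* One piece covers all heights from 1 on: [va] = 0 stands for infinite height, and [vb] is just
     above 1/(2 pi). *)
  apply dominated_pos_piece with (va := 0) (vb := 0.159156) (rh := 0.0018675) (qh := 4)
    (e6 := 0.01711) (e3 := 0.00152) (B := 36.36) (M := 0.2971);
    try lra; try apply kappa_bounds.
  - split; [apply Rlt_le, exp_pos|]. apply exp_neg_2PI_upper; lra.
  - unfold err6, p5. lra.
  - unfold err3, p2. lra.
  - unfold second_gap, p5, p2, kappa_max. lra.
  - unfold main_gap, p5, p2, kappa_max. lra.
  - unfold main_gap, p5, p2, kappa_max. lra.
  - unfold kappa_max. lra.
Qed.

(** * The inequality on the arc, piece by piece *)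

Definition cos_poly (z : R) : R := 1 - z*z/2 * (1 - z*z/12 * (1 - z*z/30 * (1 - z*z/56))).

Lemma cos_upper8 (z : R) : 0 <= z <= 2 -> cos z <= cos_poly z.
Proof.
  intros H. destruct (pre_cos_bound z 1) as [_ U]; try lra.
  eapply Rle_trans; [exact U|]. right.
  unfold cos_poly, cos_approx, cos_term. cbn [sum_f_R0 Nat.mul Nat.add].
  replace (INR (fact 0)) with 1 by (rewrite INR_IZR_INZ; reflexivity).
  replace (INR (fact 2)) with 2 by (rewrite INR_IZR_INZ; reflexivity).
  replace (INR (fact 4)) with 24 by (rewrite INR_IZR_INZ; reflexivity).
  replace (INR (fact 6)) with 720 by (rewrite INR_IZR_INZ; reflexivity).
  replace (INR (fact 8)) with 40320.
  - field.
  - change (fact 8) with (8 * (7 * fact 6))%nat. rewrite !mult_INR.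
    replace (INR (fact 6)) with 720 by (rewrite INR_IZR_INZ; reflexivity). simpl; lra.
Qed.

(** On the arc a bound on y gives x >= sqrt(1 - yh^2). Passing to the half angle keeps PI x in
    [0, PI/2], where cos is nonnegative and decreasing and the Taylor polynomial is accurate. *)
Lemma arc_phase_upper (z c y yh x : R) :
  0 <= z -> z * z <= 3.1415 * 3.1415 * (1 - yh * yh) -> cos_poly z <= c ->
  0 <= y <= yh -> 0 <= x <= 1/2 -> x^2 + y^2 = 1 ->
  cos (2 * PI * x) <= 2 * c * c - 1.
Proof.
  intros Hz Hzy Hc Hy Hx Hxy. assert (Hpi := PI_approx).
  assert (Hzx : z <= PI * x).
  { apply Rle_trans with (3.1415 * x); [|apply Rmult_le_compat_r; lra].
    apply Rnot_lt_le. intros C. assert (y^2 <= yh^2) by (apply pow_incr; lra). nra. }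
  replace (2 * PI * x) with (2 * (PI * x)) by ring. rewrite cos_2a_cos.
  assert (0 <= cos (PI * x)) by (apply cos_ge_0; nra).
  assert (cos (PI * x) <= cos z).
  { destruct (Req_dec (PI * x) z) as [->|Hne]; [lra|]. apply Rlt_le, cos_decreasing_1; nra. }
  assert (cos z <= cos_poly z) by (apply cos_upper8; nra).
  assert (cos (PI * x) * cos (PI * x) <= c * c) by (apply Rmult_le_compat; lra).
  lra.
Qed.

Lemma inv_2PI_bounds (y yl yh va vb : R) : 0 < yl <= y -> y <= yh ->
  va * (6.28319 * yh) <= 1 -> 1 <= vb * (6.28318 * yl) ->
  va <= / (2 * PI * y) <= vb.
Proof.
  intros Hl Hh Ha Hb. assert (Hpi := PI_approx).
  assert (H1 : 0 < 6.28318 * yl <= 2 * PI * y) by nra.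
  assert (H2 : 2 * PI * y <= 6.28319 * yh) by nra.
  split.
  - apply Rle_trans with (/ (6.28319 * yh)); [|apply Rinv_le_contravar; lra].
    apply (Rmult_le_reg_r (6.28319 * yh)); [lra|]. rewrite Rinv_l by lra. assumption.
  - apply Rle_trans with (/ (6.28318 * yl)); [apply Rinv_le_contravar; lra|].
    apply (Rmult_le_reg_r (6.28318 * yl)); [lra|]. rewrite Rinv_l by lra. assumption.
Qed.

(* The three hypotheses on M are the inequality on all of [yl,yh], since main_gap is concave in 1/y
   and the error terms are monotone; z is a lower bound for PI x on the piece. *)
Lemma dominated_arc_pos (yl yh va vb z c rh qh e6 e3 B M x y q : R) :
  0 < yl <= y -> y <= yh -> 0 <= x <= 1/2 -> x^2 + y^2 = 1 -> -4 <= q <= 4 * cos (2 * PI * x) ->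
  0 <= va -> va * (6.28319 * yh) <= 1 -> 1 <= vb * (6.28318 * yl) ->
  0 <= z -> z * z <= 3.1415 * 3.1415 * (1 - yh * yh) -> cos_poly z <= c ->
  4 * (2 * c * c - 1) <= qh -> 0 <= qh -> rh <= / 128 ->
  exp (- (6.28318 * yl)) <= rh -> err6 rh vb <= e6 -> err3 rh vb <= e3 ->
  second_gap 3.062 kappa_max vb <= B ->
  M <= main_gap 3.062 kappa_max va -> M <= main_gap 3.062 kappa_max vb ->
  kappa_max * e6 + 3.062 * e3 + qh * rh * B <= M ->
  dominated 3.062 (PI^3/60) (/ (2 * PI * y)) (exp (- (2 * PI * y))) q.
Proof.
  intros Hl Hh Hx Hxy Hq Hva Ha Hb Hz Hzy Hc Hqh Hqh0 Hrh Hexp He6 He3 HB M1 M2 HM.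
  assert (Hpi := PI_approx).
  assert (V := inv_2PI_bounds y yl yh va vb Hl Hh Ha Hb).
  assert (Hph := arc_phase_upper z c y yh x Hz Hzy Hc ltac:(lra) Hx Hxy).
  apply dominated_pos_piece with va vb rh qh e6 e3 B M;
    try assumption; try lra; try apply kappa_bounds.
  split; [apply Rlt_le, exp_pos|]. apply Rle_trans with (2 := Hexp), exp_neg_antitone. nra.
Qed.

Lemma dominated_arc_neg (yl yh va vb z c rl rh qh e6 e3 B M x y q : R) :
  0 < yl <= y -> y <= yh -> 0 <= x <= 1/2 -> x^2 + y^2 = 1 -> -4 <= q <= 4 * cos (2 * PI * x) ->
  0 <= va -> va * (6.28319 * yh) <= 1 -> 1 <= vb * (6.28318 * yl) ->
  0 <= z -> z * z <= 3.1415 * 3.1415 * (1 - yh * yh) -> cos_poly z <= c ->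
  4 * (2 * c * c - 1) <= qh -> qh <= 0 -> rh <= / 128 -> 0 <= rl ->
  exp (- (6.28318 * yl)) <= rh -> rl <= exp (- (6.28319 * yh)) ->
  err6 rh vb <= e6 -> err3 rh vb <= e3 -> 0 <= B <= second_gap 3.062 kappa_max va ->
  M <= main_gap 3.062 kappa_max va -> M <= main_gap 3.062 kappa_max vb ->
  kappa_max * e6 + 3.062 * e3 + qh * rl * B <= M ->
  dominated 3.062 (PI^3/60) (/ (2 * PI * y)) (exp (- (2 * PI * y))) q.
Proof.
  intros Hl Hh Hx Hxy Hq Hva Ha Hb Hz Hzy Hc Hqh Hqh0 Hrh Hrl Hexp Hexp' He6 He3 HB M1 M2 HM.
  assert (Hpi := PI_approx).
  assert (V := inv_2PI_bounds y yl yh va vb Hl Hh Ha Hb).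
  assert (Hph := arc_phase_upper z c y yh x Hz Hzy Hc ltac:(lra) Hx Hxy).
  assert (R1 : exp (- (2 * PI * y)) <= rh).
  { apply Rle_trans with (2 := Hexp), exp_neg_antitone. nra. }
  assert (R2 : rl <= exp (- (2 * PI * y))).
  { apply Rle_trans with (1 := Hexp'), exp_neg_antitone. nra. }
  apply dominated_neg_piece with va vb rl rh qh e6 e3 B M;
    try assumption; try lra; try apply kappa_bounds.
Qed.

Lemma dominated_arc (x y q : R) :
  0.877 <= y <= 1 -> 0 <= x <= 1/2 -> x^2 + y^2 = 1 -> -4 <= q <= 4 * cos (2 * PI * x) ->
  dominated 3.062 (PI^3/60) (/ (2 * PI * y)) (exp (- (2 * PI * y))) q.
Proof.
  intros Hy Hx Hxy Hq.
  (* Up to 0.959 the bound [M] is negative: mode (1,1) alone may have the wrong sign, and mode (1,2)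
     compensates since q is negative. The margin at 0.877 is small, so the first piece is the
     shortest. *)
  destruct (Rle_dec y 0.882).
  { assert (U : exp (- (6.28318 * 0.877)) <= 0.0040448)
      by (apply (exp_neg_upper16 0.344396 0.7086484 0.50218256 0.25218733 0.06359845); lra).
    assert (L : 0.0039193 <= exp (- (6.28319 * 0.882)))
      by (apply (exp_neg_lower16 0.346361 0.7072548 0.50020935 0.25020939 0.062604738); lra).
    apply (dominated_arc_neg 0.877 0.882) with (x := x) (va := 0.18044) (vb := 0.18148)
      (z := 1.48) (c := 0.0907) (qh := -3.934) (rl := 0.0039193) (rh := 0.0040448)
      (e6 := 0.0896) (e3 := 0.00428) (B := 43.41) (M := -0.6023);
      first [assumption |
        unfold cos_poly, main_gap, second_gap, err6, err3, p5, p2, kappa_max; lra]. }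
  destruct (Rle_dec y 0.89).
  { assert (U : exp (- (6.28318 * 0.882)) <= 0.0039197)
      by (apply (exp_neg_upper16 0.34636 0.707258 0.50021388 0.25021393 0.062607011); lra).
    assert (L : 0.0037271 <= exp (- (6.28319 * 0.89)))
      by (apply (exp_neg_lower16 0.349503 0.7050359 0.49707562 0.24708417 0.061050587); lra).
    apply (dominated_arc_neg 0.882 0.89) with (x := x) (va := 0.17882) (vb := 0.18045)
      (z := 1.432) (c := 0.1384) (qh := -3.846) (rl := 0.0037271) (rh := 0.0039197)
      (e6 := 0.08368) (e3 := 0.00409) (B := 42.82) (M := -0.5504);
      first [assumption |
        unfold cos_poly, main_gap, second_gap, err6, err3, p5, p2, kappa_max; lra]. }
  destruct (Rle_dec y 0.902).
  { assert (U : exp (- (6.28318 * 0.89)) <= 0.0037276)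
      by (apply (exp_neg_upper16 0.349501 0.70504 0.49708141 0.24708993 0.061053434); lra).
    assert (L : 0.0034564 <= exp (- (6.28319 * 0.902)))
      by (apply (exp_neg_lower16 0.354215 0.7017214 0.49241292 0.24247048 0.058791933); lra).
    apply (dominated_arc_neg 0.89 0.902) with (x := x) (va := 0.17644) (vb := 0.17883)
      (z := 1.356) (c := 0.2132) (qh := -3.636) (rl := 0.0034564) (rh := 0.0037276)
      (e6 := 0.07504) (e3 := 0.00381) (B := 41.95) (M := -0.4699);
      first [assumption |
        unfold cos_poly, main_gap, second_gap, err6, err3, p5, p2, kappa_max; lra]. }
  destruct (Rle_dec y 0.918).
  { assert (U : exp (- (6.28318 * 0.902)) <= 0.0034568)
      by (apply (exp_neg_upper16 0.354214 0.701725 0.49241798 0.24247547 0.058794354); lra).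
    assert (L : 0.0031258 <= exp (- (6.28319 * 0.918)))
      by (apply (exp_neg_lower16 0.360499 0.6973253 0.48626257 0.23645128 0.055909207); lra).
    apply (dominated_arc_neg 0.902 0.918) with (x := x) (va := 0.17337) (vb := 0.17645)
      (z := 1.245) (c := 0.3201) (qh := -3.18) (rl := 0.0031258) (rh := 0.0034568)
      (e6 := 0.06373) (e3 := 0.00343) (B := 40.86) (M := -0.3545);
      first [assumption |
        unfold cos_poly, main_gap, second_gap, err6, err3, p5, p2, kappa_max; lra]. }
  destruct (Rle_dec y 0.938).
  { assert (U : exp (- (6.28318 * 0.918)) <= 0.0031262)
      by (apply (exp_neg_upper16 0.360497 0.6973299 0.48626899 0.23645754 0.055912169); lra).
    assert (L : 0.0027566 <= exp (- (6.28319 * 0.938)))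
      by (apply (exp_neg_lower16 0.368353 0.6918696 0.47868354 0.22913793 0.05250419); lra).
    apply (dominated_arc_neg 0.918 0.938) with (x := x) (va := 0.16967) (vb := 0.17338)
      (z := 1.088) (c := 0.4643) (qh := -2.275) (rl := 0.0027566) (rh := 0.0031262)
      (e6 := 0.05131) (e3 := 0.00298) (B := 39.56) (M := -0.2102);
      first [assumption |
        unfold cos_poly, main_gap, second_gap, err6, err3, p5, p2, kappa_max; lra]. }
  destruct (Rle_dec y 0.959).
  { assert (U : exp (- (6.28318 * 0.938)) <= 0.0027571)
      by (apply (exp_neg_upper16 0.368351 0.6918745 0.47869033 0.22914444 0.052507175); lra).
    assert (L : 0.0024159 <= exp (- (6.28319 * 0.959)))
      by (apply (exp_neg_lower16 0.376599 0.6861874 0.47085314 0.22170267 0.049152073); lra).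
    apply (dominated_arc_neg 0.938 0.959) with (x := x) (va := 0.16595) (vb := 0.16968)
      (z := 0.89) (c := 0.6295) (qh := -0.829) (rl := 0.0024159) (rh := 0.0027571)
      (e6 := 0.03918) (e3 := 0.00252) (B := 38.29) (M := -0.0431);
      first [assumption |
        unfold cos_poly, main_gap, second_gap, err6, err3, p5, p2, kappa_max; lra]. }
  (* cos(2 pi x) changes sign on the arc at x = 1/4, y = 0.968..., inside this piece; from here on
     the bound on q is positive. *)
  destruct (Rle_dec y 0.977).
  { assert (U : exp (- (6.28318 * 0.959)) <= 0.0024162)
      by (apply (exp_neg_upper16 0.376598 0.6861921 0.4708596 0.22170877 0.049154779); lra).
    apply (dominated_arc_pos 0.959 0.977) with (x := x) (va := 0.1629) (vb := 0.16596)
      (z := 0.669) (c := 0.7845) (qh := 0.924) (rh := 0.0024162)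
      (e6 := 0.02955) (e3 := 0.00211) (B := 38.3) (M := 0.1176);
      first [assumption |
        unfold cos_poly, main_gap, second_gap, err6, err3, p5, p2, kappa_max; lra]. }
  destruct (Rle_dec y 0.991).
  { assert (U : exp (- (6.28318 * 0.977)) <= 0.0021579)
      by (apply (exp_neg_upper16 0.383666 0.6813592 0.46425036 0.2155284 0.046452492); lra).
    apply (dominated_arc_pos 0.977 0.991) with (x := x) (va := 0.1606) (vb := 0.16291)
      (z := 0.42) (c := 0.9131) (qh := 2.671) (rh := 0.0021579)
      (e6 := 0.02324) (e3 := 0.00182) (B := 37.28) (M := 0.2441);
      first [assumption |
        unfold cos_poly, main_gap, second_gap, err6, err3, p5, p2, kappa_max; lra]. }
  { assert (U : exp (- (6.28318 * 0.991)) <= 0.0019762)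
      by (apply (exp_neg_upper16 0.389164 0.6776234 0.45917348 0.21084029 0.044453628); lra).
    apply (dominated_arc_pos 0.991 1) with (x := x) (va := 0.15915) (vb := 0.16061)
      (z := 0) (c := 1) (qh := 4) (rh := 0.0019762)
      (e6 := 0.01928) (e3 := 0.00163) (B := 36.52) (M := 0.3364);
      first [assumption |
        unfold cos_poly, main_gap, second_gap, err6, err3, p5, p2, kappa_max; lra]. }
Qed.

(** * Comparison along horizontal lines *)
Lemma sin_multiple_abs (j : nat) (x : R) : Rabs (sin (INR j * x)) <= INR j * Rabs (sin x).
Proof.
  induction j as [|j IH].
  - simpl. rewrite !Rmult_0_l, sin_0, Rabs_R0. lra.
  - rewrite S_INR. replace ((INR j + 1) * x) with (INR j * x + x) by ring.
    rewrite sin_plus. eapply Rle_trans; [apply Rabs_triang|]. rewrite !Rabs_mult.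
    assert (Rabs (cos x) <= 1) by apply Rabs_le, COS_bound.
    assert (Rabs (cos (INR j * x)) <= 1) by apply Rabs_le, COS_bound.
    generalize (Rabs_pos (sin (INR j * x))), (Rabs_pos (sin x)). intros.
    assert (Rabs (sin (INR j * x)) * Rabs (cos x) <= Rabs (sin (INR j * x)) * 1)
      by (apply Rmult_le_compat_l; lra).
    assert (Rabs (cos (INR j * x)) * Rabs (sin x) <= 1 * Rabs (sin x))
      by (apply Rmult_le_compat_r; lra). lra.
Qed.

(** A difference of cosines is -2 times the product of the sines of the half difference and the half
    sum; each sine grows by at most the factor j. *)
Lemma cos_multiple_diff (j : nat) (a b : R) :
  Rabs (cos (INR j * a) - cos (INR j * b)) <= (INR j)^2 * Rabs (cos a - cos b).
Proof.
  rewrite !form2.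
  replace ((INR j * a - INR j * b) / 2) with (INR j * ((a - b) / 2)) by field.
  replace ((INR j * a + INR j * b) / 2) with (INR j * ((a + b) / 2)) by field.
  rewrite !Rabs_mult.
  assert (H1 := sin_multiple_abs j ((a - b)/2)). assert (H2 := sin_multiple_abs j ((a + b)/2)).
  set (u := Rabs (sin ((a - b) / 2))) in *. set (w := Rabs (sin ((a + b) / 2))) in *.
  assert (H3 : Rabs (sin (INR j * ((a - b) / 2))) * Rabs (sin (INR j * ((a + b) / 2))) <=
    (INR j * u) * (INR j * w)) by (apply Rmult_le_compat; auto using Rabs_pos).
  rewrite Rmult_assoc. replace (INR j ^ 2 * (Rabs (-2) * u * w)) with
    (Rabs (-2) * ((INR j * u) * (INR j * w))) by ring.
  apply Rmult_le_compat_l; [apply Rabs_pos|assumption].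
Qed.

Lemma phase_bound (x : R) (m k : nat) : (0 < m)%nat -> (0 < k)%nat ->
  Rabs (phase x m k) <= 1 * (INR k * INR m) ^ 2.
Proof.
  intros Hm Hk. assert (1 <= INR m) by (apply (le_INR 1); lia).
  assert (1 <= INR k) by (apply (le_INR 1); lia).
  apply Rle_trans with 1; [apply Rabs_le, COS_bound|]. assert (1 <= INR k * INR m) by nra. nra.
Qed.

Lemma phase_diff_bound (x x' : R) (m k : nat) :
  Rabs (phase x m k - phase x' m k) <=
  Rabs (cos (2 * PI * x) - cos (2 * PI * x')) * (INR k * INR m) ^ 2.
Proof. unfold phase. rewrite <- mult_INR, (Rmult_comm (Rabs (cos (2 * PI * x) - _))). apply cos_multiple_diff. Qed.

Lemma mode_sum_minus (a d : nat) (Q : R -> R) (t : R) (c c' : nat -> nat -> R) :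
  (forall i, ex_series (fun j => mode a d Q t (S i) (S j) * c (S i) (S j))) ->
  ex_series (fun i => Series (fun j => mode a d Q t (S i) (S j) * c (S i) (S j))) ->
  (forall i, ex_series (fun j => mode a d Q t (S i) (S j) * c' (S i) (S j))) ->
  ex_series (fun i => Series (fun j => mode a d Q t (S i) (S j) * c' (S i) (S j))) ->
  mode_sum a d Q t c - mode_sum a d Q t c' = mode_sum a d Q t (fun m k => c m k - c' m k).
Proof.
  intros H1 H2 H3 H4. unfold mode_sum. rewrite <- Series_minus by assumption.
  apply Series_ext. intros i. rewrite <- Series_minus by auto.
  apply Series_ext. intros j. ring.
Qed.

(** The factor q is 2 (c + c'), because cos 2u - cos 2u' = 2 (c + c')(c - c') with c = cos u, c' =
    cos u'. *)
Definition main_modes (a : nat) (Q : R -> R) (t q : R) : R :=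
  exp (- t) * Q t + 2 ^ a * exp (- t) ^ 2 * Q (2 * t) * q.

Lemma mode_1_1 (a d : nat) (Q : R -> R) (t : R) : mode a d Q t 1 1 = exp (- t) * Q t.
Proof. unfold mode. simpl INR. rewrite !Rmult_1_l, !pow1. field. Qed.

Lemma mode_1_2 (a d : nat) (Q : R -> R) (t : R) :
  mode a d Q t 1 2 = 2 ^ a * exp (- t) ^ 2 * Q (2 * t).
Proof.
  unfold mode. change (INR 1) with 1. rewrite pow1, Rmult_1_r, exp_neg_INR_mult.
  change (INR 2) with 2. field.
Qed.

(** Estimating the difference of the phases mode by mode, rather than the two sums separately, keeps
    the factor cos - cos' in the error, so it can be cancelled however close the two points are. *)
Lemma mode_sum_diff (a d : nat) (Q : R -> R) (t x x' : R) :
  (a <= 5)%nat -> (2 <= d)%nat ->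
  (forall s, 0 < s -> 0 <= Q s) -> (forall s s', 0 < s <= s' -> Q s' <= Q s) ->
  0 < t -> exp (- t) <= / 128 -> cos (2 * PI * x') <= cos (2 * PI * x) ->
  Rabs (mode_sum a d Q t (phase x) - mode_sum a d Q t (phase x') -
    (cos (2 * PI * x) - cos (2 * PI * x')) *
      main_modes a Q t (2 * (cos (2 * PI * x) + cos (2 * PI * x')))) <=
  (cos (2 * PI * x) - cos (2 * PI * x')) * tail_bound a d Q t.
Proof.
  intros Ha Hd HQ0 HQ Ht Hr Hc.
  destruct (mode_sum_two_terms a d Q t (phase x) 1) as [E1 [E2 _]];
    auto using phase_bound.
  destruct (mode_sum_two_terms a d Q t (phase x') 1) as [E1' [E2' _]];
    auto using phase_bound.
  rewrite mode_sum_minus by assumption.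
  destruct (mode_sum_two_terms a d Q t (fun m k => phase x m k - phase x' m k)
    (cos (2 * PI * x) - cos (2 * PI * x'))) as [_ [_ L]]; auto.
  { intros m k _ _. rewrite <- (Rabs_right (cos (2 * PI * x) - cos (2 * PI * x'))) by lra.
    apply phase_diff_bound. }
  assert (P11 : forall z, phase z 1 1 = cos (2 * PI * z)).
  { intros z. unfold phase. simpl INR. f_equal. ring. }
  assert (P12 : forall z, phase z 1 2 = 2 * cos (2 * PI * z) * cos (2 * PI * z) - 1).
  { intros z. unfold phase. rewrite <- cos_2a_cos. simpl INR. f_equal. ring. }
  cbv beta in L. rewrite mode_1_1, mode_1_2, !P11, !P12 in L. unfold main_modes.
  match type of L with Rabs ?z <= _ => match goal with |- Rabs ?w <= _ =>
    replace w with z by ring end end. exact L.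
Qed.

Lemma zeta3_value (x y : R) : 0 < y -> exp (- (2 * PI * y)) <= / 128 ->
  zeta 3 x y = 2 * zeta_nat 6 * y ^ 3 + 3 * PI / 4 / y ^ 2 * zeta_nat 5 +
     2 * PI ^ 3 * mode_sum 2 3 Q2 (2 * PI * y) (phase x).
Proof.
  intros Hy Hr. unfold zeta. rewrite (is_lim_seq_unique _ _ (zeta3_expansion x y Hy Hr)).
  reflexivity.
Qed.

Lemma zeta6_value (x y : R) : 0 < y -> exp (- (2 * PI * y)) <= / 128 ->
  zeta 6 x y = 2 * zeta_nat 12 * y ^ 6 + 63 * PI / 128 / y ^ 5 * zeta_nat 11 +
     PI ^ 6 / 30 * mode_sum 5 6 Q5 (2 * PI * y) (phase x).
Proof.
  intros Hy Hr. unfold zeta. rewrite (is_lim_seq_unique _ _ (zeta6_expansion x y Hy Hr)).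
  reflexivity.
Qed.

Lemma Q2_p2 (k t : R) : 0 < k -> 0 < t -> Q2 (k * t) = p2 (/ t / k).
Proof. intros; unfold Q2, p2. field. lra. Qed.

Lemma Q5_p5 (k t : R) : 0 < k -> 0 < t -> Q5 (k * t) = p5 (/ t / k).
Proof. intros; unfold Q5, p5. field. lra. Qed.

Lemma tail_bound_err3 (t : R) : 0 < t -> exp (- t) <= / 128 ->
  tail_bound 2 3 Q2 t = exp (- t) * err3 (exp (- t)) (/ t).
Proof.
  intros Ht Hr. unfold tail_bound, err3. rewrite !Q2_p2 by lra.
  replace (3 ^ (2 + 2)) with 81 by (simpl; ring). simpl (2 ^ (3 - 2)).
  field. lra.
Qed.

Lemma tail_bound_err6 (t : R) : 0 < t -> exp (- t) <= / 128 ->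
  tail_bound 5 6 Q5 t = exp (- t) * err6 (exp (- t)) (/ t).
Proof.
  intros Ht Hr. unfold tail_bound, err6. rewrite !Q5_p5 by lra.
  replace (3 ^ (5 + 2)) with 2187 by (simpl; ring). replace (2 ^ (6 - 2)) with 16 by (simpl; ring).
  field. lra.
Qed.

(** At equal heights the terms depending on y alone cancel. What remains is [dominated] multiplied
    by 2 PI^3 D r, with D the difference of the cosines. *)
Lemma Eb_le_of_dominated (b x x' y : R) : 0 < b -> 0 < y -> exp (- (2 * PI * y)) <= / 128 ->
  cos (2 * PI * x') <= cos (2 * PI * x) ->
  dominated b (PI^3/60) (/ (2 * PI * y)) (exp (- (2 * PI * y)))
    (2 * (cos (2 * PI * x) + cos (2 * PI * x'))) ->
  Eb b x y <= Eb b x' y.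
Proof.
  intros Hb Hy Hr Hc Hdom. assert (Hpi := PI_RGT_0).
  set (t := 2 * PI * y) in *. assert (Ht : 0 < t) by (unfold t; nra).
  assert (D3 := mode_sum_diff 2 3 Q2 t x x' ltac:(lia) ltac:(lia) Q2_nonneg Q2_decr Ht Hr Hc).
  assert (D6 := mode_sum_diff 5 6 Q5 t x x' ltac:(lia) ltac:(lia) Q5_nonneg Q5_decr Ht Hr Hc).
  unfold Eb. rewrite !zeta3_value, !zeta6_value by assumption. fold t.
  set (S3 := mode_sum 2 3 Q2 t (phase x)) in *. set (S3' := mode_sum 2 3 Q2 t (phase x')) in *.
  set (S6 := mode_sum 5 6 Q5 t (phase x)) in *. set (S6' := mode_sum 5 6 Q5 t (phase x')) in *.
  set (q := 2 * (cos (2 * PI * x) + cos (2 * PI * x'))) in *.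
  set (D := cos (2 * PI * x) - cos (2 * PI * x')) in *.
  assert (HD : 0 <= D) by (unfold D; lra).
  rewrite tail_bound_err3 in D3 by assumption. rewrite tail_bound_err6 in D6 by assumption.
  unfold main_modes in D3, D6. rewrite Q2_p2 in D3 by lra. rewrite Q5_p5 in D6 by lra.
  replace (Q2 t) with (p2 (/ t)) in D3 by reflexivity.
  replace (Q5 t) with (p5 (/ t)) in D6 by reflexivity.
  set (r := exp (- t)) in *. assert (Hr0 : 0 < r) by apply exp_pos.
  apply Rabs_le_between in D3. apply Rabs_le_between in D6.
  unfold dominated in Hdom.
  set (P5 := p5 (/ t)) in *. set (P5' := p5 (/ t / 2)) in *. set (E6 := err6 r (/ t)) in *.
  set (P2 := p2 (/ t)) in *. set (P2' := p2 (/ t / 2)) in *. set (E3 := err3 r (/ t)) in *.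
  (* The error is added for zeta(6) and subtracted for zeta(3), since the latter enters with the
     factor -b. *)
  assert (H6 : S6 - S6' <= D * r * (P5 + 32 * q * r * P5' + E6)) by lra.
  assert (H3 : D * r * (P2 + 4 * q * r * P2' - E3) <= S3 - S3') by lra.
  assert (Hp : 0 <= 2 * PI^3) by (assert (0 < PI^3) by (apply pow_lt; lra); lra).
  assert (K : PI^6/30 * (S6 - S6') <= b * (2 * PI^3) * (S3 - S3')).
  { apply Rle_trans with (PI^6/30 * (D * r * (P5 + 32 * q * r * P5' + E6))).
    { apply Rmult_le_compat_l; [|assumption]. assert (0 < PI^6) by (apply pow_lt; lra). lra. }
    apply Rle_trans with (b * (2 * PI^3) * (D * r * (P2 + 4 * q * r * P2' - E3))).
    2:{ apply Rmult_le_compat_l; [apply Rmult_le_pos; lra|assumption]. }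
    apply Rmult_le_compat_l with (r := 2 * PI^3 * (D * r)) in Hdom.
    2:{ apply Rmult_le_pos; [assumption|apply Rmult_le_pos; lra]. }
    lra. }
  lra.
Qed.

Lemma exp_neg_2PI_small (y : R) : 0.8 <= y -> exp (- (2 * PI * y)) <= / 128.
Proof.
  intros Hy. assert (Hpi := PI_approx).
  apply Rle_trans with (exp (- (5))); [apply exp_neg_antitone; nra|].
  apply (exp_neg_upper16 0.3125 0.731616 0.535263 0.286507 0.082087); lra.
Qed.

Lemma Eb_min_at_0 (b x y : R) : 3 <= b -> 1 <= y -> Eb b 0 y <= Eb b x y.
Proof.
  intros Hb Hy. assert (Hpi := PI_approx).
  assert (Hr := exp_neg_2PI_small y ltac:(lra)).
  assert (C1 := COS_bound (2 * PI * x)).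
  assert (C0 : cos (2 * PI * 0) = 1) by (rewrite Rmult_0_r; apply cos_0).
  apply Eb_le_of_dominated; try lra.
  apply dominated_larger_b with 3; try lra.
  - apply kappa_bounds.
  - apply Rlt_le, Rinv_0_lt_compat. nra.
  - split; [apply Rlt_le, exp_pos|assumption].
  - apply dominated_upper; [nra|lra].
Qed.

(** To the right of the arc the cosine is smaller, so q <= 4 cos(2 pi x) is controlled by the point
    on the arc alone. *)
Lemma Eb_min_at_arc (b x x' y : R) : 3.062 <= b -> 0.877 <= y <= 1 ->
  0 <= x <= x' -> x' <= 1/2 -> x^2 + y^2 = 1 -> Eb b x y <= Eb b x' y.
Proof.
  intros Hb Hy Hx Hx' Hxy. assert (Hpi := PI_approx).
  assert (Hr := exp_neg_2PI_small y ltac:(lra)).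
  assert (Hc : cos (2 * PI * x') <= cos (2 * PI * x)).
  { destruct (Req_dec x x') as [->|]; [lra|]. apply Rlt_le, cos_decreasing_1; nra. }
  assert (C1 := COS_bound (2 * PI * x)). assert (C2 := COS_bound (2 * PI * x')).
  apply Eb_le_of_dominated; try lra.
  apply dominated_larger_b with 3.062; try lra.
  - apply kappa_bounds.
  - apply Rlt_le, Rinv_0_lt_compat. nra.
  - split; [apply Rlt_le, exp_pos|assumption].
  - apply dominated_arc with x; lra.
Qed.

(** * The neighbourhood of exp(i pi/3) *)
Lemma zeta_partial_mono (s x y : R) (N M : nat) : (N <= M)%nat ->
  zeta_partial s x y N <= zeta_partial s x y M.
Proof.
  intros H. change (zeta_partial s x y) with
    (fun N => zsum (fun m => zsum (fun n => zeta_term s x y m n) N) N). cbv beta.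
  apply Rle_trans with (zsum (fun m => zsum (fun n => zeta_term s x y m n) M) N).
  - apply zsum_le. intros m. apply zsum_mono; [|assumption]. intros; apply zeta_term_nonneg.
  - apply zsum_mono; [|assumption]. intros m. apply zsum_nonneg. intros; apply zeta_term_nonneg.
Qed.

Lemma zeta_partial_le_lim (s x y l : R) (N : nat) :
  is_lim_seq (zeta_partial s x y) l -> zeta_partial s x y N <= zeta s x y.
Proof.
  intros H. unfold zeta. rewrite (is_lim_seq_unique _ _ H). simpl.
  apply (is_lim_seq_incr_compare _ _ H). intros n. apply zeta_partial_mono; lia.
Qed.

(** Keeps only the pairs +-(0,1), +-(1,0), +-(1,-1) of the smallest square. Near exp(i pi/3) these
    are the six shortest lattice vectors and carry almost all of zeta(6). *)
Lemma zeta6_hexagonal_terms (x y : R) : 0.8 <= y ->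
  2 * y^6 * (1 + / (x^2 + y^2)^6 + / ((1 - x)^2 + y^2)^6) <= zeta 6 x y.
Proof.
  intros Hy. eapply Rle_trans; [|eapply (zeta_partial_le_lim 6 x y _ 1)].
  2:{ apply zeta6_expansion; [lra|apply exp_neg_2PI_small; assumption]. }
  replace (zeta_partial 6 x y 1) with (zeta_partial (INR 6) x y 1)
    by (f_equal; rewrite INR_IZR_INZ; reflexivity).
  unfold zeta_partial.
  change (2 * 1)%nat with 2%nat. cbn [sum_f_R0]. cbn [Z.of_nat Pos.of_succ_nat Pos.succ].
  cbn [Z.sub Z.add Z.opp Z.pos_sub]. change (Z.pos (PosDef.Pos.pred_double 1)) with 1%Z.
  assert (N1 := zeta_term_nonneg (INR 6) x y (-1) (-1)).
  assert (N2 := zeta_term_nonneg (INR 6) x y 1 1).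
  assert (0 < y^2) by (apply pow_lt; lra).
  assert (A : 0 < x^2 + y^2) by (generalize (pow2_ge_0 x); lra).
  assert (B : 0 < (1 - x)^2 + y^2) by (generalize (pow2_ge_0 (1 - x)); lra).
  assert (T : forall m n, (Z.eqb m 0 && Z.eqb n 0)%bool = false ->
    zeta_term (INR 6) x y m n = y^6 / epstein_form x y m n ^ 6).
  { intros m n E. rewrite zeta_term_pow by lra. rewrite E. reflexivity. }
  rewrite (T (-1)%Z 0%Z), (T (-1)%Z 1%Z), (T 0%Z (-1)%Z), (T 0%Z 1%Z), (T 1%Z (-1)%Z), (T 1%Z 0%Z) by reflexivity.
  assert (N0 := zeta_term_nonneg (INR 6) x y 0 0).
  unfold epstein_form.
  replace ((-1 * x + 0)^2 + (-1 * y)^2) with (x^2 + y^2) by ring.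
  replace ((1 * x + 0)^2 + (1 * y)^2) with (x^2 + y^2) by ring.
  replace ((-1 * x + 1)^2 + (-1 * y)^2) with ((1 - x)^2 + y^2) by ring.
  replace ((1 * x + -1)^2 + (1 * y)^2) with ((1 - x)^2 + y^2) by ring.
  replace ((0 * x + -1)^2 + (0 * y)^2) with 1 by ring.
  replace ((0 * x + 1)^2 + (0 * y)^2) with 1 by ring.
  rewrite pow1. unfold Rdiv. rewrite Rinv_1. lra.
Qed.

Lemma zeta6_near_rho (x y : R) : 0.865 <= y <= 0.877 -> 0.48 <= x <= 0.52 -> 2.525 <= zeta 6 x y.
Proof.
  intros Hy Hx. eapply Rle_trans; [|apply zeta6_hexagonal_terms; lra].
  set (A := x^2 + y^2). set (B := (1 - x)^2 + y^2). set (w := y^2).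
  assert (Hw : 0.748 <= w <= 0.7692) by (unfold w; nra).
  assert (HA : 0 < A) by (unfold A; fold w; generalize (pow2_ge_0 x); lra).
  assert (HB : 0 < B) by (unfold B; fold w; generalize (pow2_ge_0 (1 - x)); lra).
  assert (HAB : A * B <= (w + 0.2504)^2).
  { replace (A * B) with ((w + 1/4 + (x - 1/2)^2)^2 - (x - 1/2)^2) by (unfold A, B, w; field).
    assert (Hu : -0.02 <= x - 1/2 <= 0.02) by lra. set (u := x - 1/2) in *.
    assert (0 <= u^2 <= 0.0004) by nra.
    assert ((w + 1/4 + u^2)^2 <= (w + 0.2504)^2) by (apply pow_incr; lra). lra. }
  set (g := / (A * B)).
  assert (Hg : / (w + 0.2504)^2 <= g) by (apply Rinv_le_contravar; [nra|assumption]).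
  assert (Hg0 : 0 < / (w + 0.2504)^2) by (apply Rinv_0_lt_compat; nra).
  (* arithmetic-geometric mean inequality for the three pairs of shortest vectors *)
  assert (G1 : 3 * g^2 <= 1 + / A^6 + / B^6).
  { assert (2 * g^3 <= / A^6 + / B^6).
    { unfold g. rewrite !Rinv_mult, <- !pow_inv.
      assert (0 <= ((/A)^3 - (/B)^3)^2) by apply pow2_ge_0. nra. }
    assert (0 <= (g - 1)^2 * (2 * g + 1)).
    { apply Rmult_le_pos; [apply pow2_ge_0|lra]. }
    nra. }
  assert (G2 : (/ (w + 0.2504)^2)^2 <= g^2) by (apply pow_incr; lra).
  replace (y^6) with (w^3) by (unfold w; ring).
  assert (W3 : 0 < w^3) by (apply pow_lt; lra).
  apply Rle_trans with (2 * w^3 * (3 * (/ (w + 0.2504)^2)^2)).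
  2:{ apply Rmult_le_compat_l; lra. }
  (* At exp(i pi/3) one has w = y^2 = 3/4, so the inequality is expanded in powers of the small
     quantity w - 3/4. *)
  assert (P : 2.525 * (w + 0.2504)^4 <= 6 * w^3).
  { set (e := w - 0.75). replace w with (0.75 + e) by (unfold e; ring).
    assert (He : -0.002 <= e <= 0.0192) by (unfold e; lra).
    assert (E2 : 0 <= e^2 <= 0.0004) by nra.
    assert (E3 : -0.00001 <= e^3 <= 0.00001) by (replace (e^3) with (e * e^2) by ring; nra).
    assert (E4 : 0 <= e^4 <= 0.00001) by (replace (e^4) with (e^2 * e^2) by ring; nra).
    nra. }
  rewrite <- pow_inv, <- pow_mult. change (2 * 2)%nat with 4%nat. rewrite pow_inv.
  assert (W4 : 0 < (w + 0.2504)^4) by (apply pow_lt; lra).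
  apply (Rmult_le_reg_r ((w + 0.2504)^4)); [assumption|].
  replace (2 * w^3 * (3 * / (w + 0.2504)^4) * (w + 0.2504)^4) with (6 * w^3) by (field; lra).
  assumption.
Qed.

Lemma mode_sum_upper (a d : nat) (Q : R -> R) (t x : R) :
  (a <= 5)%nat -> (2 <= d)%nat ->
  (forall s, 0 < s -> 0 <= Q s) -> (forall s s', 0 < s <= s' -> Q s' <= Q s) ->
  0 < t -> exp (- t) <= / 128 ->
  Rabs (mode_sum a d Q t (phase x) -
     (exp (- t) * Q t * cos (2 * PI * x) +
      2 ^ a * exp (- t) ^ 2 * Q (2 * t) * cos (2 * (2 * PI * x)))) <= tail_bound a d Q t.
Proof.
  intros Ha Hd HQ0 HQ Ht Hr.
  destruct (mode_sum_two_terms a d Q t (phase x) 1) as [_ [_ L]]; auto using phase_bound.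
  rewrite mode_1_1, mode_1_2, Rmult_1_l in L.
  replace (phase x 1 1) with (cos (2 * PI * x)) in L by (unfold phase; simpl INR; f_equal; ring).
  replace (phase x 1 2) with (cos (2 * (2 * PI * x))) in L by (unfold phase; simpl INR; f_equal; ring).
  exact L.
Qed.

Lemma zeta_nat_5_bounds : 1.0366 <= zeta_nat 5 <= 1.0373.
Proof.
  destruct (zeta_nat_bounds 5 6 ltac:(lia)) as [L U]. cbn [sum_f_R0 Nat.sub] in L, U.
  rewrite !INR_IZR_INZ in L, U. cbn [Z.of_nat Pos.of_succ_nat Pos.succ] in L, U. lra.
Qed.

Lemma zeta_nat_6_bounds : 1.0173 <= zeta_nat 6 <= 1.0174.
Proof.
  destruct (zeta_nat_bounds 6 6 ltac:(lia)) as [L U]. cbn [sum_f_R0 Nat.sub] in L, U.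
  rewrite !INR_IZR_INZ in L, U. cbn [Z.of_nat Pos.of_succ_nat Pos.succ] in L, U. lra.
Qed.

Lemma zeta_nat_11_upper : zeta_nat 11 <= 1.0005.
Proof.
  destruct (zeta_nat_bounds 11 3 ltac:(lia)) as [_ U]. cbn [sum_f_R0 Nat.sub] in U.
  rewrite !INR_IZR_INZ in U. cbn [Z.of_nat Pos.of_succ_nat Pos.succ] in U. lra.
Qed.

Lemma zeta_nat_12_upper : zeta_nat 12 <= 1.00025.
Proof.
  destruct (zeta_nat_bounds 12 3 ltac:(lia)) as [_ U]. cbn [sum_f_R0 Nat.sub] in U.
  rewrite !INR_IZR_INZ in U. cbn [Z.of_nat Pos.of_succ_nat Pos.succ] in U. lra.
Qed.

Lemma PI_powers : 9.8695 <= PI^2 <= 9.8697 /\ 31.0062 <= PI^3 <= 31.0064 /\ PI^6 <= 961.4.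
Proof.
  assert (H := PI_approx).
  assert (H2 : 3.141592^2 <= PI^2 <= 3.141594^2) by (split; apply pow_incr; lra).
  assert (H3 : 3.141592^3 <= PI^3 <= 3.141594^3) by (split; apply pow_incr; lra).
  assert (H6 : PI^6 <= 3.141594^6) by (apply pow_incr; lra).
  repeat split; lra.
Qed.

Lemma zeta3_square_lower : 4.657 <= zeta 3 0 1.
Proof.
  assert (Hpi := PI_approx). destruct PI_powers as [B2 [B3 _]].
  assert (Hr := exp_neg_2PI_small 1 ltac:(lra)).
  rewrite zeta3_value by (try lra; assumption).
  assert (M := mode_sum_upper 2 3 Q2 (2 * PI * 1) 0 ltac:(lia) ltac:(lia) Q2_nonneg Q2_decr
    ltac:(lra) Hr).
  rewrite tail_bound_err3 in M by (try lra; assumption).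
  rewrite !Rmult_0_r, cos_0, !Rmult_1_r in M. rewrite Rmult_1_r in Hr. rewrite Rmult_1_r.
  rewrite (Q2_p2 2 (2 * PI)) in M by lra. change (Q2 (2 * PI)) with (p2 (/ (2 * PI))) in M.
  set (r := exp (- (2 * PI))) in *. set (v := / (2 * PI)) in *.
  assert (Hv : 0.15915 <= v <= 0.15916).
  { unfold v. split.
    - apply Rle_trans with (/ 6.28319); [lra|apply Rinv_le_contravar; lra].
    - apply Rle_trans with (/ 6.28318); [apply Rinv_le_contravar; lra|lra]. }
  assert (Rr : 0.0018671 <= r <= 0.0018675).
  { split.
    - apply (exp_neg_lower16 0.3927 0.6752264 0.45593069 0.20787279 0.043211096); lra.
    - apply exp_neg_2PI_upper; lra. }
  assert (P1 := p2_mono 0.15915 v ltac:(lra)). assert (P2 := p2_mono 0.079575 (v/2) ltac:(lra)).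
  assert (E3 := err3_mono r 0.0018675 v 0.15916 ltac:(lra) ltac:(lra) ltac:(lra)).
  assert (E3' : err3 0.0018675 0.15916 <= 0.0017) by (unfold err3, p2; lra).
  unfold p2 at 2 in P1. unfold p2 at 2 in P2.
  apply Rabs_le_between in M.
  assert (X1 : 0.0018671 * 1.553 <= r * p2 v) by (apply Rmult_le_compat; lra).
  assert (X2 : 0.0018671^2 * 1.257 <= r^2 * p2 (v/2)).
  { apply Rmult_le_compat; try lra. apply pow_incr; lra. }
  assert (X3 : r * err3 r v <= 0.0018675 * 0.0017) by (apply Rmult_le_compat; lra).
  simpl (2^2) in M.
  assert (XM : 0.0029 <= mode_sum 2 3 Q2 (2 * PI) (phase 0)) by lra.
  assert (XS : 0.0018671 * 1.553 + 4 * (0.0018671^2 * 1.257) - 0.0018675 * 0.0017 <=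
     mode_sum 2 3 Q2 (2 * PI) (phase 0)) by lra.
  assert (Z5 := zeta_nat_5_bounds). assert (Z6 := zeta_nat_6_bounds).
  set (S := mode_sum 2 3 Q2 (2 * PI) (phase 0)) in *.
  assert (Y1 : 31.0062 * (0.0018671 * 1.553 + 4 * (0.0018671^2 * 1.257) - 0.0018675 * 0.0017)
     <= PI^3 * S) by (apply Rmult_le_compat; lra).
  assert (Y2 : 3.141592 * 1.0366 <= PI * zeta_nat 5) by (apply Rmult_le_compat; lra).
  rewrite pow1. unfold Rdiv. rewrite pow1, Rinv_1. lra.
Qed.

Lemma zeta6_square_upper : zeta 6 0 1 <= 4.066.
Proof.
  assert (Hpi := PI_approx). destruct PI_powers as [_ [_ B6]].
  assert (Hr := exp_neg_2PI_small 1 ltac:(lra)).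
  rewrite zeta6_value by (try lra; assumption).
  assert (M := mode_sum_upper 5 6 Q5 (2 * PI * 1) 0 ltac:(lia) ltac:(lia) Q5_nonneg Q5_decr
    ltac:(lra) Hr).
  rewrite tail_bound_err6 in M by (try lra; assumption).
  rewrite !Rmult_0_r, cos_0, !Rmult_1_r in M. rewrite Rmult_1_r in Hr. rewrite Rmult_1_r.
  rewrite (Q5_p5 2 (2 * PI)) in M by lra. change (Q5 (2 * PI)) with (p5 (/ (2 * PI))) in M.
  set (r := exp (- (2 * PI))) in *. set (v := / (2 * PI)) in *.
  assert (Hv : 0 < v <= 0.159156).
  { unfold v. split; [apply Rinv_0_lt_compat; lra|].
    apply Rle_trans with (/ 6.28318); [apply Rinv_le_contravar; lra|lra]. }
  assert (Rr : 0 < r <= 0.0018675).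
  { split; [apply exp_pos|]. apply exp_neg_2PI_upper; lra. }
  assert (P1 := p5_mono v 0.159156 ltac:(lra)). assert (P2 := p5_mono (v/2) 0.079578 ltac:(lra)).
  assert (E6 := err6_mono r 0.0018675 v 0.159156 ltac:(lra) ltac:(lra) ltac:(lra)).
  assert (E6' : err6 0.0018675 0.159156 <= 0.018) by (unfold err6, p5; lra).
  unfold p5 at 3 in P1. unfold p5 at 3 in P2.
  apply Rabs_le_between in M.
  assert (X1 : r * p5 v <= 0.0018675 * 8.4438) by (apply Rmult_le_compat; lra).
  assert (X2 : r^2 * p5 (v/2) <= 0.0018675^2 * 3.112).
  { apply Rmult_le_compat; try lra; [apply pow_le; lra|apply pow_incr; lra]. }
  assert (X3 : r * err6 r v <= 0.0018675 * 0.018) by (apply Rmult_le_compat; lra).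
  replace (2^5) with 32 in M by ring.
  assert (X1' : 0 <= r * p5 v) by (apply Rmult_le_pos; lra).
  assert (X2' : 0 <= r^2 * p5 (v/2)) by (apply Rmult_le_pos; [apply pow_le|]; lra).
  assert (Z11 := zeta_nat_11_upper). assert (Z12 := zeta_nat_12_upper).
  set (S := mode_sum 5 6 Q5 (2 * PI) (phase 0)) in *.
  assert (HS : S <= 0.0018675 * 8.4438 + 32 * (0.0018675^2 * 3.112) + 0.0018675 * 0.018) by lra.
  assert (0 < PI^6) by (apply pow_lt; lra).
  assert (Y1 : PI^6 * S <= 961.4 * (0.0018675 * 8.4438 + 32 * (0.0018675^2 * 3.112) + 0.0018675 * 0.018)).
  { apply Rle_trans with (PI^6 * (0.0018675 * 8.4438 + 32 * (0.0018675^2 * 3.112) + 0.0018675 * 0.018)).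
    - apply Rmult_le_compat_l; lra.
    - apply Rmult_le_compat_r; lra. }
  assert (Y2 : PI * zeta_nat 11 <= 3.141594 * 1.0005).
  { apply Rle_trans with (PI * 1.0005); [apply Rmult_le_compat_l; lra|lra]. }
  rewrite pow1. unfold Rdiv. rewrite pow1, Rinv_1. lra.
Qed.

(** Near x = 1/2 the mode (1,1) is negative and must not be dropped. An upper bound for zeta(3)
    therefore needs a lower bound for exp(-2 pi y), and after multiplication by y^2 the claim
    becomes polynomial in y. *)
Lemma zeta3_near_rho (x y : R) : 0.865 <= y <= 0.877 -> 0.48 <= x <= 0.52 -> zeta 3 x y <= 4.151.
Proof.
  intros Hy Hx. assert (Hpi := PI_approx). destruct PI_powers as [B2 [B3 _]].
  assert (Hr := exp_neg_2PI_small y ltac:(lra)).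
  rewrite zeta3_value by (try lra; assumption).
  assert (Ht : 5.4345 <= 2 * PI * y) by nra.
  assert (M := mode_sum_upper 2 3 Q2 (2 * PI * y) x ltac:(lia) ltac:(lia) Q2_nonneg Q2_decr
    ltac:(lra) Hr).
  rewrite tail_bound_err3 in M by (try lra; assumption).
  (* The angle differs from PI by at most 2 pi * 0.02 < 0.12567, and 1 - 0.12567^2/2 > 0.9921. *)
  assert (Hc1 : cos (2 * PI * x) <= - 0.9921).
  { replace (2 * PI * x) with (2 * PI * (x - 1/2) + PI) by field.
    rewrite neg_cos. set (z := 2 * PI * (x - 1/2)).
    assert (Hz : -0.12567 <= z <= 0.12567) by (unfold z; nra).
    destruct (one_minus_cos_bounds z ltac:(lra)) as [_ [_ Hb]]. nra. }
  assert (Hc2 := COS_bound (2 * (2 * PI * x))).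
  rewrite (Q2_p2 2 (2 * PI * y)) in M by lra.
  change (Q2 (2 * PI * y)) with (p2 (/ (2 * PI * y))) in M.
  set (t := 2 * PI * y) in *. set (r := exp (- t)) in *.
  assert (Hv : 0 < / t <= 0.18402).
  { split; [apply Rinv_0_lt_compat; lra|].
    apply Rle_trans with (/ 5.4345); [apply Rinv_le_contravar; lra|lra]. }
  assert (Rr : 0 < r <= 0.0043635).
  { split; [apply exp_pos|].
    apply (exp_neg_upper16 0.339656 0.7120154 0.50696593 0.25701446 0.066056433); lra. }
  assert (P1 := p2_mono 0 (/ t) ltac:(lra)).
  assert (P2 := p2_mono (/ t/2) 0.09201 ltac:(lra)).
  assert (E3 := err3_mono r 0.0043635 (/ t) 0.18402 ltac:(lra) ltac:(lra) ltac:(lra)).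
  assert (E3' : err3 0.0043635 0.18402 <= 0.0049) by (unfold err3, p2; lra).
  assert (P2' : p2 (/ t/2) <= 1.3015) by (unfold p2 at 3 in P2; lra).
  assert (X2 : r^2 * p2 (/ t/2) <= 0.0043635^2 * 1.3015).
  { apply Rmult_le_compat; try lra; [apply pow_le; lra|apply pow_incr; lra]. }
  assert (X2' : 0 <= r^2 * p2 (/ t/2)) by (apply Rmult_le_pos; [apply pow_le|]; lra).
  assert (X3 : r * err3 r (/ t) <= 0.0043635 * 0.0049) by (apply Rmult_le_compat; lra).
  apply Rabs_le_between in M. simpl (2^2) in M.
  (* [exp] is above its tangent at 5.472667 = 2 pi * 0.871, which makes the bound polynomial in y *)
  assert (R0 : 0.0041997 * (6.472667 - 6.28319 * y) <= r).
  { unfold r. replace (- t) with (- (5.472667) + (5.472667 - t)) by ring. rewrite exp_plus.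
    assert (0.0041997 <= exp (- (5.472667))).
    { apply (exp_neg_lower16 0.342042 0.7103162 0.5045491 0.25456979 0.064805777); lra. }
    assert (1 + (5.472667 - t) <= exp (5.472667 - t)) by apply exp_ineq1_le.
    assert (t <= 6.28319 * y) by (apply Rmult_le_compat_r; lra).
    apply Rmult_le_compat; lra. }
  set (S := mode_sum 2 3 Q2 t (phase x)) in *.
  assert (RP : 0 <= r * p2 (/ t)) by (apply Rmult_le_pos; lra).
  assert (HS : S <= - 0.9921 * (r * p2 (/ t)) + 4 * (0.0043635^2 * 1.3015) + 0.0043635 * 0.0049).
  { assert (r * p2 (/ t) * cos (2 * PI * x) <= r * p2 (/ t) * - 0.9921) by (apply Rmult_le_compat_l; lra).
    assert (4 * r^2 * p2 (/ t/2) * cos (2 * (2 * PI * x)) <= 4 * r^2 * p2 (/ t/2) * 1)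
      by (apply Rmult_le_compat_l; lra).
    lra. }
  assert (HS2 : 2 * PI^3 * S <= - 0.9921 * (r * (2 * PI^3 * p2 (/ t))) + 0.00748).
  { apply Rmult_le_compat_l with (r := 2 * PI^3) in HS; [|lra].
    assert (2 * PI ^ 3 * (4 * (0.0043635 ^ 2 * 1.3015) + 0.0043635 * 0.0049) <= 0.00748) by nra. lra. }
  assert (HQ : y^2 * (2 * PI^3 * p2 (/ t)) = 2 * PI^3 * y^2 + 3 * PI^2 * y + 3/2 * PI).
  { unfold t, p2. field. lra. }
  assert (HQ' : 62.0124 * y^2 + 29.6085 * y + 4.71238 <= y^2 * (2 * PI^3 * p2 (/ t))).
  { rewrite HQ. assert (31.0062 * y^2 <= PI^3 * y^2) by (apply Rmult_le_compat_r; nra).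
    assert (9.8695 * y <= PI^2 * y) by (apply Rmult_le_compat_r; lra). lra. }
  assert (HM : 0.0041997 * (6.472667 - 6.28319 * y) * (62.0124 * y^2 + 29.6085 * y + 4.71238) <=
     r * (y^2 * (2 * PI^3 * p2 (/ t)))).
  { apply Rmult_le_compat; try assumption; nra. }
  assert (Z5 := zeta_nat_5_bounds). assert (Z6 := zeta_nat_6_bounds).
  assert (Hy2 : 0 < y^2) by (apply pow_lt; lra).
  assert (Y1 : PI * zeta_nat 5 <= 3.141594 * 1.0373) by (apply Rmult_le_compat; lra).
  assert (Y2 : zeta_nat 6 * y^5 <= 1.0174 * y^5).
  { apply Rmult_le_compat_r; [apply pow_le; lra|lra]. }
  (* Expanded around 0.871, the midpoint of the range of y and the point of tangency chosen for
     exp. *)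
  assert (Poly : 2 * (1.0174 * y^5) + 3/4 * (3.141594 * 1.0373)
     - 0.9921 * (0.0041997 * (6.472667 - 6.28319 * y) * (62.0124 * y^2 + 29.6085 * y + 4.71238))
     <= (4.151 - 0.00748) * y^2).
  { clear - Hy. set (e := y - 0.871). replace y with (0.871 + e) by (unfold e; ring).
    assert (He : -0.006 <= e <= 0.006) by (unfold e; lra).
    assert (E2 : 0 <= e^2 <= 0.000036) by nra.
    assert (E3 : -0.000001 <= e^3 <= 0.000001) by (replace (e^3) with (e * e^2) by ring; nra).
    assert (E4 : 0 <= e^4 <= 0.000001) by (replace (e^4) with (e^2 * e^2) by ring; nra).
    assert (E5 : -0.000001 <= e^5 <= 0.000001) by (replace (e^5) with (e * e^4) by ring; nra).
    lra. }
  apply (Rmult_le_reg_l (y^2)); [assumption|].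
  replace (y^2 * (2 * zeta_nat 6 * y^3 + 3 * PI / 4 / y^2 * zeta_nat 5 + 2 * PI^3 * S)) with
    (2 * (zeta_nat 6 * y^5) + 3/4 * (PI * zeta_nat 5) + y^2 * (2 * PI^3 * S)) by (field; lra).
  apply Rmult_le_compat_l with (r := y^2) in HS2; [|lra].
  lra.
Qed.

(** zeta(3) is larger at i (at least 4.657) than in the box (at most 4.151), so the smallest b is
    the worst case. *)
Lemma Eb_near_rho (b x y : R) : 3.062 <= b -> 0.865 <= y <= 0.877 -> 0.48 <= x <= 0.52 ->
  Eb b 0 1 <= Eb b x y.
Proof.
  intros Hb Hy Hx. unfold Eb.
  assert (H1 := zeta6_near_rho x y Hy Hx). assert (H2 := zeta3_near_rho x y Hy Hx).
  assert (H3 := zeta3_square_lower). assert (H4 := zeta6_square_upper).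
  assert (3.062 * (zeta 3 0 1 - zeta 3 x y) <= b * (zeta 3 0 1 - zeta 3 x y))
    by (apply Rmult_le_compat_r; lra).
  lra.
Qed.

(** * Modular invariance, continuity and existence of minima *)
Lemma zeta_partial_zsum (s x y : R) (N : nat) :
  zeta_partial s x y N = zsum (fun m => zsum (zeta_term s x y m) N) N.
Proof. reflexivity. Qed.

Lemma zeta_reflect (s x y : R) : zeta s (- x) y = zeta s x y.
Proof.
  unfold zeta. f_equal. apply Lim_seq_ext. intros N. rewrite !zeta_partial_zsum.
  apply zsum_ext. intros m. rewrite <- zsum_opp. apply zsum_ext. intros n.
  rewrite <- zeta_term_opp, Z.opp_involutive. unfold zeta_term. rewrite !opp_IZR.
  replace (Z.eqb (- m) 0) with (Z.eqb m 0) by (destruct (Z.eqb_spec m 0), (Z.eqb_spec (- m) 0); lia).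
  replace ((- IZR m * - x + IZR n) ^ 2 + (- IZR m * y) ^ 2) with
    ((IZR m * x + IZR n) ^ 2 + (IZR m * y) ^ 2) by ring. reflexivity.
Qed.

Lemma zsum_exchange (f : Z -> Z -> R) (N M : nat) :
  zsum (fun m => zsum (f m) N) M = zsum (fun n => zsum (fun m => f m n) M) N.
Proof.
  induction M as [|M IH].
  - unfold zsum at 1 3; simpl. apply zsum_ext; intros. reflexivity.
  - rewrite zsum_S, IH, <- !zsum_plus. apply zsum_ext. intros n. rewrite zsum_S. reflexivity.
Qed.

Lemma Rpower_div (a b s : R) : 0 < a -> 0 < b -> Rpower (a / b) s = Rpower a s / Rpower b s.
Proof.
  intros Ha Hb. unfold Rdiv. rewrite <- Rpower_mult_distr by (auto using Rinv_0_lt_compat).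
  f_equal. unfold Rpower. rewrite ln_Rinv by assumption. rewrite <- exp_Ropp. f_equal. ring.
Qed.

(** Reflection in the unit circle exchanges m and n and divides the quadratic form by |z|^2. It
    preserves every square partial sum, so no convergence is involved. *)
Lemma zeta_inversion (s x y : R) : 0 < y ->
  zeta s (x / (x^2 + y^2)) (y / (x^2 + y^2)) = zeta s x y.
Proof.
  intros Hy. set (D := x^2 + y^2).
  assert (HD : 0 < D) by (unfold D; assert (0 < y^2) by (apply pow_lt; lra);
    generalize (pow2_ge_0 x); lra).
  unfold zeta. f_equal. apply Lim_seq_ext. intros N. rewrite !zeta_partial_zsum, zsum_exchange.
  apply zsum_ext. intros n. apply zsum_ext. intros m. unfold zeta_term.
  rewrite (Bool.andb_comm (Z.eqb m 0)).
  destruct (Z.eqb n 0 && Z.eqb m 0)%bool eqn:E; [reflexivity|].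
  fold (epstein_form x y n m). assert (Hq := epstein_form_pos x y n m Hy E).
  replace ((IZR m * (x / D) + IZR n) ^ 2 + (IZR m * (y / D)) ^ 2) with (epstein_form x y n m / D).
  - rewrite !Rpower_div by assumption. field.
    split; apply Rgt_not_eq, exp_pos.
  - unfold epstein_form.
    replace ((IZR n * x + IZR m)^2 + (IZR n * y)^2) with
      (IZR n ^ 2 * D + 2 * IZR m * IZR n * x + IZR m ^ 2) by (unfold D; ring).
    replace ((IZR m * (x / D) + IZR n) ^ 2 + (IZR m * (y / D)) ^ 2) with
      (IZR m ^ 2 * (x^2 + y^2) / D^2 + 2 * IZR m * IZR n * x / D + IZR n ^ 2) by (field; lra).
    fold D. field. lra.
Qed.

Lemma sum_f_R0_shift_le (f : nat -> R) (n c M : nat) :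
  (forall i, 0 <= f i) -> (n + c <= M)%nat ->
  sum_f_R0 (fun j => f (j + c)%nat) n <= sum_f_R0 f M.
Proof.
  intros Hf H. apply Rle_trans with (sum_f_R0 f (n + c)); [|apply sum_f_R0_mono; assumption].
  clear H. induction n as [|n IH].
  - simpl. destruct c as [|c]; [simpl; lra|]. rewrite tech5.
    generalize (cond_pos_sum f c Hf); lra.
  - simpl Nat.add. rewrite !tech5. simpl Nat.add. lra.
Qed.

Lemma zsum_shift_le (g : Z -> R) (k : Z) (N : nat) :
  (forall n, 0 <= g n) -> (Z.abs k <= Z.of_nat N)%Z ->
  zsum (fun n => g (n + k)%Z) N <= zsum g (2 * N).
Proof.
  intros Hg Hk. unfold zsum.
  rewrite (sum_eq _ (fun j => (fun i => g (Z.of_nat i - Z.of_nat (2 * N))%Z)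
     (j + Z.to_nat (Z.of_nat N + k))%nat)).
  - apply (sum_f_R0_shift_le (fun i => g (Z.of_nat i - Z.of_nat (2 * N))%Z)); [auto|]. lia.
  - intros j _. f_equal. lia.
Qed.

(** The shear n -> n + m e does not preserve the square of size N, but sends it into that of size
    2N. Using e = 1 and e = -1 then gives equality of the limits. *)
Lemma zeta_partial_translate_le (s x y : R) (e : Z) (N : nat) : (Z.abs e <= 1)%Z ->
  zeta_partial s (x + IZR e) y N <= zeta_partial s x y (2 * N).
Proof.
  intros He. rewrite !zeta_partial_zsum.
  apply Rle_trans with (zsum (fun m => zsum (zeta_term s x y m) (2 * N)) N).
  2:{ apply zsum_mono; [|lia]. intros; apply zsum_nonneg; intros; apply zeta_term_nonneg. }
  apply sum_Rle. intros i Hi. set (m := (Z.of_nat i - Z.of_nat N)%Z).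
  apply Rle_trans with (zsum (fun n => zeta_term s x y m (n + m * e)%Z) N).
  - right. apply zsum_ext. intros n. unfold zeta_term.
    rewrite plus_IZR, mult_IZR.
    replace (Z.eqb m 0 && Z.eqb (n + m * e) 0)%bool with (Z.eqb m 0 && Z.eqb n 0)%bool.
    2:{ destruct (Z.eqb_spec m 0) as [->|]; [|reflexivity]. rewrite Z.mul_0_l, Z.add_0_r. reflexivity. }
    replace ((IZR m * (x + IZR e) + IZR n)^2) with ((IZR m * x + (IZR n + IZR m * IZR e))^2) by ring.
    reflexivity.
  - apply zsum_shift_le; [intros; apply zeta_term_nonneg|]. unfold m. nia.
Qed.

Lemma Lim_zeta_partial_translate_le (s x y : R) (e : Z) : (Z.abs e <= 1)%Z ->
  Rbar_le (Lim_seq (zeta_partial s (x + IZR e) y)) (Lim_seq (zeta_partial s x y)).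
Proof.
  intros He.
  assert (Hex : ex_lim_seq (zeta_partial s x y)).
  { apply ex_lim_seq_incr. intros; apply zeta_partial_mono; lia. }
  apply Lim_seq_correct in Hex.
  apply is_lim_seq_subseq with (phi := fun N => (2 * N)%nat) in Hex.
  - apply is_lim_seq_unique in Hex. rewrite <- Hex.
    apply Lim_seq_le_loc. exists O. intros N _. apply zeta_partial_translate_le; assumption.
  - intros P [N HN]. exists N. intros n Hn. apply HN. lia.
Qed.

Lemma zeta_translate (s x y : R) : zeta s (x + 1) y = zeta s x y.
Proof.
  unfold zeta. f_equal. apply Rbar_le_antisym.
  - apply (Lim_zeta_partial_translate_le s x y 1). lia.
  - replace x with (x + 1 + IZR (-1)) at 1 by ring.
    apply Lim_zeta_partial_translate_le. lia.
Qed.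

Lemma zeta_partial_scal (s x y C : R) (N : nat) :
  C * zeta_partial s x y N = zsum (fun m => zsum (fun n => C * zeta_term s x y m n) N) N.
Proof. rewrite zeta_partial_zsum, <- zsum_scal. apply zsum_ext. intros; symmetry; apply zsum_scal. Qed.

(* The terms of the remainder are dominated by those at [i], so the convergence of the square
   partial sums is uniform wherever such a [C] can be chosen uniformly. *)
Lemma zeta_dominated_by_square (s x y C : R) :
  (exists l : R, is_lim_seq (zeta_partial s 0 1) l) ->
  (forall m n, zeta_term s x y m n <= C * zeta_term s 0 1 m n) ->
  zeta s x y <= C * zeta s 0 1 /\
  forall N, zeta_partial s x y N <= zeta s x y /\
    zeta s x y - zeta_partial s x y N <= C * (zeta s 0 1 - zeta_partial s 0 1 N).
Proof.
  intros [l0 H0] Hdom.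
  assert (E0 : zeta s 0 1 = l0) by (unfold zeta; rewrite (is_lim_seq_unique _ _ H0); reflexivity).
  assert (Hdiff : forall N M, (N <= M)%nat ->
    C * zeta_partial s 0 1 N - zeta_partial s x y N <= C * zeta_partial s 0 1 M - zeta_partial s x y M).
  { assert (E : forall N, C * zeta_partial s 0 1 N - zeta_partial s x y N =
      zsum (fun m => zsum (fun n => C * zeta_term s 0 1 m n + -1 * zeta_term s x y m n) N) N).
    { intros N. rewrite zeta_partial_scal.
      replace (zeta_partial s x y N) with (- (-1 * zeta_partial s x y N)) by ring.
      rewrite zeta_partial_scal. unfold Rminus. rewrite Ropp_involutive, <- zsum_plus.
      apply zsum_ext. intros m. rewrite <- zsum_plus. reflexivity. }
    assert (Hpos : forall m n, 0 <= C * zeta_term s 0 1 m n + -1 * zeta_term s x y m n).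
    { intros m n. specialize (Hdom m n). lra. }
    intros N M HNM. rewrite !E.
    apply Rle_trans with
      (zsum (fun m => zsum (fun n => C * zeta_term s 0 1 m n + -1 * zeta_term s x y m n) M) N).
    - apply zsum_le. intros m. apply zsum_mono; auto.
    - apply zsum_mono; [|assumption]. intros; apply zsum_nonneg; auto. }
  assert (Hle : forall N, zeta_partial s x y N <= C * zeta_partial s 0 1 N).
  { intros N. rewrite zeta_partial_scal, zeta_partial_zsum. apply zsum_le. intros m.
    apply zsum_le. intros n. apply Hdom. }
  assert (H0C : is_lim_seq (fun N => C * zeta_partial s 0 1 N) (C * l0))
    by apply (is_lim_seq_scal_l _ C l0 H0).
  assert (Hfin : exists l : R, is_lim_seq (zeta_partial s x y) l).
  { assert (Hex : ex_lim_seq (zeta_partial s x y))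
      by (apply ex_lim_seq_incr; intros; apply zeta_partial_mono; lia).
    destruct Hex as [[l| |] Hl].
    - exists l; assumption.
    - exfalso. assert (X := is_lim_seq_le _ _ _ _ Hle Hl H0C). exact X.
    - exfalso. assert (X := is_lim_seq_le (fun _ => 0) _ 0 _
        (fun N => zsum_nonneg _ N (fun m => zsum_nonneg _ N (fun n => zeta_term_nonneg s x y m n)))
        (is_lim_seq_const 0) Hl). exact X. }
  destruct Hfin as [l Hl].
  assert (E : zeta s x y = l) by (unfold zeta; rewrite (is_lim_seq_unique _ _ Hl); reflexivity).
  rewrite E0, E. split; [exact (is_lim_seq_le _ _ _ _ Hle Hl H0C)|].
  intros N. split; [rewrite <- E; apply (zeta_partial_le_lim s x y l N Hl)|].
  assert (X : Rbar_le (C * zeta_partial s 0 1 N - zeta_partial s x y N) (C * l0 - l)).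
  { apply (is_lim_seq_le_loc (fun _ => C * zeta_partial s 0 1 N - zeta_partial s x y N)
      (fun M => C * zeta_partial s 0 1 M - zeta_partial s x y M)).
    - exists N. intros M HM. apply Hdiff; assumption.
    - apply is_lim_seq_const.
    - apply is_lim_seq_minus'; assumption. }
  simpl in X. lra.
Qed.

(** The factor 12 = 3 * 4 comes from m^2 + n^2 <= 3 m^2 + 2 (m x + n)^2, for |x| <= 1, and m^2 <= 4
    m^2 y^2, for y >= 1/2. *)
Lemma zeta_term_dominated (p : nat) (x y Y : R) (m n : Z) :
  -1 <= x <= 1 -> 1/2 <= y <= Y ->
  zeta_term (INR p) x y m n <= (12 * Y) ^ p * zeta_term (INR p) 0 1 m n.
Proof.
  intros Hx Hy. rewrite !zeta_term_pow by lra.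
  destruct (Z.eqb m 0 && Z.eqb n 0)%bool eqn:E; [lra|].
  assert (H1 := epstein_form_pos x y m n ltac:(lra) E).
  assert (H0 := epstein_form_pos 0 1 m n ltac:(lra) E).
  assert (Hq : epstein_form 0 1 m n <= 12 * epstein_form x y m n).
  { unfold epstein_form. set (a := IZR m). set (c := IZR n).
    assert (A1 : a^2 * x^2 <= a^2 * 1) by (apply Rmult_le_compat_l; [apply pow2_ge_0|nra]).
    assert (A2 : a^2 * (1/4) <= a^2 * y^2) by (apply Rmult_le_compat_l; [apply pow2_ge_0|nra]).
    assert (A3 : c^2 <= 2 * (a * x + c)^2 + 2 * (a^2 * x^2)).
    { assert (0 <= (2 * (a * x) + c)^2) by apply pow2_ge_0. lra. }
    assert (0 <= (a * x + c)^2) by apply pow2_ge_0. lra. }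
  rewrite pow1. unfold Rdiv. rewrite <- !pow_inv, Rmult_1_l, <- !Rpow_mult_distr.
  apply pow_incr.
  assert (I1 : 0 < / epstein_form x y m n) by (apply Rinv_0_lt_compat; assumption).
  split; [apply Rmult_le_pos; lra|].
  apply Rle_trans with (Y * / epstein_form x y m n); [apply Rmult_le_compat_r; lra|].
  replace (12 * Y * / epstein_form 0 1 m n) with (Y * (12 * / epstein_form 0 1 m n)) by ring.
  apply Rmult_le_compat_l; [lra|].
  replace (12 * / epstein_form 0 1 m n) with (/ (epstein_form 0 1 m n / 12)) by (field; lra).
  apply Rinv_le_contravar; lra.
Qed.

(** * Continuity along curves and existence of minima *)

Lemma continuity_pt_sum_f_R0 (f : nat -> R -> R) (c : R) (N : nat) :
  (forall i, continuity_pt (f i) c) -> continuity_pt (fun u => sum_f_R0 (fun i => f i u) N) c.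
Proof.
  intros H. induction N as [|N IH]; simpl; [apply H|].
  apply (continuity_pt_plus (fun u => sum_f_R0 (fun i => f i u) N)); auto.
Qed.

Lemma continuity_pt_pow (f : R -> R) (p : nat) (c : R) :
  continuity_pt f c -> continuity_pt (fun u => f u ^ p) c.
Proof.
  intros H. apply (continuity_pt_comp f (fun z => z ^ p)); [assumption|].
  apply derivable_continuous_pt, derivable_pt_pow.
Qed.

(** Continuity is stated along a curve so that the one-variable theorem on uniform limits applies;
    the vertical ray and the arc are the two instances. *)
Lemma zeta_path_continuous (p : nat) (X Y : R -> R) (c Ymax : R) (r : posreal) :
  (exists l : R, is_lim_seq (zeta_partial (INR p) 0 1) l) ->
  (forall u, Rabs (u - c) < r -> -1 <= X u <= 1 /\ 1/2 <= Y u <= Ymax) ->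
  (forall u, Rabs (u - c) < r -> continuity_pt X u /\ continuity_pt Y u) ->
  continuity_pt (fun u => zeta (INR p) (X u) (Y u)) c.
Proof.
  intros H0 Hbox Hcont.
  (* Integer powers replace [Rpower]; the two agree where Y is positive, in particular on the ball
     around c. *)
  set (T := fun u m n => if (Z.eqb m 0 && Z.eqb n 0)%bool then 0
     else Y u ^ p * / epstein_form (X u) (Y u) m n ^ p).
  set (G := fun N u => zsum (fun m => zsum (T u m) N) N).
  assert (EG : forall N u, Rabs (u - c) < r -> G N u = zeta_partial (INR p) (X u) (Y u) N).
  { intros N u Hu. rewrite zeta_partial_zsum. apply zsum_ext. intros m. apply zsum_ext. intros n.
    rewrite zeta_term_pow by (generalize (Hbox u Hu); lra). reflexivity. }
  apply (CVU_continuity G _ c r).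
  - intros eps Heps. set (C := (12 * Ymax) ^ p).
    assert (Hc := Hbox c ltac:(rewrite Rminus_diag, Rabs_R0; apply cond_pos)).
    assert (HC : 0 <= C) by (apply pow_le; lra).
    destruct H0 as [l0 H0].
    assert (E0 : zeta (INR p) 0 1 = l0) by (unfold zeta; rewrite (is_lim_seq_unique _ _ H0); reflexivity).
    assert (H0' := H0). apply is_lim_seq_spec in H0'.
    assert (He : 0 < eps / (C + 1)) by (apply Rdiv_lt_0_compat; lra).
    destruct (H0' (mkposreal _ He)) as [N HN]. exists N. intros n u Hn Hu.
    assert (Hu' : Rabs (u - c) < r) by exact Hu.
    destruct (Hbox u Hu') as [B1 B2].
    destruct (zeta_dominated_by_square (INR p) (X u) (Y u) C) as [_ D].
    + exists l0; assumption.
    + intros m k. apply zeta_term_dominated; assumption.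
    + destruct (D n) as [D1 D2]. rewrite EG by assumption.
      rewrite E0 in D2. specialize (HN n Hn). simpl in HN. apply Rabs_def2 in HN.
      rewrite Rabs_right by lra.
      apply Rle_lt_trans with (1 := D2).
      apply Rle_lt_trans with (C * (eps / (C + 1))); [apply Rmult_le_compat_l; lra|].
      apply (Rmult_lt_reg_r (C + 1)); [lra|].
      replace (C * (eps / (C + 1)) * (C + 1)) with (C * eps) by (field; lra). nra.
  - intros N u Hu. assert (Hu' : Rabs (u - c) < r) by exact Hu.
    destruct (Hbox u Hu') as [B1 B2]. destruct (Hcont u Hu') as [CX CY].
    unfold G, zsum.
    apply (continuity_pt_sum_f_R0 (fun i u => sum_f_R0 (fun j => T u (Z.of_nat i - Z.of_nat N)%Z
       (Z.of_nat j - Z.of_nat N)%Z) (2 * N))).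
    intros i. apply (continuity_pt_sum_f_R0 (fun j u => T u (Z.of_nat i - Z.of_nat N)%Z
       (Z.of_nat j - Z.of_nat N)%Z)).
    intros j. set (m := (Z.of_nat i - Z.of_nat N)%Z). set (n := (Z.of_nat j - Z.of_nat N)%Z).
    unfold T. destruct (Z.eqb m 0 && Z.eqb n 0)%bool eqn:E.
    + apply continuity_pt_const. intros a b; reflexivity.
    + apply (continuity_pt_mult (fun u => Y u ^ p)); [apply continuity_pt_pow; assumption|].
      apply (continuity_pt_inv (fun u => epstein_form (X u) (Y u) m n ^ p)).
      * apply continuity_pt_pow. unfold epstein_form.
        apply (continuity_pt_plus (fun u => (IZR m * X u + IZR n)^2)); apply continuity_pt_pow.
        -- apply (continuity_pt_plus (fun u => IZR m * X u)).
           ++ apply (continuity_pt_scal X); assumption.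
           ++ apply continuity_pt_const; intros a b; reflexivity.
        -- apply (continuity_pt_scal Y); assumption.
      * apply pow_nonzero, Rgt_not_eq, epstein_form_pos; [lra|assumption].
  - unfold Boule. rewrite Rminus_diag, Rabs_R0. apply cond_pos.
Qed.

Lemma zeta3_square_converges : exists l : R, is_lim_seq (zeta_partial (INR 3) 0 1) l.
Proof.
  eexists. replace (INR 3) with 3 by (simpl; lra).
  apply zeta3_expansion; [lra|apply exp_neg_2PI_small; lra].
Qed.

Lemma zeta6_square_converges : exists l : R, is_lim_seq (zeta_partial (INR 6) 0 1) l.
Proof.
  eexists. replace (INR 6) with 6 by (simpl; lra).
  apply zeta6_expansion; [lra|apply exp_neg_2PI_small; lra].
Qed.

Lemma Eb_path_continuous (b : R) (X Y : R -> R) (c Ymax : R) (r : posreal) :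
  (forall u, Rabs (u - c) < r -> -1 <= X u <= 1 /\ 1/2 <= Y u <= Ymax) ->
  (forall u, Rabs (u - c) < r -> continuity_pt X u /\ continuity_pt Y u) ->
  continuity_pt (fun u => Eb b (X u) (Y u)) c.
Proof.
  intros Hbox Hcont. unfold Eb.
  apply (continuity_pt_minus (fun u => zeta 6 (X u) (Y u)) (fun u => b * zeta 3 (X u) (Y u))).
  - replace 6 with (INR 6) by (simpl; lra).
    apply (zeta_path_continuous 6 X Y c Ymax r zeta6_square_converges Hbox Hcont).
  - apply (continuity_pt_scal (fun u => zeta 3 (X u) (Y u))).
    replace 3 with (INR 3) by (simpl; lra).
    apply (zeta_path_continuous 3 X Y c Ymax r zeta3_square_converges Hbox Hcont).
Qed.

Lemma zeta3_vertical_growth (y : R) : 1 <= y -> zeta 3 0 y <= y ^ 3 * zeta 3 0 1.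
Proof.
  intros Hy. replace 3 with (INR 3) by (simpl; lra).
  apply zeta_dominated_by_square; [apply zeta3_square_converges|].
  intros m n. rewrite !zeta_term_pow by lra.
  destruct (Z.eqb m 0 && Z.eqb n 0)%bool eqn:E; [lra|].
  assert (H1 := epstein_form_pos 0 1 m n ltac:(lra) E).
  rewrite pow1. unfold Rdiv. rewrite Rmult_1_l. apply Rmult_le_compat_l; [apply pow_le; lra|].
  apply Rinv_le_contravar; [apply pow_lt; assumption|]. apply pow_incr. split; [lra|].
  unfold epstein_form. rewrite !Rpow_mult_distr.
  assert (IZR m ^ 2 * 1^2 <= IZR m ^ 2 * y^2).
  { apply Rmult_le_compat_l; [apply pow2_ge_0|nra]. }
  lra.
Qed.

Lemma Eb_min_exists_Gamma_a (b : R) : 0 <= b ->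
  exists y0, 1 <= y0 /\ forall y, 1 <= y -> Eb b 0 y0 <= Eb b 0 y.
Proof.
  intros Hb. set (Z := zeta 3 0 1).
  (* Beyond Y the value is at least y^3 (2 y^3 - b Z), and Y makes the parenthesis both nonnegative
     and at least the value at i. The minimum over [1, Y] is therefore global. *)
  set (Y := 1 + Rabs (Eb b 0 1) + Rabs (b * Z)).
  assert (HY : 1 <= Y) by (unfold Y; generalize (Rabs_pos (Eb b 0 1)), (Rabs_pos (b * Z)); lra).
  destruct (continuity_ab_min (fun y => Eb b 0 y) 1 Y HY) as [y0 [Hmin Hy0]].
  { intros c Hc. assert (Hr : 0 < 1/2) by lra.
    apply (Eb_path_continuous b (fun _ => 0) (fun y => y) c (c + 1/2) (mkposreal _ Hr)).
    - simpl. intros u Hu. apply Rabs_def2 in Hu. lra.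
    - intros u _. split.
      + apply continuity_pt_const; intros a a'; reflexivity.
      + apply derivable_continuous_pt, derivable_pt_id. }
  exists y0. split; [lra|]. intros y Hy.
  destruct (Rle_dec y Y) as [HyY|HyY]; [apply Hmin; lra|].
  apply Rle_trans with (Eb b 0 1); [apply Hmin; lra|].
  assert (L6 : 2 * y^6 <= zeta 6 0 y).
  { eapply Rle_trans; [|apply zeta6_hexagonal_terms; lra].
    assert (0 < y^6) by (apply pow_lt; lra).
    assert (0 < y^2) by (apply pow_lt; lra).
    assert (0 < / (0^2 + y^2)^6) by (apply Rinv_0_lt_compat, pow_lt; lra).
    assert (0 < / ((1 - 0)^2 + y^2)^6) by (apply Rinv_0_lt_compat, pow_lt; lra).
    nra. }
  assert (U3 := zeta3_vertical_growth y Hy). fold Z in U3.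
  apply Rmult_le_compat_l with (r := b) in U3; [|assumption].
  assert (Hy3 : y <= y^3) by nra.
  assert (A1 := Rle_abs (Eb b 0 1)). assert (A2 := Rle_abs (b * Z)).
  assert (A3 := Rabs_pos (Eb b 0 1)). assert (A4 := Rabs_pos (b * Z)).
  assert (K : Eb b 0 1 <= 2 * y^3 - b * Z) by (unfold Y in HyY; lra).
  assert (K0 : 0 <= 2 * y^3 - b * Z) by (unfold Y in HyY; lra).
  assert (K1 : 1 * (2 * y^3 - b * Z) <= y^3 * (2 * y^3 - b * Z)) by (apply Rmult_le_compat_r; lra).
  change (Eb b 0 y) with (zeta 6 0 y - b * zeta 3 0 y).
  replace (y^6) with (y^3 * y^3) in L6 by ring. lra.
Qed.

Lemma Eb_min_exists_arc (b : R) :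
  exists y0, sqrt 3 / 2 <= y0 <= 1 /\
  forall y, sqrt 3 / 2 <= y <= 1 -> Eb b (sqrt (1 - y0^2)) y0 <= Eb b (sqrt (1 - y^2)) y.
Proof.
  assert (S3 : 1.73 <= sqrt 3 <= 1.74).
  { split; apply Rsqr_incr_0_var; rewrite ?Rsqr_sqrt; unfold Rsqr; try lra; apply sqrt_pos. }
  (* Continuity at y = 1 is two-sided. [Rabs] extends the curve past that endpoint and changes
     nothing on the arc. *)
  destruct (continuity_ab_min (fun y => Eb b (sqrt (Rabs (1 - y^2))) y) (sqrt 3 / 2) 1 ltac:(lra))
    as [y0 [Hmin Hy0]].
  { intros c Hc. assert (Hr : 0 < 0.1) by lra.
    apply (Eb_path_continuous b (fun y => sqrt (Rabs (1 - y^2))) (fun y => y) c 2 (mkposreal _ Hr)).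
    - simpl. intros u Hu. apply Rabs_def2 in Hu. split; [|lra].
      split; [apply Rle_trans with 0; [lra|apply sqrt_pos]|].
      apply Rle_trans with (sqrt 1); [|rewrite sqrt_1; lra].
      apply sqrt_le_1_alt, Rabs_le. nra.
    - intros u _. split.
      + apply (continuity_pt_comp (fun y => Rabs (1 - y^2)) sqrt).
        * apply (continuity_pt_comp (fun y => 1 - y^2) Rabs).
          -- apply derivable_continuous_pt. reg.
          -- apply Rcontinuity_abs.
        * apply continuity_pt_sqrt, Rabs_pos.
      + apply derivable_continuous_pt, derivable_pt_id. }
  assert (E : forall y, sqrt 3 / 2 <= y <= 1 -> Rabs (1 - y^2) = 1 - y^2).
  { intros y Hy. apply Rabs_right. nra. }
  exists y0. split; [assumption|]. intros y Hy. specialize (Hmin y Hy). cbv beta in Hmin.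
  rewrite !E in Hmin by assumption. exact Hmin.
Qed.

(** * Reduction to the fundamental domain and conclusion *)

Lemma Eb_reflect (b x y : R) : Eb b (- x) y = Eb b x y.
Proof. unfold Eb. rewrite !zeta_reflect. reflexivity. Qed.

Lemma Eb_translate (b x y : R) : Eb b (x + 1) y = Eb b x y.
Proof. unfold Eb. rewrite !zeta_translate. reflexivity. Qed.

Lemma Eb_inversion (b x y : R) : 0 < y -> Eb b (x / (x^2 + y^2)) (y / (x^2 + y^2)) = Eb b x y.
Proof. intros Hy. unfold Eb. rewrite !zeta_inversion by assumption. reflexivity. Qed.

Lemma Eb_translate_nat (b x y : R) (k : nat) : Eb b (x + INR k) y = Eb b x y.
Proof.
  induction k as [|k IH]; [simpl; rewrite Rplus_0_r; reflexivity|].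
  rewrite S_INR, <- Rplus_assoc, Eb_translate. exact IH.
Qed.

Lemma Eb_strip_representative (b x y : R) : exists x', 0 <= x' <= 1/2 /\ Eb b x' y = Eb b x y.
Proof.
  assert (Hint : exists x1, -1/2 <= x1 <= 1/2 /\ Eb b x1 y = Eb b x y).
  { destruct (archimed (x - 1/2)) as [A1 A2]. set (k := up (x - 1/2)) in *.
    exists (x - IZR k). split; [lra|].
    destruct (Z_le_dec 0 k) as [Hk|Hk].
    - rewrite <- (Eb_translate_nat b (x - IZR k) y (Z.to_nat k)).
      f_equal. rewrite INR_IZR_INZ, Z2Nat.id by assumption. ring.
    - rewrite <- (Eb_translate_nat b x y (Z.to_nat (- k))).
      f_equal. rewrite INR_IZR_INZ, Z2Nat.id, opp_IZR by lia. ring. }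
  destruct Hint as [x1 [H1 E1]]. destruct (Rle_dec 0 x1).
  - exists x1. split; [lra|assumption].
  - exists (- x1). split; [lra|]. rewrite Eb_reflect. assumption.
Qed.

(* Each inversion with |z|^2 <= 0.999 raises the height by a definite factor; when 0.999 < |z|^2 < 1
   one inversion lands in the fundamental domain or in the box around exp(i pi/3). *)
Lemma Eb_lower_bound_half_plane (b m : R) :
  (forall x y, DG_closure x y -> m <= Eb b x y) ->
  (forall x y, 0.865 <= y <= 0.877 -> 0.48 <= x <= 0.52 -> m <= Eb b x y) ->
  forall x y, 0 < y -> m <= Eb b x y.
Proof.
  intros HDG Hbox.
  assert (Hind : forall k x y, 0.999 ^ k <= y -> m <= Eb b x y).
  { induction k as [|k IH]; intros x y Hy.
    - simpl in Hy. destruct (Eb_strip_representative b x y) as [x' [Hx' <-]].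
      apply HDG. unfold DG_closure. repeat split; try lra. nra.
    - assert (0 < 0.999 ^ k) by (apply pow_lt; lra). simpl in Hy.
      destruct (Eb_strip_representative b x y) as [x' [Hx' <-]]. clear x.
      set (D := x'^2 + y^2). assert (Hy0 : 0 < y) by lra.
      assert (HD : 0 < D).
      { unfold D. assert (0 < y^2) by (apply pow_lt; lra). generalize (pow2_ge_0 x'); lra. }
      destruct (Rle_dec 1 D) as [H1|H1].
      { apply HDG. unfold DG_closure. fold D. repeat split; lra. }
      rewrite <- Eb_inversion by assumption. fold D.
      assert (I1 : 1 < / D) by (rewrite <- Rinv_1; apply Rinv_lt_contravar; lra).
      destruct (Rle_dec D 0.999) as [H2|H2].
      { apply IH. apply (Rmult_le_reg_r D); [assumption|].
        unfold Rdiv. rewrite Rmult_assoc, Rinv_l, Rmult_1_r by lra.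
        assert (0.999 ^ k * D <= 0.999 ^ k * 0.999) by (apply Rmult_le_compat_l; lra). lra. }
      assert (I2 : / D < 1.0011).
      { apply Rlt_le_trans with (/ 0.999); [apply Rinv_lt_contravar; nra|lra]. }
      assert (N : (x' / D)^2 + (y / D)^2 = / D).
      { replace ((x' / D)^2 + (y / D)^2) with ((x'^2 + y^2) / D^2) by (field; lra). fold D. field. lra. }
      assert (Yp : y <= y / D) by (unfold Rdiv; nra).
      (* Inversion enlarges x' <= 1/2 by a factor below 1.0011, so the image can pass Re z = 1/2
         only slightly. *)
      assert (Xp : 0 <= x' / D <= 0.5006) by (unfold Rdiv; split; nra).
      destruct (Rle_dec (x' / D) (1/2)) as [H3|H3].
      { apply HDG. unfold DG_closure. rewrite N. repeat split; lra. }
      assert (Hy2 : 0.749 <= y^2) by (unfold D in H2; nra).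
      assert (Y865 : 0.865 <= y) by nra.
      set (yy := y / D) in *. set (xx := x' / D) in *.
      (* The upper height bound follows from yy^2 = 1/D - xx^2 < 1.0011 - 1/4. *)
      apply Hbox; [|lra]. split; [lra|]. nra. }
  intros x y Hy.
  destruct (pow_lt_1_zero 0.999 ltac:(rewrite Rabs_right; lra) y Hy) as [k Hk].
  apply (Hind k). specialize (Hk k (le_n k)).
  rewrite Rabs_right in Hk by (apply Rle_ge, pow_le; lra). lra.
Qed.

(** Points at height 1 or more move horizontally to the imaginary axis and those between 0.877 and 1
    to the arc. The remaining corner is compared with i, a point of the axis. *)
Lemma Eb_lower_bound_DG (b ma mb : R) : 3.062 <= b ->
  (forall y, 1 <= y -> ma <= Eb b 0 y) ->
  (forall y, sqrt 3 / 2 <= y <= 1 -> mb <= Eb b (sqrt (1 - y^2)) y) ->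
  forall x y, DG_closure x y -> Rmin ma mb <= Eb b x y.
Proof.
  intros Hb Ha Hmb x y [Hy [Hn [Hx0 Hx1]]].
  assert (S3 : (sqrt 3)^2 = 3) by (apply pow2_sqrt; lra). assert (S0 := sqrt_pos 3).
  destruct (Rle_dec 1 y) as [H1|H1].
  { apply Rle_trans with ma; [apply Rmin_l|]. apply Rle_trans with (Eb b 0 y); [auto|].
    apply Eb_min_at_0; lra. }
  assert (Hy2 : 3/4 <= y^2) by nra.
  assert (Y865 : 0.865 <= y) by nra.
  destruct (Rle_dec 0.877 y) as [H2|H2].
  - apply Rle_trans with mb; [apply Rmin_r|].
    assert (Hys : sqrt 3 / 2 <= y <= 1) by (split; nra).
    apply Rle_trans with (Eb b (sqrt (1 - y^2)) y); [auto|].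
    assert (Hs : (sqrt (1 - y^2))^2 = 1 - y^2) by (apply pow2_sqrt; nra).
    assert (Hsp := sqrt_pos (1 - y^2)).
    apply Eb_min_at_arc; try lra. split; [assumption|]. apply Rnot_lt_le. intros C. nra.
  - apply Rle_trans with ma; [apply Rmin_l|]. apply Rle_trans with (Eb b 0 1); [apply Ha; lra|].
    (* |z| >= 1 and y < 0.877 give x^2 > 1 - 0.877^2 > 0.48^2. *)
    apply Eb_near_rho; [assumption|lra|]. split; [|lra]. nra.
Qed.

Theorem theorem3p2 :
  (forall b : R, 3062 / 1000 <= b ->
     exists m : R,
       is_min_on upper_half (Eb b) m /\
       is_min_on DG_closure (Eb b) m /\
       is_min_on Gamma (Eb b) m) /\
  (forall b : R, 3 <= b ->
     exists m : R,
       is_min_on (fun x y => DG_closure x y /\ 1 <= y) (Eb b) m /\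
       is_min_on Gamma_a (Eb b) m).
Proof.
  split; intros b Hb.
  - assert (Hb' : 3.062 <= b) by lra.
    destruct (Eb_min_exists_Gamma_a b ltac:(lra)) as [ya [Hya Ha]].
    destruct (Eb_min_exists_arc b) as [yb [Hyb Hmb]].
    set (ma := Eb b 0 ya) in *. set (mb := Eb b (sqrt (1 - yb^2)) yb) in *.
    assert (S3 : (sqrt 3)^2 = 3) by (apply pow2_sqrt; lra). assert (S0 := sqrt_pos 3).
    assert (LDG := Eb_lower_bound_DG b ma mb Hb' Ha Hmb).
    assert (LH : forall x y, 0 < y -> Rmin ma mb <= Eb b x y).
    { apply Eb_lower_bound_half_plane; [exact LDG|]. intros x y Hy Hx.
      apply Rle_trans with ma; [apply Rmin_l|]. apply Rle_trans with (Eb b 0 1); [apply Ha; lra|].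
      apply Eb_near_rho; assumption. }
    (* The minimizer on [Gamma] can be taken in the closed fundamental domain, so the lower bound
       [LH] on the half plane settles all three minima with one value. *)
    assert (Hatt : exists x y, Gamma x y /\ DG_closure x y /\ Eb b x y = Rmin ma mb).
    { unfold Rmin. destruct (Rle_dec ma mb).
      - exists 0, ya. split; [left; split; lra|].
        split; [unfold DG_closure; repeat split; try lra; nra|reflexivity].
      - assert (Hs : (sqrt (1 - yb^2))^2 = 1 - yb^2) by (apply pow2_sqrt; nra).
        assert (Hsp := sqrt_pos (1 - yb^2)).
        assert (1 <= sqrt 3) by nra. assert (3/4 <= yb^2) by nra.
        exists (sqrt (1 - yb^2)), yb. split; [right; unfold Gamma_b; repeat split; lra|].
        split; [unfold DG_closure; repeat split; try lra; nra|reflexivity]. }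
    destruct Hatt as [x [y [HG [HD E]]]].
    exists (Rmin ma mb). repeat split.
    + exists x, y. split; [apply HD|assumption].
    + intros x' y' H. apply LH. exact H.
    + exists x, y. auto.
    + exact LDG.
    + exists x, y. auto.
    + intros x' y' [[_ H]|[H _]]; apply LH; lra.
  - destruct (Eb_min_exists_Gamma_a b ltac:(lra)) as [ya [Hya Ha]].
    exists (Eb b 0 ya). repeat split.
    + exists 0, ya. unfold DG_closure. repeat split; try lra. nra.
    + intros x y [_ Hy]. apply Rle_trans with (Eb b 0 y); [auto|]. apply Eb_min_at_0; assumption.
    + exists 0, ya. unfold Gamma_a. auto.
    + intros x y [-> Hy]. auto.
Qed.
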